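(* Let $\Sigma$ be a Riemann surface and $X:\Sigma\to\mathbb{R}^3$ an immersion whose Gauss-Kronecker curvature is non-zero (at every point). Then $X(\Sigma)$ is an RT-surface if and only if there are holomorphic functions $f,g:U\subset\mathbb{C}\to\mathbb{C}$, where $U$ is a simply connected open set and $g'\neq 0$, such that $X(\Sigma)$ is locally parameterized by $$X=\frac{e^{\langle 1,f\rangle}}{2|g'|^2}\bigl(Tg'\overline{f'}-2g\langle g',gf'\rangle,\,-2\langle g',gf'\rangle\bigr)+e^{\langle 1,f\rangle}\,\frac{(2g,\,2-T)}{T},\qquad T=1+|g|^2,$$ with normal Gauss map $$N=\frac{(2g,\,1-|g|^2)}{1+|g|^2}.$$ The regularity condition of this parameterization is $$T^4\langle \xi,\,f'^2-\xi\rangle+4T^2|f'|^2|g'|^2+16|g'|^4\neq 0,\qquad \xi=f'\left(\frac{g''}{g'}-\frac{2}{T}g'\overline{g}\right)-f''.$$ Moreover, writing $h=e^{\langle 1,f\rangle}$, $A_1=\langle 1,f'\rangle^2-\langle 1,\xi\rangle$ and $A_2=\langle 1,if'\rangle^2+\langle 1,\xi\rangle$, the coefficients $E,F,G$ of the first fundamental form and $b_{11},b_{12},b_{22}$ of the second fundamental form of $X$ are $$E=h^2\left(\frac{T^2}{4|g'|^2}\Bigl(A_1^2+\bigl\langle i,\xi-\tfrac{f'^2}{2}\bigr\rangle^2\Bigr)+2A_1+\frac{4|g'|^2}{T^2}\right),$$ $$F=h^2\left(\frac{T^2|f'|^2}{4|g'|^2}+2\right)\bigl\langle i,\xi-\tfrac{f'^2}{2}\bigr\rangle,$$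 $$G=h^2\left(\frac{T^2}{4|g'|^2}\Bigl(A_2^2+\bigl\langle i,\xi-\tfrac{f'^2}{2}\bigr\rangle^2\Bigr)+2A_2+\frac{4|g'|^2}{T^2}\right),$$ $$b_{11}=hA_1+\frac{4h|g'|^2}{T^2},\qquad b_{12}=h\bigl\langle i,\xi-\tfrac{f'^2}{2}\bigr\rangle,\qquad b_{22}=hA_2+\frac{4h|g'|^2}{T^2}.$$
   Context: Identify $\mathbb{R}^3$ with $\mathbb{C}\times\mathbb{R}$, and write $z=u_1+iu_2$ for the coordinate on $U\subset\mathbb{C}\cong\mathbb{R}^2$; subscripts ${}_{,i}$ denote $\partial/\partial u_i$, and $'$ denotes the complex derivative. For complex numbers $a=a_1+ia_2$, $b=b_1+ib_2$, $\langle a,b\rangle=a_1b_1+a_2b_2$ is the real inner product (so $\langle 1,a\rangle=\operatorname{Re}a$, $\langle i,a\rangle=\operatorname{Im}a$). For an oriented surface $\Sigma\subset\mathbb{R}^3$ with unit normal (Gauss map) $N$, the support function is $\Psi(p)=\langle p,N(p)\rangle$ and the quadratic distance function is $\Lambda(p)=\langle p,p\rangle$. For a local parameterization $X$ the Weingarten matrix $W=(W_{ij})$ is defined by $N_{,i}=\sum_{j}W_{ij}X_{,j}$; the Gaussian (Gauss-Kronecker) curvature is $K=\det W$ and the mean curvature is $H=-\tfrac12\operatorname{tr}W$. The coefficients of the first and second fundamental forms are taken to be $E=\langle X_{,1},X_{,1}\rangle$, $F=\langle X_{,1},X_{,2}\rangle$, $G=\langle X_{,2},X_{,2}\rangle$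 and $b_{ij}=\langle X_{,i},N_{,j}\rangle$. A surface $\Sigma$ with $K\neq 0$ is a Ribaucour-type surface (RT-surface) if for each $p\in\Sigma$ the sphere with center $p+\left(\frac{H(p)}{K(p)}+\frac{\Psi(p)}{2}\right)N(p)$ and (signed) radius $\frac{H(p)}{K(p)}+\frac{\Psi(p)}{2}$ passes through the origin; equivalently, $2\Psi H+(\Lambda+\Psi^2)K=0$ on $\Sigma$.
   Formalization: The local parameterization is asserted only near points p with X(p)≠0 at which (0,-1) is not the unit normal N with ⟨X,N⟩>0; at the other points (e.g. the south pole of the unit sphere, an RT-surface) it is impossible, since the formulas force ⟨X,N⟩>0 and N≠(0,-1). *)

(* Defs.v *)
(* Stdlib reals with Coquelicot. *)
From Stdlib Require Import Reals.
From Coquelicot Require Import Coquelicot.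
Open Scope R_scope.

(** * The ambient space R^3 = C x R *)

Definition ip (a b : C) : R := Re a * Re b + Im a * Im b.

Definition R3 : Type := (C * R)%type.

Definition origin : R3 := (RtoC 0, 0).
Definition add3 (x y : R3) : R3 := (Cplus (fst x) (fst y), snd x + snd y).
Definition scal3 (t : R) (x : R3) : R3 :=
  (Cmult (RtoC t) (fst x), t * snd x).
Definition dot3 (x y : R3) : R := ip (fst x) (fst y) + snd x * snd y.
Definition norm3 (x : R3) : R := sqrt (dot3 x x).
Definition cross3 (x y : R3) : R3 :=
  ((Im (fst x) * snd y - snd x * Im (fst y),
    snd x * Re (fst y) - Re (fst x) * snd y),
   Re (fst x) * Im (fst y) - Im (fst x) * Re (fst y)).

(* The radius is signed. *)
Definition sphere (c : R3) (r : R) (q : R3) : Prop :=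
  norm3 (add3 q (scal3 (-1) c)) = Rabs r.

(** * Calculus on open subsets of C = R^2 *)

(* F_{,1} and F_{,2}, for z = u1 + i u2. *)
Definition d1 (F : C -> R) (z : C) : R := Derive (fun t => F (t, Im z)) (Re z).
Definition d2 (F : C -> R) (z : C) : R := Derive (fun t => F (Re z, t)) (Im z).

Definition D1 (Y : C -> R3) (z : C) : R3 :=
  ((d1 (fun w => Re (fst (Y w))) z, d1 (fun w => Im (fst (Y w))) z),
   d1 (fun w => snd (Y w)) z).
Definition D2 (Y : C -> R3) (z : C) : R3 :=
  ((d2 (fun w => Re (fst (Y w))) z, d2 (fun w => Im (fst (Y w))) z),
   d2 (fun w => snd (Y w)) z).

Fixpoint Ck_on (k : nat) (D : C -> Prop) (F : C -> R) : Prop :=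
  (forall z, D z -> continuous F z) /\
  match k with
  | O => True
  | S k' =>
      (forall z, D z ->
         ex_derive (fun t : R => F (t, Im z)) (Re z) /\
         ex_derive (fun t : R => F (Re z, t)) (Im z)) /\
      Ck_on k' D (d1 F) /\ Ck_on k' D (d2 F)
  end.

Definition smooth_on (D : C -> Prop) (F : C -> R) : Prop :=
  forall k, Ck_on k D F.

Definition smooth_onC (D : C -> Prop) (F : C -> C) : Prop :=
  smooth_on D (fun z => Re (F z)) /\ smooth_on D (fun z => Im (F z)).

Definition smooth_on3 (D : C -> Prop) (Y : C -> R3) : Prop :=
  smooth_onC D (fun z => fst (Y z)) /\ smooth_on D (fun z => snd (Y z)).

Definition holomorphic_on (D : C -> Prop) (F : C -> C) : Prop :=
  forall z, D z -> @ex_derive C_AbsRing C_NormedModule F z.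

(* Paths and homotopies are continuous maps on [0,1] and [0,1]^2; they are
   given by continuous maps on R and R^2, which loses no generality since one
   can precompose with the retraction of R onto [0,1]. *)
Definition in01 (t : R) : Prop := 0 <= t <= 1.

Definition is_path (D : C -> Prop) (gam : R -> C) : Prop :=
  (forall t, continuous gam t) /\ (forall t, in01 t -> D (gam t)).

Definition path_connected (D : C -> Prop) : Prop :=
  forall z w, D z -> D w -> exists gam, is_path D gam /\ gam 0 = z /\ gam 1 = w.

Definition null_homotopic (D : C -> Prop) (gam : R -> C) : Prop :=
  exists Hom : R * R -> C,
    (forall st, continuous Hom st) /\
    (forall s t, in01 s -> in01 t -> D (Hom (s, t))) /\
    (forall t, in01 t -> Hom (0, t) = gam t /\ Hom (1, t) = gam 0) /\
    (forall s, in01 s -> Hom (s, 0) = gam 0 /\ Hom (s, 1) = gam 0).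

Definition simply_connected (D : C -> Prop) : Prop :=
  (exists z, D z) /\ path_connected D /\
  (forall gam, is_path D gam -> gam 0 = gam 1 -> null_homotopic D gam).

(** * Parameterized surfaces in R^3 *)

Definition regular_at (Y : C -> R3) (z : C) : Prop :=
  forall s t : R,
    add3 (scal3 s (D1 Y z)) (scal3 t (D2 Y z)) = origin -> s = 0 /\ t = 0.

Definition unit_normal_at (Y : C -> R3) (z : C) (n : R3) : Prop :=
  norm3 n = 1 /\ dot3 n (D1 Y z) = 0 /\ dot3 n (D2 Y z) = 0.

Definition normal (Y : C -> R3) (z : C) : R3 :=
  let n := cross3 (D1 Y z) (D2 Y z) in scal3 (/ norm3 n) n.

Record mat2 : Type := Mat2 { m11 : R; m12 : R; m21 : R; m22 : R }.

(* N_{,i} = sum_j W_ij Y_{,j}; such a W exists and is unique at regular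
   points when N is a smooth unit normal field of Y. *)
Definition is_weingarten (Y N : C -> R3) (z : C) (W : mat2) : Prop :=
  D1 N z = add3 (scal3 (m11 W) (D1 Y z)) (scal3 (m12 W) (D2 Y z)) /\
  D2 N z = add3 (scal3 (m21 W) (D1 Y z)) (scal3 (m22 W) (D2 Y z)).

Definition gauss_curv (W : mat2) : R := m11 W * m22 W - m12 W * m21 W.
Definition mean_curv (W : mat2) : R := - (1 / 2) * (m11 W + m22 W).

Definition coefE (Y : C -> R3) (z : C) : R := dot3 (D1 Y z) (D1 Y z).
Definition coefF (Y : C -> R3) (z : C) : R := dot3 (D1 Y z) (D2 Y z).
Definition coefG (Y : C -> R3) (z : C) : R := dot3 (D2 Y z) (D2 Y z).
Definition coefb11 (Y N : C -> R3) (z : C) : R := dot3 (D1 Y z) (D1 N z).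
Definition coefb12 (Y N : C -> R3) (z : C) : R := dot3 (D1 Y z) (D2 N z).
Definition coefb22 (Y N : C -> R3) (z : C) : R := dot3 (D2 Y z) (D2 N z).

(** * Riemann surfaces *)

(* [coord] and [param] are mutually inverse bijections between [cdom] and
   [cimg]; their values elsewhere are irrelevant. *)
Record chart (M : Type) : Type := Chart {
  cdom : M -> Prop;
  cimg : C -> Prop;
  coord : M -> C;
  param : C -> M;
  cimg_open : open cimg;
  coord_img : forall p, cdom p -> cimg (coord p);
  param_dom : forall z, cimg z -> cdom (param z);
  param_coord : forall p, cdom p -> param (coord p) = p;
  coord_param : forall z, cimg z -> coord (param z) = z
}.
Arguments cdom {M} c p.
Arguments cimg {M} c z.
Arguments coord {M} c p.
Arguments param {M} c z.

Definition overlap {M : Type} (c c' : chart M) (z : C) : Prop :=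
  cimg c z /\ cdom c' (param c z).

Definition transition {M : Type} (c c' : chart M) (z : C) : C :=
  coord c' (param c z).

(* The topology for which all the charts of the atlas are homeomorphisms. *)
Definition atlas_open {M I : Type} (A : I -> chart M) (V : M -> Prop) : Prop :=
  forall i, open (fun z => cimg (A i) z /\ V (param (A i) z)).

Record RiemannSurface : Type := {
  carrier :> Type;
  index : Type;
  atlas : index -> chart carrier;
  atlas_cover : forall p, exists i, cdom (atlas i) p;
  atlas_overlap : forall i j, open (overlap (atlas i) (atlas j));
  atlas_holomorphic : forall i j,
    holomorphic_on (overlap (atlas i) (atlas j))
                   (transition (atlas i) (atlas j));
  atlas_hausdorff : forall p q, p <> q ->
    exists V W : carrier -> Prop,
      atlas_open atlas V /\ atlas_open atlas W /\ V p /\ W q /\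
      (forall x, ~ (V x /\ W x));
  atlas_connected : forall V : carrier -> Prop,
    atlas_open atlas V -> atlas_open atlas (fun x => ~ V x) ->
    (exists x, V x) -> forall x, V x
}.
Arguments atlas {r} i.

(* A chart of the smooth surface underlying S: its inverse [param c] is a
   diffeomorphism from [cimg c] onto an open subset of S.  It need not be a
   holomorphic chart. *)
Definition smooth_chart (S : RiemannSurface) (c : chart S) : Prop :=
  forall i : index S,
    open (overlap (atlas i) c) /\ open (overlap c (atlas i)) /\
    smooth_onC (overlap (atlas i) c) (transition (atlas i) c) /\
    smooth_onC (overlap c (atlas i)) (transition c (atlas i)).

(** * Immersed surfaces *)

Definition in_chart {S : RiemannSurface} (X : S -> R3) (c : chart S) : C -> R3 :=
  fun z => X (param c z).

Definition immersion {S : RiemannSurface} (X : S -> R3) : Prop :=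
  forall i : index S,
    smooth_on3 (cimg (atlas i)) (in_chart X (atlas i)) /\
    forall z, cimg (atlas i) z -> regular_at (in_chart X (atlas i)) z.

(* S is oriented by its complex structure, so on an immersed surface the
   normals computed in the various charts of the atlas agree.  Changing N
   to -N does not change K, nor the spheres in [RT_surface]. *)
Definition nonzero_curvature {S : RiemannSurface} (X : S -> R3) : Prop :=
  forall (i : index S) (z : C), cimg (atlas i) z ->
    let Y := in_chart X (atlas i) in
    exists W, is_weingarten Y (normal Y) z W /\ gauss_curv W <> 0.

Definition RT_surface {S : RiemannSurface} (X : S -> R3) : Prop :=
  forall (i : index S) (z : C), cimg (atlas i) z ->
    let Y := in_chart X (atlas i) in
    let N := normal Y in
    let Psi := dot3 (Y z) (N z) in
    exists W, is_weingarten Y N z W /\ gauss_curv W <> 0 /\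
      let r := mean_curv W / gauss_curv W + Psi / 2 in
      sphere (add3 (Y z) (scal3 r (N z))) r origin.

(** * The representation by holomorphic data *)

Definition holomorphic_data (U : C -> Prop) (f g : C -> C) : Prop :=
  open U /\ simply_connected U /\ holomorphic_on U f /\ holomorphic_on U g /\
  forall z, U z -> C_derive g z <> RtoC 0.

Definition RT_h (f : C -> C) (z : C) : R := exp (ip (RtoC 1) (f z)).

Definition RT_T (g : C -> C) (z : C) : R := 1 + Cmod (g z) ^ 2.

Definition RT_X (f g : C -> C) (z : C) : R3 :=
  let h := RT_h f z in
  let T := RT_T g z in
  let f' := C_derive f z in
  let g' := C_derive g z in
  let q := ip g' (g z * f')%C in
  add3 (scal3 (h / (2 * Cmod g' ^ 2))
          ((RtoC T * g' * Cconj f' - 2 * g z * RtoC q)%C, - 2 * q))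
       (scal3 (h / T) ((2 * g z)%C, 2 - T)).

Definition RT_N (g : C -> C) (z : C) : R3 :=
  scal3 (/ (1 + Cmod (g z) ^ 2)) ((2 * g z)%C, 1 - Cmod (g z) ^ 2).

Definition RT_xi (f g : C -> C) (z : C) : C :=
  let f' := C_derive f in
  let g' := C_derive g in
  (f' z * (C_derive g' z / g' z - 2 / RtoC (RT_T g z) * g' z * Cconj (g z))
   - C_derive f' z)%C.

Definition RT_A1 (f g : C -> C) (z : C) : R :=
  ip (RtoC 1) (C_derive f z) ^ 2 - ip (RtoC 1) (RT_xi f g z).

Definition RT_A2 (f g : C -> C) (z : C) : R :=
  ip (RtoC 1) (Ci * C_derive f z)%C ^ 2 + ip (RtoC 1) (RT_xi f g z).

Definition RT_B (f g : C -> C) (z : C) : R :=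
  ip Ci (RT_xi f g z - C_derive f z ^ 2 / 2)%C.

Definition locally_represented {S : RiemannSurface} (X : S -> R3) (p : S) : Prop :=
  exists (U : C -> Prop) (f g : C -> C) (c : chart S),
    holomorphic_data U f g /\
    smooth_chart S c /\ (forall z, cimg c z <-> U z) /\ cdom c p /\
    forall z, U z ->
      in_chart X c z = RT_X f g z /\
      unit_normal_at (in_chart X c) z (RT_N g z).

(* Since <RT_X, RT_N> = RT_h > 0 and RT_N never takes the value (0,-1), no
   surface is represented near a point p with X p = 0, nor near a point where
   (0,-1) is the unit normal that has positive support function; and there are
   RT-surfaces with such points.  The unit sphere has a point of the second
   kind.  The envelope Psi N + grad Psi on the sphere near (0,1), with
   Psi = |w|^2 in the stereographic coordinate w, is an RT-surface with a
   point of the first kind. *)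
Definition exceptional_point {S : RiemannSurface} (X : S -> R3) (p : S) : Prop :=
  let south : R3 := (RtoC 0, -1) in
  X p = origin \/
  (0 < dot3 (X p) south /\
   exists i : index S, cdom (atlas i) p /\
     unit_normal_at (in_chart X (atlas i)) (coord (atlas i) p) south).

(* Main.v *)
From Stdlib Require Import Reals Lra Lia Psatz Classical ClassicalEpsilon.
From Stdlib Require Import FunctionalExtensionality.
From Coquelicot Require Import Coquelicot.
Require Import Defs.
Open Scope R_scope.

(** Why the theorem is true.  A surface with K <> 0 is locally parameterized by
    its Gauss map, and is recovered from its support function psi = <X, N>,
    seen as a function on the sphere, as the envelope X = psi N + grad psi.  In
    a coordinate w in which N is conformal, with |N_i|^2 = lam, the inverse of
    the Weingarten matrix has trace (<X_1, N_1> + <X_2, N_2>) / lam, so that the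
    RT-condition 2 Psi H + (Lambda + Psi^2) K = 0 becomes
    lam (Lambda + psi^2) = psi (<X_1, N_1> + <X_2, N_2>).  Here the second
    fundamental form is the Hessian of psi plus psi times the metric and
    Lambda = psi^2 + |grad psi|^2, and what is left is
    psi Laplace(psi) = |grad psi|^2: the logarithm of psi is harmonic.  So
    psi = exp (Re f) with f holomorphic, and writing the envelope in terms of f
    and of the stereographic coordinate g of N gives the formula of the
    representation.

    From the representation to the condition, [RT_second_form] computes the
    second fundamental form by differentiating <X, N> = h and <X, N_i> = h_i;
    the first fundamental form and the regularity condition follow because
    N, N_1, N_2 is an orthogonal frame ([RT_parseval]).  The condition is carried
    from the chart of the representation to the charts of the atlas by
    [RT_transfer], since trace and determinant of the Weingarten matrix do not
    depend on coordinates.  At an exceptional point either X = 0 and the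
    condition is trivial, or N is vertical; since N is an immersion it is not
    vertical at nearby points of a coordinate line, and the condition passes to
    the limit ([exceptional_RT_poly]).

    Conversely, at a non-exceptional point of an RT-surface psi does not vanish,
    and the unit normal for which it is positive is not (0, -1).  By K <> 0 and
    the inverse function theorem ([local_inverse]) its stereographic coordinate
    is a chart; in this chart g(w) = w, and f is a holomorphic function with
    real part ln psi on a square ([RT_envelope_representation]).

    The functions f and g are only assumed complex differentiable, while the
    formulas contain f'' and g''.  That the derivative of a holomorphic function
    is holomorphic ([derivative_holomorphic]) is proved in real terms: Goursat's
    bisection gives local primitives of closed 1-forms with differentiable
    coefficients, a primitive F of f is continuously differentiable, and Cauchy's
    formula for F' as an average of F over circles of fixed radius shows that F'
    is as regular as F.  Primitives of closed 1-forms also give the harmonic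
    conjugate of ln psi. *)

(** * Gradients and C^k functions of two real variables *)

Lemma open_contains_box (D : C -> Prop) (z : C) : open D -> D z ->
  exists d : posreal, forall w : C,
    Rabs (Re w - Re z) < d -> Rabs (Im w - Im z) < d -> D w.
Proof.
intros oD Dz; destruct (oD z Dz) as [d Hd]; exists d.
intros w h1 h2; apply Hd; split; assumption.
Qed.

Lemma open_of_boxes (D : C -> Prop) :
  (forall z, D z -> exists d : posreal, forall w : C,
    Rabs (Re w - Re z) < d -> Rabs (Im w - Im z) < d -> D w) -> open D.
Proof.
intros H z Dz; destruct (H z Dz) as [d Hd]; exists d.
intros w [h1 h2]; apply Hd; assumption.
Qed.

Lemma continuous_eps (F : C -> R) (z : C) :
  continuous F z <-> forall eps : posreal, exists d : posreal, forall w : C,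
    Rabs (Re w - Re z) < d -> Rabs (Im w - Im z) < d -> Rabs (F w - F z) < eps.
Proof.
split.
- intros cF eps.
  destruct (cF _ (locally_ball (F z) eps)) as [d Hd]; exists d.
  intros w h1 h2; exact (Hd w (conj h1 h2)).
- intros H P [eps HP]; destruct (H eps) as [d Hd]; exists d.
  intros w [h1 h2]; apply HP; apply (Hd w h1 h2).
Qed.

Lemma continuous_2d (F : C -> R) (x y : R) :
  continuous F (x, y) <-> continuity_2d_pt (fun x y => F (x, y)) x y.
Proof.
rewrite continuous_eps; split.
- intros H eps; destruct (H eps) as [d Hd]; exists d.
  intros u v h1 h2; exact (Hd (u, v) h1 h2).
- intros H eps; destruct (H eps) as [d Hd]; exists d.
  intros [u v] h1 h2; exact (Hd u v h1 h2).
Qed.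

(** Total differentiability at z with partial derivatives a and b: unlike the
    existence of partial derivatives it is stable under composition. *)
Definition has_grad (F : C -> R) (z : C) (a b : R) : Prop :=
  differentiable_pt_lim (fun x y => F (x, y)) (Re z) (Im z) a b.

Lemma C_eta (z : C) : (Re z, Im z) = z.
Proof. now destruct z. Qed.

Lemma has_grad_eq (F : C -> R) (z : C) (a b a' b' : R) :
  has_grad F z a b -> a = a' -> b = b' -> has_grad F z a' b'.
Proof. now intros H <- <-. Qed.

Lemma has_grad_ext_on (D : C -> Prop) (F G : C -> R) (z : C) (a b : R) :
  open D -> D z -> (forall w, D w -> F w = G w) ->
  has_grad F z a b -> has_grad G z a b.
Proof.
intros oD Dz E; destruct (open_contains_box D z oD Dz) as [d Hd].
apply differentiable_pt_lim_ext; exists d; intros u v h1 h2.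
apply E, Hd; assumption.
Qed.

Lemma has_grad_ext (F G : C -> R) (z : C) (a b : R) :
  (forall w, F w = G w) -> has_grad F z a b -> has_grad G z a b.
Proof.
intros E; apply (has_grad_ext_on (fun _ => True)); auto using open_true.
Qed.

Lemma has_grad_d1 (F : C -> R) (z : C) (a b : R) : has_grad F z a b -> d1 F z = a.
Proof. intros H; apply (differentiable_pt_lim_unique _ _ _ _ _ H). Qed.

Lemma has_grad_d2 (F : C -> R) (z : C) (a b : R) : has_grad F z a b -> d2 F z = b.
Proof. intros H; apply (differentiable_pt_lim_unique _ _ _ _ _ H). Qed.

Lemma has_grad_unique (F : C -> R) (z : C) (a b a' b' : R) :
  has_grad F z a b -> has_grad F z a' b' -> a = a' /\ b = b'.
Proof.
intros H H'; split.
- now rewrite <- (has_grad_d1 _ _ _ _ H), <- (has_grad_d1 _ _ _ _ H').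
- now rewrite <- (has_grad_d2 _ _ _ _ H), <- (has_grad_d2 _ _ _ _ H').
Qed.

Lemma has_grad_continuous (F : C -> R) (z : C) (a b : R) :
  has_grad F z a b -> continuous F z.
Proof.
intros H; destruct z as [x y]; apply continuous_2d.
apply differentiable_continuity_pt; exists a, b; exact H.
Qed.

Lemma has_grad_curve (F : C -> R) (a b : R -> R) (t p q p' q' : R) :
  has_grad F (a t, b t) p q -> is_derive a t p' -> is_derive b t q' ->
  is_derive (fun t => F (a t, b t)) t (p * p' + q * q').
Proof.
intros H ha hb; apply is_derive_Reals.
apply is_derive_Reals in ha; apply is_derive_Reals in hb.
exact (derivable_pt_lim_comp_2d (fun x y => F (x, y)) a b t p q p' q' H ha hb).
Qed.

Lemma has_grad_partial1 (F : C -> R) (x y a b : R) :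
  has_grad F (x, y) a b -> is_derive (fun t => F (t, y)) x a.
Proof.
intros H.
assert (E := has_grad_curve F (fun t => t) (fun _ => y) x a b 1 0 H
  (is_derive_id x) (is_derive_const y x)).
now replace a with (a * 1 + b * 0) by ring.
Qed.

Lemma has_grad_partial2 (F : C -> R) (x y a b : R) :
  has_grad F (x, y) a b -> is_derive (fun t => F (x, t)) y b.
Proof.
intros H.
assert (E := has_grad_curve F (fun _ => x) (fun t => t) y a b 0 1 H
  (is_derive_const x y) (is_derive_id y)).
now replace b with (a * 0 + b * 1) by ring.
Qed.

Lemma has_grad_affine (F : C -> R) (z : C) (a b : R) :
  (forall u v, F (u, v) = F (Re z, Im z) + (a * (u - Re z) + b * (v - Im z))) ->
  has_grad F z a b.
Proof.
intros H eps; exists eps; intros u v _ _; rewrite (H u v).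
match goal with |- Rabs ?x <= _ => replace x with 0 by ring end; rewrite Rabs_R0.
apply Rmult_le_pos; [left; apply eps|].
eapply Rle_trans; [apply Rabs_pos | apply Rmax_l].
Qed.

Lemma has_grad_const (c : R) (z : C) : has_grad (fun _ => c) z 0 0.
Proof. apply has_grad_affine; intros; ring. Qed.

Lemma has_grad_Re (z : C) : has_grad Re z 1 0.
Proof. apply has_grad_affine; intros; simpl; ring. Qed.

Lemma has_grad_Im (z : C) : has_grad Im z 0 1.
Proof. apply has_grad_affine; intros; simpl; ring. Qed.

Lemma has_grad_comp2 (G A B : C -> R) (z : C) (a b a1 a2 b1 b2 : R) :
  has_grad G (A z, B z) a b -> has_grad A z a1 a2 -> has_grad B z b1 b2 ->
  has_grad (fun w => G (A w, B w)) z (a * a1 + b * b1) (a * a2 + b * b2).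
Proof.
destruct z as [x y]; intros hG hA hB.
exact (differentiable_pt_lim_comp (fun x y => G (x, y)) (fun x y => A (x, y))
  (fun x y => B (x, y)) x y a b a1 a2 b1 b2 hG hA hB).
Qed.

Lemma has_grad_comp1 (phi : R -> R) (A : C -> R) (z : C) (l a1 a2 : R) :
  is_derive phi (A z) l -> has_grad A z a1 a2 ->
  has_grad (fun w => phi (A w)) z (l * a1) (l * a2).
Proof.
intros hp hA; apply is_derive_Reals in hp.
apply has_grad_eq with (l * a1 + 0 * a1) (l * a2 + 0 * a2); try ring.
refine (has_grad_comp2 (fun w => phi (Re w)) A A z l 0 a1 a2 a1 a2 _ hA hA).
exact (differentiable_pt_lim_proj1_0 phi (A z) (A z) l hp).
Qed.

Lemma has_grad_plus (F G : C -> R) (z : C) (a b a' b' : R) :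
  has_grad F z a b -> has_grad G z a' b' ->
  has_grad (fun w => F w + G w) z (a + a') (b + b').
Proof.
intros hF hG.
apply has_grad_eq with (1 * a + 1 * a') (1 * b + 1 * b'); try ring.
refine (has_grad_comp2 (fun w => Re w + Im w) F G z 1 1 _ _ _ _ _ hF hG).
apply has_grad_affine; intros; simpl; ring.
Qed.

Lemma has_grad_mult (F G : C -> R) (z : C) (a b a' b' : R) :
  has_grad F z a b -> has_grad G z a' b' ->
  has_grad (fun w => F w * G w) z (a * G z + F z * a') (b * G z + F z * b').
Proof.
intros hF hG.
apply has_grad_eq with (G z * a + F z * a') (G z * b + F z * b'); try ring.
refine (has_grad_comp2 (fun w => Re w * Im w) F G z (G z) (F z) _ _ _ _ _ hF hG).
intros eps; exists eps; intros u v h1 h2; simpl in *.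
replace (_ - _) with ((u - F z) * (v - G z)) by ring; rewrite Rabs_mult.
apply Rmult_le_compat; try apply Rabs_pos; [now left | apply Rmax_r].
Qed.

Lemma has_grad_opp (F : C -> R) (z : C) (a b : R) :
  has_grad F z a b -> has_grad (fun w => - F w) z (- a) (- b).
Proof.
intros hF; apply has_grad_eq with ((-1) * a) ((-1) * b); try ring.
apply (has_grad_comp1 Ropp); [|assumption].
auto_derive; auto; ring.
Qed.

Lemma has_grad_minus (F G : C -> R) (z : C) (a b a' b' : R) :
  has_grad F z a b -> has_grad G z a' b' ->
  has_grad (fun w => F w - G w) z (a - a') (b - b').
Proof. intros hF hG; apply has_grad_plus; [|apply has_grad_opp]; assumption. Qed.

Lemma has_grad_inv (F : C -> R) (z : C) (a b : R) :
  F z <> 0 -> has_grad F z a b ->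
  has_grad (fun w => / F w) z (- / F z ^ 2 * a) (- / F z ^ 2 * b).
Proof.
intros nz hF; apply (has_grad_comp1 Rinv); [|assumption].
auto_derive; auto; field; auto.
Qed.

Lemma has_grad_div (F G : C -> R) (z : C) (a b a' b' : R) :
  G z <> 0 -> has_grad F z a b -> has_grad G z a' b' ->
  has_grad (fun w => F w / G w) z ((a * G z - F z * a') / G z ^ 2)
    ((b * G z - F z * b') / G z ^ 2).
Proof.
intros nz hF hG.
eapply has_grad_eq; [exact (has_grad_mult _ _ _ _ _ _ _ hF
  (has_grad_inv _ _ _ _ nz hG)) | |]; simpl; field; assumption.
Qed.

(** By the mean value theorem in the first variable, where the partial
    derivative is known nearby; the second variable only enters at the point. *)
Lemma has_grad_of_partials (D : C -> Prop) (F F1 : C -> R) (z : C) (b : R) :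
  open D -> D z ->
  (forall w, D w -> is_derive (fun t => F (t, Im w)) (Re w) (F1 w)) ->
  is_derive (fun t => F (Re z, t)) (Im z) b ->
  continuous F1 z -> has_grad F z (F1 z) b.
Proof.
intros oD Dz H1 H2 c1; destruct z as [x y].
apply filterdiff_differentiable_pt_lim.
refine (is_derive_filterdiff (fun x y => F (x, y)) x y (fun x y => F1 (x, y)) b
  _ H2 _).
- destruct (open_contains_box D _ oD Dz) as [d Hd]; exists d.
  intros [u v] [h1 h2]; exact (H1 (u, v) (Hd (u, v) h1 h2)).
- eapply continuous_ext; [|exact c1]; now intros [u v].
Qed.

Lemma Ck_continuous k D F z : Ck_on k D F -> D z -> continuous F z.
Proof. destruct k; intros [H _]; apply H. Qed.

Lemma Ck_d1 k D F : Ck_on (S k) D F -> Ck_on k D (d1 F).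
Proof. intros [_ [_ [H _]]]; exact H. Qed.

Lemma Ck_d2 k D F : Ck_on (S k) D F -> Ck_on k D (d2 F).
Proof. intros [_ [_ [_ H]]]; exact H. Qed.

Lemma continuous_ext_on (D : C -> Prop) (F G : C -> R) (z : C) :
  open D -> D z -> (forall w, D w -> F w = G w) -> continuous F z -> continuous G z.
Proof.
intros oD Dz E; apply continuous_ext_loc.
destruct (oD z Dz) as [d Hd]; exists d; intros w hw; apply E, Hd, hw.
Qed.

Lemma d1_ext_on (D : C -> Prop) (F G : C -> R) (z : C) :
  open D -> D z -> (forall w, D w -> F w = G w) -> d1 F z = d1 G z.
Proof.
intros oD Dz E; apply Derive_ext_loc.
destruct (open_contains_box D z oD Dz) as [d Hd]; exists d; intros t ht.
apply E, Hd; simpl; [exact ht|].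
unfold Rminus; rewrite Rplus_opp_r, Rabs_R0; apply d.
Qed.

Lemma d2_ext_on (D : C -> Prop) (F G : C -> R) (z : C) :
  open D -> D z -> (forall w, D w -> F w = G w) -> d2 F z = d2 G z.
Proof.
intros oD Dz E; apply Derive_ext_loc.
destruct (open_contains_box D z oD Dz) as [d Hd]; exists d; intros t ht.
apply E, Hd; simpl; [|exact ht].
unfold Rminus; rewrite Rplus_opp_r, Rabs_R0; apply d.
Qed.

Lemma Ck_grad k D F z : open D -> Ck_on (S k) D F -> D z ->
  has_grad F z (d1 F z) (d2 F z).
Proof.
intros oD [_ [H [C1 C2]]] Dz.
apply (has_grad_of_partials D); auto.
- intros w Dw; apply Derive_correct, H, Dw.
- apply Derive_correct, H, Dz.
- apply (Ck_continuous k D); assumption.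
Qed.

Lemma Ck_ext k D F G : open D -> (forall w, D w -> F w = G w) ->
  Ck_on k D F -> Ck_on k D G.
Proof.
intros oD; revert F G; induction k as [|k IH]; intros F G E.
- intros [c _]; split; [|exact I].
  intros z Dz; apply (continuous_ext_on D F); auto.
- intros H; assert (H' := H); destruct H' as [c [_ [h1 h2]]].
  assert (hg : forall z, D z -> has_grad G z (d1 F z) (d2 F z)).
  { intros z Dz; apply (has_grad_ext_on D F); auto; apply (Ck_grad k D); auto. }
  split; [|split; [|split]].
  + intros z Dz; apply (has_grad_continuous _ _ _ _ (hg z Dz)).
  + intros [x y] Dz; split.
    * eexists; exact (has_grad_partial1 _ _ _ _ _ (hg _ Dz)).
    * eexists; exact (has_grad_partial2 _ _ _ _ _ (hg _ Dz)).
  + apply (IH (d1 F)); auto; intros w Dw; apply (d1_ext_on D); auto.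
  + apply (IH (d2 F)); auto; intros w Dw; apply (d2_ext_on D); auto.
Qed.

(** Reduces the closure properties of [Ck_on] to an induction on k.  The partial
    derivatives in its definition may be replaced by any functions that give
    the gradient on D, since outside D nothing is known about [d1 F]. *)
Lemma Ck_intro k D F F1 F2 : open D ->
  (forall z, D z -> has_grad F z (F1 z) (F2 z)) ->
  Ck_on k D F1 -> Ck_on k D F2 -> Ck_on (S k) D F.
Proof.
intros oD hg h1 h2; split; [|split; [|split]].
- intros z Dz; apply (has_grad_continuous _ _ _ _ (hg z Dz)).
- intros [x y] Dz; split.
  + eexists; exact (has_grad_partial1 _ _ _ _ _ (hg _ Dz)).
  + eexists; exact (has_grad_partial2 _ _ _ _ _ (hg _ Dz)).
- apply (Ck_ext k D F1); auto; intros w Dw; symmetry.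
  apply (has_grad_d1 _ _ _ _ (hg w Dw)).
- apply (Ck_ext k D F2); auto; intros w Dw; symmetry.
  apply (has_grad_d2 _ _ _ _ (hg w Dw)).
Qed.

Lemma Ck_pred k D F : Ck_on (S k) D F -> Ck_on k D F.
Proof.
revert F; induction k as [|k IH]; intros F [c [e [h1 h2]]].
- split; auto.
- split; [auto | split; [auto | split; apply IH; assumption]].
Qed.

Lemma Ck_sub k (D D' : C -> Prop) F : (forall z, D' z -> D z) ->
  Ck_on k D F -> Ck_on k D' F.
Proof.
intros sub; revert F; induction k as [|k IH]; intros F.
- intros [c _]; split; auto.
- intros [c [e [h1 h2]]]; split; [auto | split; [auto | split; auto]].
Qed.

Lemma Ck_const k D c : open D -> Ck_on k D (fun _ => c).
Proof.
intros oD; revert c; induction k as [|k IH]; intros c.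
- split; [|exact I]; intros z _; apply continuous_const.
- apply (Ck_intro k D _ (fun _ => 0) (fun _ => 0)); auto.
  intros z _; apply has_grad_const.
Qed.

Lemma Ck_Re k D : open D -> Ck_on k D Re.
Proof.
intros oD; destruct k.
- split; [|exact I]; intros z _; exact (has_grad_continuous _ _ _ _ (has_grad_Re z)).
- apply (Ck_intro k D _ (fun _ => 1) (fun _ => 0)); auto using Ck_const.
  intros z _; apply has_grad_Re.
Qed.

Lemma Ck_Im k D : open D -> Ck_on k D Im.
Proof.
intros oD; destruct k.
- split; [|exact I]; intros z _; exact (has_grad_continuous _ _ _ _ (has_grad_Im z)).
- apply (Ck_intro k D _ (fun _ => 0) (fun _ => 1)); auto using Ck_const.
  intros z _; apply has_grad_Im.
Qed.

Lemma Ck_plus k D F G : open D -> Ck_on k D F -> Ck_on k D G ->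
  Ck_on k D (fun z => F z + G z).
Proof.
intros oD; revert F G; induction k as [|k IH]; intros F G hF hG.
- split; [|exact I]; intros z Dz.
  apply (continuous_plus (V := R_NormedModule)); [apply hF|apply hG]; assumption.
- apply (Ck_intro k D _ (fun z => d1 F z + d1 G z) (fun z => d2 F z + d2 G z)); auto.
  + intros z Dz; apply has_grad_plus; apply (Ck_grad k D); auto.
  + apply IH; auto using Ck_d1.
  + apply IH; auto using Ck_d2.
Qed.

Lemma Ck_mult k D F G : open D -> Ck_on k D F -> Ck_on k D G ->
  Ck_on k D (fun z => F z * G z).
Proof.
intros oD; revert F G; induction k as [|k IH]; intros F G hF hG.
- split; [|exact I]; intros z Dz.
  apply (continuous_mult (K := R_AbsRing)); [apply hF|apply hG]; assumption.
- apply (Ck_intro k D _ (fun z => d1 F z * G z + F z * d1 G z)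
    (fun z => d2 F z * G z + F z * d2 G z)); auto.
  + intros z Dz; apply has_grad_mult; apply (Ck_grad k D); auto.
  + apply Ck_plus; auto; apply IH; auto using Ck_d1, Ck_pred.
  + apply Ck_plus; auto; apply IH; auto using Ck_d2, Ck_pred.
Qed.

Lemma Ck_sq k D F : open D -> Ck_on k D F -> Ck_on k D (fun z => F z ^ 2).
Proof.
intros oD hF; apply (Ck_ext k D (fun z => F z * F z)); auto using Ck_mult.
intros w _; ring.
Qed.

Lemma Ck_opp k D F : open D -> Ck_on k D F -> Ck_on k D (fun z => - F z).
Proof.
intros oD hF; apply (Ck_ext k D (fun z => (-1) * F z)); auto.
- intros w _; ring.
- apply Ck_mult; auto using Ck_const.
Qed.

Lemma Ck_minus k D F G : open D -> Ck_on k D F -> Ck_on k D G ->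
  Ck_on k D (fun z => F z - G z).
Proof. intros oD hF hG; apply Ck_plus; auto using Ck_opp. Qed.

Lemma Ck_inv k D F : open D -> (forall z, D z -> F z <> 0) -> Ck_on k D F ->
  Ck_on k D (fun z => / F z).
Proof.
intros oD nz; induction k as [|k IH]; intros hF.
- split; [|exact I]; intros z Dz.
  apply (continuous_comp F Rinv); [apply hF; assumption|].
  apply (ex_derive_continuous (K := R_AbsRing) Rinv); auto_derive; auto.
- assert (hi := IH (Ck_pred _ _ _ hF)).
  apply (Ck_intro k D _ (fun z => - (/ F z * / F z) * d1 F z)
    (fun z => - (/ F z * / F z) * d2 F z)); auto.
  + intros z Dz; eapply has_grad_eq;
      [apply has_grad_inv; [apply nz, Dz | apply (Ck_grad k D); auto] | |];
      field; auto.
  + apply Ck_mult; auto using Ck_d1, Ck_d2.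
    apply Ck_opp; auto; apply Ck_mult; auto.
  + apply Ck_mult; auto using Ck_d1, Ck_d2.
    apply Ck_opp; auto; apply Ck_mult; auto.
Qed.

Lemma Ck_div k D F G : open D -> (forall z, D z -> G z <> 0) ->
  Ck_on k D F -> Ck_on k D G -> Ck_on k D (fun z => F z / G z).
Proof. intros oD nz hF hG; apply Ck_mult; auto using Ck_inv. Qed.

Lemma Ck_sqrt k D F : open D -> (forall z, D z -> 0 < F z) -> Ck_on k D F ->
  Ck_on k D (fun z => sqrt (F z)).
Proof.
intros oD pos; induction k as [|k IH]; intros hF.
- split; [|exact I]; intros z Dz.
  apply (continuous_comp F sqrt); [apply hF; assumption | apply continuous_sqrt].
- assert (hi : Ck_on k D (fun z => / (2 * sqrt (F z)))).
  { apply Ck_inv; auto.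
    - intros z Dz; assert (h := sqrt_lt_R0 _ (pos z Dz)); lra.
    - apply Ck_mult; auto using Ck_const; apply IH, Ck_pred, hF. }
  apply (Ck_intro k D _ (fun z => / (2 * sqrt (F z)) * d1 F z)
    (fun z => / (2 * sqrt (F z)) * d2 F z)); auto.
  + intros z Dz; apply (has_grad_comp1 sqrt); [|apply (Ck_grad k D); auto].
    assert (h := pos z Dz); auto_derive; auto; field.
    now apply Rgt_not_eq, sqrt_lt_R0.
  + apply Ck_mult; auto using Ck_d1, Ck_d2.
  + apply Ck_mult; auto using Ck_d1, Ck_d2.
Qed.

Lemma Ck_comp k (D D' : C -> Prop) G A B : open D -> open D' ->
  (forall z, D z -> D' (A z, B z)) ->
  Ck_on k D' G -> Ck_on k D A -> Ck_on k D B ->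
  Ck_on k D (fun z => G (A z, B z)).
Proof.
intros oD oD' maps; revert G; induction k as [|k IH]; intros G hG hA hB.
- split; [|exact I]; intros z Dz.
  apply (continuous_comp_2 A B (fun x y => G (x, y))); [apply hA|apply hB|]; auto.
  eapply continuous_ext; [|apply hG; apply (maps z Dz)]; now intros [u v].
- apply (Ck_intro k D _ (fun z => d1 G (A z, B z) * d1 A z + d2 G (A z, B z) * d1 B z)
    (fun z => d1 G (A z, B z) * d2 A z + d2 G (A z, B z) * d2 B z)); auto.
  + intros z Dz; apply (has_grad_comp2 G); [apply (Ck_grad k D') | apply (Ck_grad k D)
      | apply (Ck_grad k D)]; auto.
  + apply Ck_plus; auto; apply Ck_mult; auto using Ck_d1;
      apply IH; auto using Ck_d1, Ck_d2, Ck_pred.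
  + apply Ck_plus; auto; apply Ck_mult; auto using Ck_d2;
      apply IH; auto using Ck_d1, Ck_d2, Ck_pred.
Qed.

(** * Complex derivatives and Goursat's theorem *)

Lemma Cmod_le_2max (w : C) : Cmod w <= 2 * Rmax (Rabs (Re w)) (Rabs (Im w)).
Proof.
eapply Rle_trans; [apply Cmod_2Rmax|].
apply Rmult_le_compat_r.
- eapply Rle_trans; [apply Rabs_pos | apply Rmax_l].
- rewrite <- (sqrt_square 2) at 2 by lra; apply sqrt_le_1; lra.
Qed.

Lemma Re_le_Cmod (w : C) : Rabs (Re w) <= Cmod w.
Proof. eapply Rle_trans; [apply Rmax_l | apply Rmax_Cmod]. Qed.

Lemma Im_le_Cmod (w : C) : Rabs (Im w) <= Cmod w.
Proof. eapply Rle_trans; [apply Rmax_r | apply Rmax_Cmod]. Qed.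

Lemma C_locally_square (P : C -> Prop) (z : C) :
  @locally (AbsRing_UniformSpace C_AbsRing) z P ->
  exists d : posreal, forall w : C,
    Rabs (Re w - Re z) < d -> Rabs (Im w - Im z) < d -> P w.
Proof.
intros [d Hd].
assert (d2 : 0 < d / 2) by (assert (h := cond_pos d); lra).
exists (mkposreal _ d2); simpl; intros w h1 h2; apply Hd.
change (Cmod (w - z) < d).
eapply Rle_lt_trans; [apply Cmod_le_2max|].
assert (Rmax (Rabs (Re (w - z))) (Rabs (Im (w - z))) < d / 2)
  by (apply Rmax_lub_lt; assumption); lra.
Qed.

Lemma C_square_locally (P : C -> Prop) (z : C) (d : posreal) :
  (forall w : C, Rabs (Re w - Re z) < d -> Rabs (Im w - Im z) < d -> P w) ->
  @locally (AbsRing_UniformSpace C_AbsRing) z P.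
Proof.
intros H; exists d; intros w hw.
change (Cmod (w - z) < d) in hw; apply H.
- eapply Rle_lt_trans; [exact (Re_le_Cmod (w - z)) | exact hw].
- eapply Rle_lt_trans; [exact (Im_le_Cmod (w - z)) | exact hw].
Qed.

(** The real form of complex differentiability: the gradients of the real and
    imaginary parts satisfy the Cauchy-Riemann equations. *)
Lemma C_derive_grad (f : C -> C) (z l : C) :
  @is_derive C_AbsRing C_NormedModule f z l ->
  has_grad (fun w => Re (f w)) z (Re l) (- Im l) /\
  has_grad (fun w => Im (f w)) z (Im l) (Re l).
Proof.
intros [_ H]; specialize (H z (fun P h => h)).
assert (K : forall eps : posreal, exists d : posreal, forall w : C,
  Rabs (Re w - Re z) < d -> Rabs (Im w - Im z) < d ->
  Cmod (f w - f z - (w - z) * l)%C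
    <= eps * Rmax (Rabs (Re w - Re z)) (Rabs (Im w - Im z))).
{ intros eps; assert (e2 : 0 < eps / 2) by (assert (h := cond_pos eps); lra).
  destruct (C_locally_square _ _ (H (mkposreal _ e2))) as [d Hd].
  exists d; intros w h1 h2; specialize (Hd w h1 h2).
  change (Cmod (f w - f z - (w - z) * l)%C <= eps / 2 * Cmod (w - z)%C) in Hd.
  eapply Rle_trans; [exact Hd|].
  replace (eps * _) with
    (eps / 2 * (2 * Rmax (Rabs (Re w - Re z)) (Rabs (Im w - Im z)))) by field.
  apply Rmult_le_compat_l; [lra | exact (Cmod_le_2max (w - z))]. }
split; intros eps; destruct (K eps) as [d Hd]; exists d; intros u v h1 h2;
  specialize (Hd (u, v) h1 h2); (eapply Rle_trans; [|exact Hd]).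
- eapply Rle_trans; [|apply Re_le_Cmod]; right; apply (f_equal Rabs).
  destruct z as [x y], l as [a b]; unfold Re, Im; simpl; ring.
- eapply Rle_trans; [|apply Im_le_Cmod]; right; apply (f_equal Rabs).
  destruct z as [x y], l as [a b]; unfold Re, Im; simpl; ring.
Qed.

Lemma grad_C_derive (f : C -> C) (z : C) (a b : R) :
  has_grad (fun w => Re (f w)) z a (- b) ->
  has_grad (fun w => Im (f w)) z b a ->
  @is_derive C_AbsRing C_NormedModule f z (a, b).
Proof.
intros h1 h2; split; [apply is_linear_scal_l|].
intros x hx; assert (hx' : z = x) by
  (apply (is_filter_lim_locally_unique (K := C_AbsRing)
     (V := AbsRing_NormedModule C_AbsRing)); exact hx).
subst x; intros eps.
assert (e2 : 0 < eps / 2) by (assert (h := cond_pos eps); lra).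
destruct (h1 (mkposreal _ e2)) as [r1 H1], (h2 (mkposreal _ e2)) as [r2 H2].
assert (dp : 0 < Rmin r1 r2) by (apply Rmin_pos; apply cond_pos).
apply (C_square_locally _ z (mkposreal _ dp)); simpl; intros w k1 k2.
assert (Rmin r1 r2 <= r1) by apply Rmin_l.
assert (Rmin r1 r2 <= r2) by apply Rmin_r.
specialize (H1 (Re w) (Im w) ltac:(lra) ltac:(lra)).
specialize (H2 (Re w) (Im w) ltac:(lra) ltac:(lra)).
change (Cmod (Cminus (f w - f z) ((w - z) * (a, b)))%C <= eps * Cmod (w - z)%C).
eapply Rle_trans; [apply Cmod_le_2max|].
assert (M : Rmax (Rabs (Re w - Re z)) (Rabs (Im w - Im z)) <= Cmod (w - z)%C)
  by exact (Rmax_Cmod (w - z)%C).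
set (m := Rmax (Rabs (Re w - Re z)) (Rabs (Im w - Im z))) in *.
replace (eps * Cmod (w - z)%C) with (2 * (eps / 2 * Cmod (w - z)%C)) by field.
apply Rmult_le_compat_l; [lra|].
apply Rle_trans with (eps / 2 * m); [|apply Rmult_le_compat_l; lra].
destruct w as [u v], z as [x y]; simpl in *; apply Rmax_lub.
- eapply Rle_trans; [|exact H1]; right; apply (f_equal Rabs); unfold Re, Im; simpl; ring.
- eapply Rle_trans; [|exact H2]; right; apply (f_equal Rabs); unfold Re, Im; simpl; ring.
Qed.

Lemma continuous_pair (u A B : C -> R) (z : C) :
  continuous A z -> continuous B z -> continuous u (A z, B z) ->
  continuous (fun w => u (A w, B w)) z.
Proof.
intros hA hB hu; apply (continuous_comp_2 A B (fun x y => u (x, y))); auto.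
eapply continuous_ext; [|exact hu]; now intros [x y].
Qed.

Lemma continuous_curve (u : C -> R) (a b : R -> R) (t : R) :
  continuous a t -> continuous b t -> continuous u (a t, b t) ->
  continuous (fun t => u (a t, b t)) t.
Proof.
intros hA hB hu; apply (continuous_comp_2 a b (fun x y => u (x, y))); auto.
eapply continuous_ext; [|exact hu]; now intros [x y].
Qed.

Lemma continuous_hor (u : C -> R) (x y : R) :
  continuous u (x, y) -> continuous (fun t => u (t, y)) x.
Proof.
intros hu; apply (continuous_curve u (fun t => t) (fun _ => y)); auto.
- apply continuous_id.
- apply continuous_const.
Qed.

Lemma continuous_ver (u : C -> R) (x y : R) :
  continuous u (x, y) -> continuous (fun t => u (x, t)) y.
Proof.
intros hu; apply (continuous_curve u (fun _ => x) (fun t => t)); auto.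
- apply continuous_const.
- apply continuous_id.
Qed.

Definition in_rect (a b c d : R) (z : C) : Prop := a <= Re z <= b /\ c <= Im z <= d.

(** The integral of the 1-form P dx + Q dy along the boundary of a rectangle. *)
Definition rect_int (P Q : C -> R) (a b c d : R) : R :=
  RInt (fun x => P (x, c)) a b + RInt (fun y => Q (b, y)) c d
  - RInt (fun x => P (x, d)) a b - RInt (fun y => Q (a, y)) c d.

Lemma ex_RInt_hor (P : C -> R) (a b y : R) : a <= b ->
  (forall x, a <= x <= b -> continuous P (x, y)) ->
  ex_RInt (fun x => P (x, y)) a b.
Proof.
intros ab cP; apply (ex_RInt_continuous (V := R_CompleteNormedModule)).
intros x hx; rewrite Rmin_left, Rmax_right in hx by lra.
apply continuous_hor, cP, hx.
Qed.

Lemma ex_RInt_ver (P : C -> R) (c d x : R) : c <= d ->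
  (forall y, c <= y <= d -> continuous P (x, y)) ->
  ex_RInt (fun y => P (x, y)) c d.
Proof.
intros ab cP; apply (ex_RInt_continuous (V := R_CompleteNormedModule)).
intros y hy; rewrite Rmin_left, Rmax_right in hy by lra.
apply continuous_ver, cP, hy.
Qed.

Lemma RInt_split (f : R -> R) (a m b : R) : ex_RInt f a m -> ex_RInt f m b ->
  RInt f a b = RInt f a m + RInt f m b.
Proof. intros h1 h2; symmetry; exact (RInt_Chasles f a m b h1 h2). Qed.

Lemma rect_int_split (P Q : C -> R) (a m b c n d : R) :
  a <= m <= b -> c <= n <= d ->
  (forall z, in_rect a b c d z -> continuous P z /\ continuous Q z) ->
  rect_int P Q a b c d = rect_int P Q a m c n + rect_int P Q m b c n
    + rect_int P Q a m n d + rect_int P Q m b n d.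
Proof.
intros h1 h2 cont.
assert (HP : forall y, c <= y <= d -> RInt (fun x => P (x, y)) a b =
  RInt (fun x => P (x, y)) a m + RInt (fun x => P (x, y)) m b).
{ intros y hy; apply RInt_split; apply ex_RInt_hor; try lra; intros x hx;
    apply cont; split; simpl; lra. }
assert (HQ : forall x, a <= x <= b -> RInt (fun y => Q (x, y)) c d =
  RInt (fun y => Q (x, y)) c n + RInt (fun y => Q (x, y)) n d).
{ intros x hx; apply RInt_split; apply ex_RInt_ver; try lra; intros y hy;
    apply cont; split; simpl; lra. }
unfold rect_int; rewrite (HP c), (HP d), (HQ a), (HQ b) by lra; ring.
Qed.

Lemma RInt_near_const (f : R -> R) (a b k M : R) : a <= b -> ex_RInt f a b ->
  (forall t, a <= t <= b -> Rabs (f t - k) <= M) ->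
  Rabs (RInt f a b - (b - a) * k) <= (b - a) * M.
Proof.
intros ab ex H.
assert (exk : ex_RInt (fun _ => k) a b) by apply ex_RInt_const.
replace (RInt f a b - (b - a) * k) with (RInt (fun t => f t - k) a b).
- apply abs_RInt_le_const; auto.
  apply (ex_RInt_minus (V := R_NormedModule)); assumption.
- etransitivity;
    [apply (RInt_minus (V := R_CompleteNormedModule)); assumption|].
  rewrite (RInt_const (V := R_CompleteNormedModule)); reflexivity.
Qed.

Lemma halve_pow (s : R) (n : nat) : s / 2 ^ n = s / 2 ^ S n + s / 2 ^ S n.
Proof. simpl; field; apply pow_nonzero; lra. Qed.

(** The hypothesis makes the intervals from u n to u n + s / 2 ^ n nested; the
    supremum of the left ends lies in all of them. *)
Lemma nested_halves (u : nat -> R) (s : R) :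
  (forall n, u n <= u (S n) <= u n + s / 2 ^ S n) ->
  exists l, forall n, u n <= l <= u n + s / 2 ^ n.
Proof.
intros H.
assert (half := halve_pow s).
assert (up : forall n k, u n <= u (n + k)%nat).
{ intros n k; induction k as [|k IH].
  - rewrite Nat.add_0_r; lra.
  - rewrite Nat.add_succ_r; specialize (H (n + k)%nat); lra. }
assert (dn : forall n k, u (n + k)%nat + s / 2 ^ (n + k) <= u n + s / 2 ^ n).
{ intros n k; induction k as [|k IH].
  - rewrite Nat.add_0_r; lra.
  - rewrite Nat.add_succ_r; specialize (H (n + k)%nat).
    specialize (half (n + k)%nat); lra. }
assert (pos : forall n, 0 <= s / 2 ^ n).
{ intros n; rewrite half; specialize (H n); lra. }
assert (bd : forall m n, u m <= u n + s / 2 ^ n).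
{ intros m n; destruct (Nat.le_ge_cases m n) as [h|h].
  - replace n with (m + (n - m))%nat by lia.
    specialize (up m (n - m)%nat); specialize (pos (m + (n - m))%nat); lra.
  - replace m with (n + (m - n))%nat by lia.
    specialize (dn n (m - n)%nat); specialize (pos (n + (m - n))%nat); lra. }
destruct (completeness (fun x => exists n, x = u n)) as [l [lub1 lub2]].
- exists (u O + s / 2 ^ O); intros x [n ->]; apply bd.
- exists (u O), O; reflexivity.
- exists l; intros n; split; [apply lub1; now exists n|].
  apply lub2; intros x [m ->]; apply bd.
Qed.

(** On a small rectangle the affine parts of P and Q contribute nothing because
    P_y = Q_x = q at z; the remainders are at most eta times the half-perimeter
    on each side. *)
Lemma rect_int_small (P Q : C -> R) (z : C) (p q r : R) (eta : posreal) :
  has_grad P z p q -> has_grad Q z q r ->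
  exists delta : posreal, forall a b c d,
    in_rect a b c d z -> b - a < delta -> d - c < delta ->
    (forall w, in_rect a b c d w -> continuous P w /\ continuous Q w) ->
    Rabs (rect_int P Q a b c d) <= 2 * eta * ((b - a) + (d - c)) ^ 2.
Proof.
intros hP hQ; destruct z as [x0 y0]; destruct (hP eta) as [r1 H1], (hQ eta) as [r2 H2].
cbn [Re Im fst snd] in H1, H2.
assert (rp : 0 < Rmin r1 r2) by (apply Rmin_pos; apply cond_pos).
exists (mkposreal _ rp); cbn [pos]; intros a b c d [hx hy] hb hd cont; simpl in hx, hy.
assert (l1 : Rmin r1 r2 <= r1) by apply Rmin_l.
assert (l2 : Rmin r1 r2 <= r2) by apply Rmin_r.
assert (ep := cond_pos eta).
set (s := (b - a) + (d - c)).
assert (near : forall x y, a <= x <= b -> c <= y <= d ->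
  Rabs (x - x0) <= b - a /\ Rabs (y - y0) <= d - c).
{ intros x y h1 h2; split; apply Rabs_le; lra. }
assert (EP : forall x y, a <= x <= b -> c <= y <= d ->
  Rabs (P (x, y) - P (x0, y0) - (p * (x - x0) + q * (y - y0))) <= eta * s).
{ intros x y h1 h2; destruct (near x y h1 h2).
  eapply Rle_trans; [apply H1; lra|].
  apply Rmult_le_compat_l; [lra|]; apply Rmax_lub; unfold s; lra. }
assert (EQ : forall x y, a <= x <= b -> c <= y <= d ->
  Rabs (Q (x, y) - Q (x0, y0) - (q * (x - x0) + r * (y - y0))) <= eta * s).
{ intros x y h1 h2; destruct (near x y h1 h2).
  eapply Rle_trans; [apply H2; lra|].
  apply Rmult_le_compat_l; [lra|]; apply Rmax_lub; unfold s; lra. }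
assert (exP : forall y, c <= y <= d -> ex_RInt (fun x => P (x, y)) a b).
{ intros y h; apply ex_RInt_hor; [lra|]; intros x h'; apply cont; split; simpl; lra. }
assert (exQ : forall x, a <= x <= b -> ex_RInt (fun y => Q (x, y)) c d).
{ intros x h; apply ex_RInt_ver; [lra|]; intros y h'; apply cont; split; simpl; lra. }
assert (IP : Rabs (RInt (fun x => P (x, c) - P (x, d)) a b - (b - a) * (q * (c - d)))
  <= (b - a) * (2 * (eta * s))).
{ apply RInt_near_const; [lra| |].
  - apply (ex_RInt_minus (V := R_NormedModule)); apply exP; lra.
  - intros x hx'; assert (k1 := EP x c hx' ltac:(lra)).
    assert (k2 := EP x d hx' ltac:(lra)).
    apply Rabs_le_between in k1; apply Rabs_le_between in k2; apply Rabs_le; lra. }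
assert (IQ : Rabs (RInt (fun y => Q (b, y) - Q (a, y)) c d - (d - c) * (q * (b - a)))
  <= (d - c) * (2 * (eta * s))).
{ apply RInt_near_const; [lra| |].
  - apply (ex_RInt_minus (V := R_NormedModule)); apply exQ; lra.
  - intros y hy'; assert (k1 := EQ a y ltac:(lra) hy').
    assert (k2 := EQ b y ltac:(lra) hy').
    apply Rabs_le_between in k1; apply Rabs_le_between in k2; apply Rabs_le; lra. }
assert (E : rect_int P Q a b c d = RInt (fun x => P (x, c) - P (x, d)) a b
  + RInt (fun y => Q (b, y) - Q (a, y)) c d).
{ unfold rect_int.
  assert (e1 : RInt (fun x => P (x, c) - P (x, d)) a b =
    RInt (fun x => P (x, c)) a b - RInt (fun x => P (x, d)) a b)
    by (apply (RInt_minus (V := R_CompleteNormedModule)); apply exP; lra).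
  assert (e2 : RInt (fun y => Q (b, y) - Q (a, y)) c d =
    RInt (fun y => Q (b, y)) c d - RInt (fun y => Q (a, y)) c d)
    by (apply (RInt_minus (V := R_CompleteNormedModule)); apply exQ; lra).
  rewrite e1, e2; ring. }
rewrite E; apply Rabs_le_between in IP; apply Rabs_le_between in IQ.
apply Rabs_le; unfold s in *; split; lra.
Qed.

(** Goursat's bisection, for a closed 1-form whose coefficients are
    differentiable at each point without continuity of the derivatives.  One of the
    four quarters of a rectangle carries a quarter of the boundary integral; the
    chosen quarters shrink to a point, where [rect_int_small] bounds the integral
    by an arbitrarily small multiple of the area. *)
Lemma goursat (P Q : C -> R) (a b c d : R) : a <= b -> c <= d ->
  (forall z, in_rect a b c d z ->
     exists p q r, has_grad P z p q /\ has_grad Q z q r) ->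
  rect_int P Q a b c d = 0.
Proof.
intros ab cd H.
assert (cont : forall z, in_rect a b c d z -> continuous P z /\ continuous Q z).
{ intros z hz; destruct (H z hz) as (p & q & r & h1 & h2).
  split; eapply has_grad_continuous; eassumption. }
destruct (Req_dec (rect_int P Q a b c d) 0) as [h0|nz]; [exact h0 | exfalso].
set (m0 := Rabs (rect_int P Q a b c d)) in *.
assert (m0p : 0 < m0) by now apply Rabs_pos_lt.
set (s := b - a) in *; set (t := d - c) in *.
assert (p2 : forall n, 0 < 2 ^ n) by (intros n; apply pow_lt; lra).
assert (hs : forall n, 0 <= s / 2 ^ n) by
  (intros n; apply Rle_mult_inv_pos; [unfold s; lra | auto]).
assert (ht : forall n, 0 <= t / 2 ^ n) by
  (intros n; apply Rle_mult_inv_pos; [unfold t; lra | auto]).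
set (bad := fun n (w : R * R) =>
  (a <= fst w /\ fst w + s / 2 ^ n <= b /\ c <= snd w /\ snd w + t / 2 ^ n <= d) /\
  m0 / 4 ^ n <= Rabs (rect_int P Q (fst w) (fst w + s / 2 ^ n)
                                   (snd w) (snd w + t / 2 ^ n))).
assert (step : forall n w, exists w', bad n w ->
  bad (S n) w' /\ fst w <= fst w' <= fst w + s / 2 ^ S n /\
  snd w <= snd w' <= snd w + t / 2 ^ S n).
{ intros n [x y]; destruct (classic (bad n (x, y))) as [[hin hb]|nb];
    [|exists (x, y); tauto].
  simpl in hin, hb.
  assert (sn := halve_pow s n); assert (tn := halve_pow t n).
  assert (sp := hs (S n)); assert (tp := ht (S n)).
  set (s' := s / 2 ^ S n) in *; set (t' := t / 2 ^ S n) in *.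
  assert (E4 : m0 / 4 ^ n = 4 * (m0 / 4 ^ S n)) by
    (simpl; field; apply pow_nonzero; lra).
  assert (SP := rect_int_split P Q x (x + s') (x + s / 2 ^ n)
    y (y + t') (y + t / 2 ^ n) ltac:(lra) ltac:(lra)).
  rewrite SP in hb by (intros w [w1 w2]; apply cont; split; lra).
  set (m1 := rect_int P Q x (x + s') y (y + t')) in *.
  set (m2 := rect_int P Q (x + s') (x + s / 2 ^ n) y (y + t')) in *.
  set (m3 := rect_int P Q x (x + s') (y + t') (y + t / 2 ^ n)) in *.
  set (m4 := rect_int P Q (x + s') (x + s / 2 ^ n) (y + t') (y + t / 2 ^ n)) in *.
  assert (T1 := Rabs_triang (m1 + m2 + m3) m4).
  assert (T2 := Rabs_triang (m1 + m2) m3).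
  assert (T3 := Rabs_triang m1 m2).
  destruct (Rle_dec (m0 / 4 ^ S n) (Rabs m1)) as [g|g1].
  { exists (x, y); intros _; unfold bad; cbn [fst snd]; fold s' t'.
    repeat split; try lra; exact g. }
  destruct (Rle_dec (m0 / 4 ^ S n) (Rabs m2)) as [g|g2].
  { exists (x + s', y); intros _; unfold bad; cbn [fst snd]; fold s' t'.
    replace (x + s' + s') with (x + s / 2 ^ n) by lra.
    repeat split; try lra; exact g. }
  destruct (Rle_dec (m0 / 4 ^ S n) (Rabs m3)) as [g|g3].
  { exists (x, y + t'); intros _; unfold bad; cbn [fst snd]; fold s' t'.
    replace (y + t' + t') with (y + t / 2 ^ n) by lra.
    repeat split; try lra; exact g. }
  exists (x + s', y + t'); intros _; unfold bad; cbn [fst snd]; fold s' t'.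
  replace (x + s' + s') with (x + s / 2 ^ n) by lra.
  replace (y + t' + t') with (y + t / 2 ^ n) by lra.
  repeat split; try lra; change (m0 / 4 ^ S n <= Rabs m4); lra. }
set (next := fun n w => proj1_sig (constructive_indefinite_description _ (step n w))).
set (sq := fix sq n := match n with O => (a, c) | S k => next k (sq k) end).
assert (nextP : forall n, bad n (sq n) -> bad (S n) (sq (S n)) /\
  fst (sq n) <= fst (sq (S n)) <= fst (sq n) + s / 2 ^ S n /\
  snd (sq n) <= snd (sq (S n)) <= snd (sq n) + t / 2 ^ S n).
{ intros n; change (sq (S n)) with (next n (sq n)); unfold next.
  exact (proj2_sig (constructive_indefinite_description _ (step n (sq n)))). }
assert (allbad : forall n, bad n (sq n)).
{ induction n as [|n IH]; [|apply nextP, IH].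
  unfold bad; simpl; unfold s, t.
  replace (a + (b - a) / 1) with b by field; replace (c + (d - c) / 1) with d by field.
  split; [lra|]; unfold m0; lra. }
destruct (nested_halves (fun n => fst (sq n)) s) as [x0 hx0];
  [intros n; apply (nextP n (allbad n))|].
destruct (nested_halves (fun n => snd (sq n)) t) as [y0 hy0];
  [intros n; apply (nextP n (allbad n))|].
simpl in hx0, hy0.
assert (in0 : in_rect a b c d (x0, y0)).
{ assert (k1 := hx0 O); assert (k2 := hy0 O); simpl in k1, k2.
  unfold s, t, Rdiv in k1, k2; split; simpl; lra. }
destruct (H _ in0) as (p & q & r & hP & hQ).
(* with eta = m0 / D the bound of rect_int_small is less than m0 / 4 ^ n *)
set (D := 4 * (s + t) ^ 2 + 1).
assert (Dp : 0 < D) by (unfold D; assert (h := pow2_ge_0 (s + t)); lra).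
assert (ep : 0 < m0 / D) by now apply Rdiv_lt_0_compat.
destruct (rect_int_small P Q (x0, y0) p q r (mkposreal _ ep) hP hQ) as [delta small].
assert (stp : 0 <= s + t) by (unfold s, t; lra).
assert (N : exists n, s / 2 ^ n < delta /\ t / 2 ^ n < delta).
{ destruct (pow_lt_1_zero (/ 2) ltac:(rewrite Rabs_pos_eq; lra)
    (delta / (s + t + 1))) as [n Hn].
  - apply Rdiv_lt_0_compat; [apply cond_pos | lra].
  - exists n; specialize (Hn n (Nat.le_refl n)).
    rewrite Rabs_pos_eq in Hn by (apply pow_le; lra).
    rewrite pow_inv in Hn.
    assert (i2 : 0 < / 2 ^ n) by (apply Rinv_0_lt_compat; auto).
    assert (K : / 2 ^ n * (s + t + 1) < delta).
    { apply Rmult_lt_compat_r with (r := s + t + 1) in Hn; [|lra].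
      replace (delta / (s + t + 1) * (s + t + 1)) with (pos delta) in Hn
        by (field; lra); exact Hn. }
    assert (0 <= s) by (unfold s; lra); assert (0 <= t) by (unfold t; lra).
    unfold Rdiv; split; nra. }
destruct N as [n [n1 n2]].
destruct (allbad n) as [hin hb].
specialize (small (fst (sq n)) (fst (sq n) + s / 2 ^ n)
  (snd (sq n)) (snd (sq n) + t / 2 ^ n)).
assert (B : Rabs (rect_int P Q (fst (sq n)) (fst (sq n) + s / 2 ^ n) (snd (sq n))
  (snd (sq n) + t / 2 ^ n)) <= 2 * (m0 / D) * (s / 2 ^ n + t / 2 ^ n) ^ 2).
{ eapply Rle_trans; [apply small|].
  - split; [apply hx0 | apply hy0].
  - lra.
  - lra.
  - intros w [w1 w2]; apply cont; split; lra.
  - right; cbn [pos]; ring. }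
assert (E4 : 2 * (m0 / D) * (s / 2 ^ n + t / 2 ^ n) ^ 2 =
  m0 / 4 ^ n * (2 * (s + t) ^ 2 / D)).
{ replace (4 ^ n) with (2 ^ n * 2 ^ n) by
    (rewrite <- Rpow_mult_distr; f_equal; ring).
  field; split; [lra | apply pow_nonzero; lra]. }
assert (K : 2 * (s + t) ^ 2 / D < 1).
{ apply Rmult_lt_reg_r with D; [exact Dp|].
  unfold Rdiv; rewrite Rmult_assoc, Rinv_l by lra; unfold D; assert (h := pow2_ge_0 (s + t)); lra. }
assert (p4 : 0 < m0 / 4 ^ n) by (apply Rdiv_lt_0_compat; [lra | apply pow_lt; lra]).
rewrite E4 in B; nra.
Qed.

(** Open balls of the maximum norm: the axis-parallel segments from the centre
    to a projection of a point stay inside, and they are simply connected. *)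
Definition square (c : C) (r : R) (z : C) : Prop :=
  Rabs (Re z - Re c) < r /\ Rabs (Im z - Im c) < r.

Lemma square_is_open (c : C) (r : R) : open (square c r).
Proof.
apply open_of_boxes; intros z [h1 h2].
assert (dp : 0 < Rmin (r - Rabs (Re z - Re c)) (r - Rabs (Im z - Im c)))
  by (apply Rmin_pos; lra).
exists (mkposreal _ dp); simpl; intros w k1 k2.
assert (l1 := Rmin_l (r - Rabs (Re z - Re c)) (r - Rabs (Im z - Im c))).
assert (l2 := Rmin_r (r - Rabs (Re z - Re c)) (r - Rabs (Im z - Im c))).
assert (t1 := Rabs_triang (Re w - Re z) (Re z - Re c)).
assert (t2 := Rabs_triang (Im w - Im z) (Im z - Im c)).
replace (Re w - Re z + (Re z - Re c)) with (Re w - Re c) in t1 by ring.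
replace (Im w - Im z + (Im z - Im c)) with (Im w - Im c) in t2 by ring.
unfold square; lra.
Qed.

Lemma square_center (c : C) (r : R) : 0 < r -> square c r c.
Proof. intros rp; unfold square, Rminus; rewrite !Rplus_opp_r, Rabs_R0; auto. Qed.

Lemma RInt_opp_swap (f : R -> R) (a b : R) : ex_RInt f a b ->
  RInt f b a = - RInt f a b.
Proof.
intros h; symmetry; apply (opp_RInt_swap (V := R_CompleteNormedModule)); exact h.
Qed.

Lemma goursat_unordered (P Q : C -> R) (a b c d : R) :
  (forall z, in_rect (Rmin a b) (Rmax a b) (Rmin c d) (Rmax c d) z ->
     exists p q r, has_grad P z p q /\ has_grad Q z q r) ->
  rect_int P Q a b c d = 0.
Proof.
intros H.
assert (cont : forall z, in_rect (Rmin a b) (Rmax a b) (Rmin c d) (Rmax c d) z ->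
  continuous P z /\ continuous Q z).
{ intros z hz; destruct (H z hz) as (p & q & r & h1 & h2).
  split; eapply has_grad_continuous; eassumption. }
assert (ord : Rmin a b <= Rmax a b) by
  (eapply Rle_trans; [apply Rmin_l | apply Rmax_l]).
assert (ord' : Rmin c d <= Rmax c d) by
  (eapply Rle_trans; [apply Rmin_l | apply Rmax_l]).
assert (G := goursat P Q _ _ _ _ ord ord' H).
assert (exP : forall y, Rmin c d <= y <= Rmax c d ->
  ex_RInt (fun x => P (x, y)) (Rmin a b) (Rmax a b)).
{ intros y h; apply ex_RInt_hor; auto; intros x h'; apply cont; split; assumption. }
assert (exQ : forall x, Rmin a b <= x <= Rmax a b ->
  ex_RInt (fun y => Q (x, y)) (Rmin c d) (Rmax c d)).
{ intros y h; apply ex_RInt_ver; auto; intros x h'; apply cont; split; assumption. }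
unfold rect_int in *.
destruct (Rle_dec a b) as [ab|ab]; destruct (Rle_dec c d) as [cd|cd];
  [rewrite (Rmin_left a b), (Rmax_right a b) in * by lra
  |rewrite (Rmin_left a b), (Rmax_right a b) in * by lra
  |rewrite (Rmin_right a b), (Rmax_left a b) in * by lra
  |rewrite (Rmin_right a b), (Rmax_left a b) in * by lra];
  [rewrite (Rmin_left c d), (Rmax_right c d) in * by lra
  |rewrite (Rmin_right c d), (Rmax_left c d) in * by lra
  |rewrite (Rmin_left c d), (Rmax_right c d) in * by lra
  |rewrite (Rmin_right c d), (Rmax_left c d) in * by lra].
- exact G.
- rewrite (RInt_opp_swap (fun y => Q (a, y)) d c), (RInt_opp_swap (fun y => Q (b, y)) d c)
    by (apply exQ; lra); lra.
- rewrite (RInt_opp_swap (fun x => P (x, c)) b a), (RInt_opp_swap (fun x => P (x, d)) b a)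
    by (apply exP; lra); lra.
- rewrite (RInt_opp_swap (fun y => Q (a, y)) d c), (RInt_opp_swap (fun y => Q (b, y)) d c)
    by (apply exQ; lra).
  rewrite (RInt_opp_swap (fun x => P (x, c)) b a), (RInt_opp_swap (fun x => P (x, d)) b a)
    by (apply exP; lra); lra.
Qed.

Lemma between_center (x0 x t r : R) : Rabs (x - x0) < r ->
  Rmin x0 x <= t <= Rmax x0 x -> Rabs (t - x0) < r.
Proof.
intros h; apply Rabs_def2 in h; unfold Rmin, Rmax; destruct (Rle_dec x0 x);
  intros k; apply Rabs_def1; lra.
Qed.

Lemma is_derive_RInt_upper (f : R -> R) (a x : R) (e : posreal) :
  (forall t, Rmin a x - e < t < Rmax a x + e -> continuous f t) ->
  is_derive (fun x => RInt f a x) x (f x).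
Proof.
intros H.
assert (ep := cond_pos e).
assert (l1 := Rmin_r a x); assert (l2 := Rmax_r a x).
apply (is_derive_RInt (V := R_NormedModule) f (fun x => RInt f a x) a x).
- exists e; intros y hy; change (Rabs (y - x) < e) in hy.
  apply Rabs_def2 in hy.
  apply (RInt_correct (V := R_CompleteNormedModule)).
  apply (ex_RInt_continuous (V := R_CompleteNormedModule)); intros t ht; apply H.
  assert (m1 := Rmin_l a x); assert (m2 := Rmax_l a x).
  unfold Rmin at 1, Rmax at 1 in ht; destruct (Rle_dec a y); lra.
- apply H; lra.
Qed.

Lemma is_derive_cst (c x : R) : is_derive (fun _ : R => c) x 0.
Proof. exact (is_derive_const (K := R_AbsRing) (V := R_NormedModule) c x). Qed.

(** The two paths from the centre to z with one horizontal and one vertical leg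
    give the same integral by Goursat's theorem; the last leg of each path yields
    one of the two partial derivatives. *)
Lemma primitive_on_square (P Q : C -> R) (c : C) (r : R) :
  (forall z, square c r z -> exists p q s, has_grad P z p q /\ has_grad Q z q s) ->
  exists F, forall z, square c r z -> has_grad F z (P z) (Q z).
Proof.
intros H; destruct c as [x0 y0].
assert (cont : forall z, square (x0, y0) r z -> continuous P z /\ continuous Q z).
{ intros z hz; destruct (H z hz) as (p & q & s & h1 & h2).
  split; eapply has_grad_continuous; eassumption. }
set (F := fun z : C => RInt (fun t => P (t, y0)) x0 (Re z)
                     + RInt (fun t => Q (Re z, t)) y0 (Im z)).
set (F' := fun z : C => RInt (fun t => P (t, Im z)) x0 (Re z)
                     + RInt (fun t => Q (x0, t)) y0 (Im z)).
assert (FF : forall z, square (x0, y0) r z -> F z = F' z).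
{ intros [x y] [hx hy]; simpl in hx, hy.
  assert (G := goursat_unordered P Q x0 x y0 y).
  unfold rect_int in G; unfold F, F'; cbn [Re Im fst snd].
  assert (G' : forall w, in_rect (Rmin x0 x) (Rmax x0 x) (Rmin y0 y) (Rmax y0 y) w ->
    square (x0, y0) r w).
  { intros w [w1 w2]; split; eapply between_center; eauto. }
  specialize (G (fun w hw => H w (G' w hw))); lra. }
assert (room : forall z : C, square (x0, y0) r z -> exists e : posreal,
  Rabs (Re z - x0) + e < r /\ Rabs (Im z - y0) + e < r).
{ intros z [hx hy]; simpl in hx, hy.
  assert (dp : 0 < Rmin (r - Rabs (Re z - x0)) (r - Rabs (Im z - y0)) / 2) by
    (apply Rdiv_lt_0_compat; [apply Rmin_pos; lra | lra]).
  exists (mkposreal _ dp); simpl.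
  assert (l1 := Rmin_l (r - Rabs (Re z - x0)) (r - Rabs (Im z - y0))).
  assert (l2 := Rmin_r (r - Rabs (Re z - x0)) (r - Rabs (Im z - y0))).
  lra. }
assert (span : forall x0 x t r e, Rabs (x - x0) + e < r ->
  Rmin x0 x - e < t < Rmax x0 x + e -> Rabs (t - x0) < r).
{ intros a x t s e h k; revert k h; unfold Rmin, Rmax;
    destruct (Rle_dec a x); intros k h; apply Rabs_def1; revert h; unfold Rabs; destruct (Rcase_abs (x - a)); lra. }
assert (Fx : forall z, square (x0, y0) r z ->
  is_derive (fun t => F (t, Im z)) (Re z) (P z)).
{ intros z hz; destruct (room z hz) as [e [e1 e2]].
  apply (is_derive_ext_loc (fun t => F' (t, Im z))).
  - destruct (open_contains_box _ z (square_is_open (x0, y0) r) hz) as [d Hd].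
    exists d; intros t ht; symmetry; apply FF, Hd; [exact ht|].
    simpl; unfold Rminus; rewrite Rplus_opp_r, Rabs_R0; apply d.
  - unfold F'; cbn [Re Im fst snd].
    replace (P z) with (P (Re z, Im z) + 0) by (destruct z; simpl; ring).
    apply (is_derive_plus (V := R_NormedModule)); [|apply is_derive_cst].
    apply (is_derive_RInt_upper (fun t => P (t, Im z)) x0 (Re z) e).
    intros t ht; apply continuous_hor, cont; split; simpl.
    + eapply span; eauto.
    + lra || (apply Rle_lt_trans with (2 := e2); assert (h := cond_pos e); lra). }
assert (Fy : forall z, square (x0, y0) r z ->
  is_derive (fun t => F (Re z, t)) (Im z) (Q z)).
{ intros z hz; destruct (room z hz) as [e [e1 e2]].
  unfold F; cbn [Re Im fst snd].
  replace (Q z) with (0 + Q (Re z, Im z)) by (destruct z; simpl; ring).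
  apply (is_derive_plus (V := R_NormedModule)); [apply is_derive_cst|].
  apply (is_derive_RInt_upper (fun t => Q (Re z, t)) y0 (Im z) e).
  intros t ht; apply continuous_ver, cont; split; simpl.
  + apply Rle_lt_trans with (2 := e1); assert (h := cond_pos e); lra.
  + eapply span; eauto. }
exists F; intros z hz.
apply (has_grad_of_partials (square (x0, y0) r)); auto.
- apply square_is_open.
- apply cont, hz.
Qed.

(** * Cauchy's formula and the regularity of holomorphic functions *)

Definition loop_int (f : R -> R) : R := RInt f 0 (2 * PI).

Lemma two_PI_pos : 0 < 2 * PI.
Proof. assert (h := PI_RGT_0); lra. Qed.

Lemma ex_RInt_cont (f : R -> R) (a b : R) : (forall t, continuous f t) -> ex_RInt f a b.
Proof.
intros H; apply (ex_RInt_continuous (V := R_CompleteNormedModule)); auto.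
Qed.

Lemma is_derive_RInt_circle (f df : C -> R) (s0 : R) (e : posreal) :
  (forall s th, Rabs (s - s0) < e -> is_derive (fun s => f (s, th)) s (df (s, th))) ->
  (forall s th, Rabs (s - s0) < e -> continuous df (s, th)) ->
  (forall s th, Rabs (s - s0) < e -> continuous f (s, th)) ->
  is_derive (fun s => RInt (fun th => f (s, th)) 0 (2 * PI)) s0
    (RInt (fun th => df (s0, th)) 0 (2 * PI)).
Proof.
intros H1 H2 H3.
assert (z0 : Rabs (s0 - s0) < e)
  by (unfold Rminus; rewrite Rplus_opp_r, Rabs_R0; apply e).
rewrite (RInt_ext (V := R_CompleteNormedModule) (fun th => df (s0, th))
  (fun th => Derive (fun s => f (s, th)) s0)).
2: { intros th _; symmetry; apply is_derive_unique, H1, z0. }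
apply (is_derive_RInt_param (fun s th => f (s, th)) 0 (2 * PI) s0).
- exists e; intros s hs th _; eexists; apply H1, hs.
- intros th _; apply (continuity_2d_pt_ext_loc (fun s th => df (s, th))).
  + exists e; intros s t hs _; symmetry; apply is_derive_unique, H1, hs.
  + apply continuous_2d, H2, z0.
- exists e; intros s hs; apply ex_RInt_cont; intros t.
  apply continuous_ver, H3, hs.
Qed.

Lemma abs_cos_le (t : R) : Rabs (cos t) <= 1.
Proof. apply Rabs_le, COS_bound. Qed.

Lemma abs_sin_le (t : R) : Rabs (sin t) <= 1.
Proof. apply Rabs_le, SIN_bound. Qed.

Lemma cos_Im_grad (z : C) : has_grad (fun w => cos (Im w)) z 0 (- sin (Im z)).
Proof.
eapply has_grad_eq; [apply (has_grad_comp1 cos _ _ (- sin (Im z))), has_grad_Im | |];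
  try ring; auto_derive; auto; ring.
Qed.

Lemma sin_Im_grad (z : C) : has_grad (fun w => sin (Im w)) z 0 (cos (Im z)).
Proof.
eapply has_grad_eq; [apply (has_grad_comp1 sin _ _ (cos (Im z))), has_grad_Im | |];
  try ring; auto_derive; auto; ring.
Qed.

Lemma polar_x_grad x w :
  has_grad (fun w => x + Re w * cos (Im w)) w (cos (Im w)) (- Re w * sin (Im w)).
Proof.
eapply has_grad_eq.
- apply has_grad_plus; [apply has_grad_const|].
  apply has_grad_mult; [apply has_grad_Re | apply cos_Im_grad].
- simpl; ring.
- simpl; ring.
Qed.

Lemma polar_y_grad y w :
  has_grad (fun w => y + Re w * sin (Im w)) w (sin (Im w)) (Re w * cos (Im w)).
Proof.
eapply has_grad_eq.
- apply has_grad_plus; [apply has_grad_const|].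
  apply has_grad_mult; [apply has_grad_Re | apply sin_Im_grad].
- simpl; ring.
- simpl; ring.
Qed.

(** With w = (radius, angle) this is the real part of F e^{- i theta} in polar
    coordinates around (x, y), where F = U + iV has the derivative u + iv at p.  Its
    radial derivative is Re F'; its angular derivative contains the imaginary part
    of F e^{- i theta}, which is the same expression for - i F = V - iU. *)
Lemma polar_grad (U V : C -> R) (x y u v : R) (w : C) :
  let p := (x + Re w * cos (Im w), y + Re w * sin (Im w)) in
  has_grad U p u (- v) -> has_grad V p v u ->
  has_grad (fun w => U (x + Re w * cos (Im w), y + Re w * sin (Im w)) * cos (Im w)
                   + V (x + Re w * cos (Im w), y + Re w * sin (Im w)) * sin (Im w)) w u
    (- (Re w * v) + (V p * cos (Im w) - U p * sin (Im w))).
Proof.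
intros p hU hV; assert (cs := sin2_cos2 (Im w)); unfold Rsqr in cs.
eapply has_grad_eq.
- apply has_grad_plus; apply has_grad_mult; try apply cos_Im_grad; try apply sin_Im_grad.
  + apply (has_grad_comp2 U); [exact hU | apply polar_x_grad | apply polar_y_grad].
  + apply (has_grad_comp2 V); [exact hV | apply polar_x_grad | apply polar_y_grad].
- simpl; transitivity (u * (sin (Im w) * sin (Im w) + cos (Im w) * cos (Im w)));
    [ring | rewrite cs; ring].
- cbv beta; fold p; transitivity (- (Re w * v)
     * (sin (Im w) * sin (Im w) + cos (Im w) * cos (Im w)) +
     (V p * cos (Im w) - U p * sin (Im w))); [ring | rewrite cs; ring].
Qed.

Section Circle.

Variables (U V u v : C -> R) (x y r : R).

Hypothesis gU : forall w, square (x, y) r w -> has_grad U w (u w) (- v w).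
Hypothesis gV : forall w, square (x, y) r w -> has_grad V w (v w) (u w).
Hypothesis cu : forall w, square (x, y) r w -> continuous u w.

Let px (w : C) : R := x + Re w * cos (Im w).
Let py (w : C) : R := y + Re w * sin (Im w).

Lemma circle_in_square w : Rabs (Re w) < r -> square (x, y) r (px w, py w).
Proof.
intros h; unfold square, px, py; simpl.
replace (x + Re w * cos (Im w) - x) with (Re w * cos (Im w)) by ring.
replace (y + Re w * sin (Im w) - y) with (Re w * sin (Im w)) by ring.
assert (c1 := abs_cos_le (Im w)); assert (s1 := abs_sin_le (Im w)).
rewrite !Rabs_mult; assert (p := Rabs_pos (Re w)); split; nra.
Qed.

Lemma cont_polar w : Rabs (Re w) < r -> continuous (fun w => u (px w, py w)) w.
Proof.
intros h; apply continuous_pair.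
- eapply has_grad_continuous, polar_x_grad.
- eapply has_grad_continuous, polar_y_grad.
- apply cu, circle_in_square, h.
Qed.

(** Cauchy's formula for F' at the centre of a circle.  Let phi t be the integral
    on the left over the circle of radius t, and M t the one of u = Re F'.  The
    radial derivative gives phi' = M, integration by parts in the angle gives
    phi t = t M t; so phi t / t is constant, and its limit at 0 is 2 pi u (x, y). *)
Lemma cauchy_circle (rho : R) : 0 < rho < r ->
  loop_int (fun th => U (x + rho * cos th, y + rho * sin th) * cos th
                    + V (x + rho * cos th, y + rho * sin th) * sin th)
  = 2 * PI * rho * u (x, y).
Proof.
intros hr.
set (W := fun w => U (px w, py w) * cos (Im w) + V (px w, py w) * sin (Im w)).
set (phi := fun t => loop_int (fun th => W (t, th))).
set (M := fun t => loop_int (fun th => u (px (t, th), py (t, th)))).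
change (phi rho = 2 * PI * rho * u (x, y)).
assert (gW : forall w, Rabs (Re w) < r -> has_grad W w (u (px w, py w))
  (- (Re w * v (px w, py w)) + (V (px w, py w) * cos (Im w) - U (px w, py w) * sin (Im w)))).
{ intros w hw; assert (hs := circle_in_square w hw).
  exact (polar_grad U V x y _ _ w (gU _ hs) (gV _ hs)). }
assert (dphi : forall t, Rabs t < r -> is_derive phi t (M t)).
{ intros t ht; assert (ep : 0 < r - Rabs t) by lra.
  assert (near : forall s, Rabs (s - t) < r - Rabs t -> Rabs s < r).
  { intros s hs; assert (T := Rabs_triang (s - t) t).
    replace (s - t + t) with s in T by ring; lra. }
  apply (is_derive_RInt_circle W (fun w => u (px w, py w)) t (mkposreal _ ep));
    simpl; intros s th hs; specialize (near s hs).
  - exact (has_grad_partial1 _ _ _ _ _ (gW (s, th) near)).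
  - exact (cont_polar (s, th) near).
  - exact (has_grad_continuous _ _ _ _ (gW (s, th) near)). }
assert (parts : forall t, Rabs t < r -> phi t = t * M t).
{ intros t ht.
  assert (c1 : forall th, continuous (fun th => u (px (t, th), py (t, th))) th).
  { intros th; apply (continuous_ver (fun w => u (px w, py w))).
    apply (cont_polar (t, th)), ht. }
  assert (c2 : forall th, continuous (fun th => W (t, th)) th).
  { intros th; apply (continuous_ver W).
    exact (has_grad_continuous _ _ _ _ (gW (t, th) ht)). }
  set (G := fun th => V (px (t, th), py (t, th)) * cos th + - U (px (t, th), py (t, th)) * sin th).
  set (dG := fun th => t * u (px (t, th), py (t, th)) - W (t, th)).
  assert (E : is_RInt dG 0 (2 * PI) (minus (G (2 * PI)) (G 0))).
  { apply (is_RInt_derive (V := R_CompleteNormedModule)).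
    - intros th _; assert (hs := circle_in_square (t, th) ht).
      assert (g := polar_grad V (fun w => - U w) x y (v (px (t, th), py (t, th)))
        (- u (px (t, th), py (t, th))) (t, th)).
      apply (has_grad_eq _ _ _ _ (v (px (t, th), py (t, th))) (dG th)) in g.
      + exact (has_grad_partial2 _ _ _ _ _ g).
      + rewrite Ropp_involutive; exact (gV _ hs).
      + eapply has_grad_eq; [apply has_grad_opp, (gU _ hs) | |]; ring.
      + reflexivity.
      + unfold dG, W, px, py; simpl; ring.
    - intros th _; apply (continuous_minus (V := R_NormedModule)); [|apply c2].
      apply (continuous_scal_r (V := R_NormedModule)), c1. }
  assert (per : G (2 * PI) = G 0).
  { unfold G, px, py; simpl; rewrite sin_0, cos_0, sin_2PI, cos_2PI; reflexivity. }
  apply (is_RInt_unique (V := R_CompleteNormedModule)) in E; rewrite per in E.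
  assert (E2 : RInt dG 0 (2 * PI) = t * M t - phi t).
  { unfold M, phi.
    transitivity (RInt (fun th => t * u (px (t, th), py (t, th))) 0 (2 * PI)
      - RInt (fun th => W (t, th)) 0 (2 * PI)).
    - apply (RInt_minus (V := R_CompleteNormedModule)); [|now apply ex_RInt_cont].
      apply (ex_RInt_scal (V := R_NormedModule)); now apply ex_RInt_cont.
    - apply (f_equal (fun m => m - _)).
      apply (RInt_scal (V := R_CompleteNormedModule)); now apply ex_RInt_cont. }
  rewrite E2 in E; change (t * M t - phi t = G 0 - G 0) in E; lra. }
assert (Mconst : forall s, 0 < s <= rho -> M s = M rho).
{ intros s hs.
  assert (d0 : forall t, 0 < t < r -> is_derive (fun t => phi t / t) t 0).
  { intros t ht.
    assert (at' : Rabs t < r) by (rewrite Rabs_pos_eq; lra).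
    assert (E := is_derive_div phi (fun t => t) t (M t) 1 (dphi t at')
      (is_derive_id t) ltac:(lra)).
    replace 0 with ((M t * t - phi t * 1) / t ^ 2); [exact E|].
    rewrite (parts t at'); field; lra. }
  destruct (MVT_gen (fun t => phi t / t) s rho (fun _ => 0)) as [c [_ hc]].
  - intros t ht; rewrite Rmin_left, Rmax_right in ht by lra; apply d0; lra.
  - intros t ht; rewrite Rmin_left, Rmax_right in ht by lra.
    apply continuity_pt_filterlim, (ex_derive_continuous (K := R_AbsRing)
      (V := R_NormedModule) (fun t => phi t / t)); exists 0; apply d0; lra.
  - rewrite (parts s), (parts rho) in hc by (rewrite Rabs_pos_eq; lra).
    replace (rho * M rho / rho) with (M rho) in hc by (field; lra).
    replace (s * M s / s) with (M s) in hc by (field; lra); lra. }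
rewrite (parts rho) by (rewrite Rabs_pos_eq; lra).
replace (2 * PI * rho * u (x, y)) with (rho * (2 * PI * u (x, y))) by ring; f_equal.
assert (tpi := two_PI_pos).
apply cond_eq; intros eps epos.
assert (e1 : 0 < eps / (2 * PI + 1)) by (apply Rdiv_lt_0_compat; lra).
assert (in0 : square (x, y) r (x, y)) by (apply square_center; lra).
destruct (proj1 (continuous_eps u (x, y)) (cu _ in0) (mkposreal _ e1)) as [d Hd].
simpl in Hd.
set (s := Rmin rho (d / 2)).
assert (sp : 0 < s <= rho).
{ split; [apply Rmin_pos; [lra | assert (h := cond_pos d); lra] | apply Rmin_l]. }
assert (sd : s < d).
{ apply Rle_lt_trans with (d / 2); [apply Rmin_r | assert (h := cond_pos d); lra]. }
assert (sr : Rabs s < r) by (rewrite Rabs_pos_eq; lra).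
rewrite <- (Mconst s sp).
assert (B : Rabs (M s - (2 * PI - 0) * u (x, y)) <= (2 * PI - 0) * (eps / (2 * PI + 1))).
{ apply RInt_near_const; [lra | |].
  - apply ex_RInt_cont; intros th; apply (continuous_ver (fun w => u (px w, py w))).
    apply (cont_polar (s, th)), sr.
  - intros th _; left.
    assert (c1 := abs_cos_le th); assert (s1 := abs_sin_le th).
    apply Hd; unfold px, py; simpl.
    + replace (x + s * cos th - x) with (s * cos th) by ring.
      rewrite Rabs_mult, (Rabs_pos_eq s) by lra; nra.
    + replace (y + s * sin th - y) with (s * sin th) by ring.
      rewrite Rabs_mult, (Rabs_pos_eq s) by lra; nra. }
rewrite Rminus_0_r in B; eapply Rle_lt_trans; [exact B|].
apply Rmult_lt_reg_r with (2 * PI + 1); [lra|].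
replace (2 * PI * (eps / (2 * PI + 1)) * (2 * PI + 1)) with (2 * PI * eps)
  by (field; lra); nra.
Qed.

End Circle.

(** The integral of the real part of (A + iB) e^{- i theta} over the circle of
    radius rho, as a function of the centre. *)
Definition circle_int (rho : R) (A B : C -> R) (z : C) : R :=
  loop_int (fun th => A (Re z + rho * cos th, Im z + rho * sin th) * cos th
                    + B (Re z + rho * cos th, Im z + rho * sin th) * sin th).

Lemma sub_square (c : C) (r rho : R) (z : C) : square c (r - rho) z ->
  exists r', rho < r' /\ forall w, square z r' w -> square c r w.
Proof.
intros [h1 h2].
exists (rho + Rmin (r - rho - Rabs (Re z - Re c)) (r - rho - Rabs (Im z - Im c))).
assert (p : 0 < Rmin (r - rho - Rabs (Re z - Re c)) (r - rho - Rabs (Im z - Im c)))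
  by (apply Rmin_pos; lra).
assert (l1 := Rmin_l (r - rho - Rabs (Re z - Re c)) (r - rho - Rabs (Im z - Im c))).
assert (l2 := Rmin_r (r - rho - Rabs (Re z - Re c)) (r - rho - Rabs (Im z - Im c))).
split; [lra|]; intros w [k1 k2].
assert (t1 := Rabs_triang (Re w - Re z) (Re z - Re c)).
assert (t2 := Rabs_triang (Im w - Im z) (Im z - Im c)).
replace (Re w - Re z + (Re z - Re c)) with (Re w - Re c) in t1 by ring.
replace (Im w - Im z + (Im z - Im c)) with (Im w - Im c) in t2 by ring.
unfold square; lra.
Qed.

Lemma translate_circle (z w : C) (rho r th : R) : 0 < rho < r ->
  Rabs (Re w - Re z) < r - rho -> Rabs (Im w - Im z) < r - rho ->
  square z r (Re w + rho * cos th, Im w + rho * sin th).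
Proof.
intros hr h1 h2; assert (c1 := abs_cos_le th); assert (s1 := abs_sin_le th).
unfold square; simpl.
assert (t1 := Rabs_triang (Re w - Re z) (rho * cos th)).
assert (t2 := Rabs_triang (Im w - Im z) (rho * sin th)).
rewrite Rabs_mult, (Rabs_pos_eq rho) in t1, t2 by lra.
replace (Re w - Re z + rho * cos th) with (Re w + rho * cos th - Re z) in t1 by ring.
replace (Im w - Im z + rho * sin th) with (Im w + rho * sin th - Im z) in t2 by ring.
split; nra.
Qed.

Lemma continuous_mul2 (u v A B : C -> R) (z : C) :
  continuous A z -> continuous B z -> continuous u z -> continuous v z ->
  continuous (fun w => A w * u w + B w * v w) z.
Proof.
intros; apply (continuous_plus (V := R_NormedModule));
  apply (continuous_mult (K := R_AbsRing)); assumption.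
Qed.

Lemma circle_integrand_continuous (A B : C -> R) (z w : C) (rho r th : R) : 0 < rho < r ->
  (forall w, square z r w -> continuous A w /\ continuous B w) ->
  Rabs (Re w - Re z) < r - rho -> Rabs (Im w - Im z) < r - rho ->
  continuous (fun th => A (Re w + rho * cos th, Im w + rho * sin th) * cos th
                      + B (Re w + rho * cos th, Im w + rho * sin th) * sin th) th.
Proof.
intros hr cont h1 h2; destruct (cont _ (translate_circle z w rho r th hr h1 h2)) as [cA cB].
assert (cc : forall f, ex_derive f th -> continuous f th)
  by (intros f; apply (ex_derive_continuous (K := R_AbsRing) (V := R_NormedModule))).
apply (continuous_plus (V := R_NormedModule)); apply (continuous_mult (K := R_AbsRing));
  try apply continuous_curve; auto; apply cc; auto_derive; auto.
Qed.

(** By uniform continuity of A and B on a compact square that contains the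
    circles around all centres near z. *)
Lemma circle_int_continuous (A B : C -> R) (z : C) (rho r : R) : 0 < rho < r ->
  (forall w, square z r w -> continuous A w /\ continuous B w) ->
  continuous (circle_int rho A B) z.
Proof.
intros hr cont; apply continuous_eps; intros eps.
assert (ep := cond_pos eps); assert (tpi := two_PI_pos).
set (r' := (rho + r) / 2).
set (e := eps / (4 * PI + 1)).
assert (epos : 0 < e) by (apply Rdiv_lt_0_compat; lra).
destruct z as [x y].
assert (cont' : forall s t, x - r' <= s <= x + r' -> y - r' <= t <= y + r' ->
  continuous A (s, t) /\ continuous B (s, t)).
{ intros s t hs ht; apply cont; split; simpl; unfold r' in *; apply Rabs_def1; lra. }
destruct (uniform_continuity_2d (fun s t => A (s, t)) (x - r') (x + r') (y - r') (y + r')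
  ltac:(intros; apply continuous_2d, cont'; assumption) (mkposreal _ epos)) as [d1' HA].
destruct (uniform_continuity_2d (fun s t => B (s, t)) (x - r') (x + r') (y - r') (y + r')
  ltac:(intros; apply continuous_2d, cont'; assumption) (mkposreal _ epos)) as [d2' HB].
simpl in HA, HB.
set (d := Rmin (Rmin d1' d2') (r' - rho)).
assert (dp : 0 < d).
{ repeat apply Rmin_pos; try apply cond_pos; unfold r'; lra. }
assert (l1 : d <= d1') by (eapply Rle_trans; [apply Rmin_l | apply Rmin_l]).
assert (l2 : d <= d2') by (eapply Rle_trans; [apply Rmin_l | apply Rmin_r]).
assert (l3 : d <= r' - rho) by apply Rmin_r.
exists (mkposreal _ dp); simpl; intros [s t] hs ht; simpl in hs, ht.
assert (hr' : 0 < rho < r' /\ r' < r) by (unfold r'; lra).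
assert (ins : forall (w : C) th, Rabs (Re w - x) < d -> Rabs (Im w - y) < d ->
  square (x, y) r' (Re w + rho * cos th, Im w + rho * sin th)).
{ intros w th k1 k2; apply translate_circle; simpl; lra. }
assert (h0 : Rabs (x - x) < d /\ Rabs (y - y) < d).
{ unfold Rminus; rewrite !Rplus_opp_r, Rabs_R0; lra. }
set (f := fun (w : C) th => A (Re w + rho * cos th, Im w + rho * sin th) * cos th
                    + B (Re w + rho * cos th, Im w + rho * sin th) * sin th).
assert (cf : forall (w : C) th, Rabs (Re w - x) < d -> Rabs (Im w - y) < d ->
  continuous (f w) th).
{ intros w th k1 k2; apply (circle_integrand_continuous A B (x, y) w rho r); auto; simpl; lra. }
change (Rabs (loop_int (f (s, t)) - loop_int (f (x, y))) < eps).
assert (E : loop_int (f (s, t)) - loop_int (f (x, y)) =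
  loop_int (fun th => f (s, t) th - f (x, y) th)).
{ symmetry; apply (RInt_minus (V := R_CompleteNormedModule)); apply ex_RInt_cont;
    intros th; apply cf; tauto. }
rewrite E.
assert (Bd : Rabs (loop_int (fun th => f (s, t) th - f (x, y) th))
  <= (2 * PI - 0) * (2 * e)).
{ apply abs_RInt_le_const; [lra | |].
  - apply ex_RInt_cont; intros th.
    apply (continuous_minus (V := R_NormedModule)); apply cf; tauto.
  - intros th _; destruct (ins (s, t) th hs ht) as [i1 i2].
    destruct (ins (x, y) th ltac:(simpl; tauto) ltac:(simpl; tauto)) as [j1 j2].
    simpl in i1, i2, j1, j2.
    apply Rabs_def2 in i1; apply Rabs_def2 in i2;
      apply Rabs_def2 in j1; apply Rabs_def2 in j2.
    assert (q1 : Rabs (s + rho * cos th - (x + rho * cos th)) < d).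
    { now replace (s + rho * cos th - (x + rho * cos th)) with (s - x) by ring. }
    assert (q2 : Rabs (t + rho * sin th - (y + rho * sin th)) < d).
    { now replace (t + rho * sin th - (y + rho * sin th)) with (t - y) by ring. }
    specialize (HA (x + rho * cos th) (y + rho * sin th) (s + rho * cos th)
      (t + rho * sin th) ltac:(lra) ltac:(lra) ltac:(lra) ltac:(lra) ltac:(lra) ltac:(lra)).
    specialize (HB (x + rho * cos th) (y + rho * sin th) (s + rho * cos th)
      (t + rho * sin th) ltac:(lra) ltac:(lra) ltac:(lra) ltac:(lra) ltac:(lra) ltac:(lra)).
    unfold f; simpl.
    set (a1 := A (s + rho * cos th, t + rho * sin th)) in *.
    set (a0 := A (x + rho * cos th, y + rho * sin th)) in *.
    set (b1 := B (s + rho * cos th, t + rho * sin th)) in *.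
    set (b0 := B (x + rho * cos th, y + rho * sin th)) in *.
    replace (a1 * cos th + b1 * sin th - (a0 * cos th + b0 * sin th)) with
      ((a1 - a0) * cos th + (b1 - b0) * sin th) by ring.
    eapply Rle_trans; [apply Rabs_triang|]; rewrite !Rabs_mult.
    assert (c1 := abs_cos_le th); assert (s1 := abs_sin_le th).
    assert (p1 := Rabs_pos (a1 - a0)); assert (p2 := Rabs_pos (b1 - b0)).
    assert (p3 := Rabs_pos (cos th)); assert (p4 := Rabs_pos (sin th)).
    nra. }
eapply Rle_lt_trans; [exact Bd|].
apply Rmult_lt_reg_r with (4 * PI + 1); [lra|].
replace ((2 * PI - 0) * (2 * e) * (4 * PI + 1)) with (4 * PI * eps)
  by (unfold e; field; lra); nra.
Qed.

Lemma circle_int_along (A B A1 A2 B1 B2 : C -> R) (a b : R -> R) (s0 p q rho r : R) :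
  0 < rho < r ->
  (forall w, square (a s0, b s0) r w ->
     has_grad A w (A1 w) (A2 w) /\ has_grad B w (B1 w) (B2 w)) ->
  (forall w, square (a s0, b s0) r w ->
     continuous (fun w => p * A1 w + q * A2 w) w /\ continuous (fun w => p * B1 w + q * B2 w) w) ->
  (forall s, is_derive a s p /\ is_derive b s q) ->
  (forall s, Rabs (a s - a s0) <= Rabs (s - s0) /\ Rabs (b s - b s0) <= Rabs (s - s0)) ->
  is_derive (fun s => circle_int rho A B (a s, b s)) s0
    (circle_int rho (fun w => p * A1 w + q * A2 w) (fun w => p * B1 w + q * B2 w) (a s0, b s0)).
Proof.
intros hr hg hc hd hn; assert (ep : 0 < r - rho) by lra.
set (px := fun w : C => a (Re w) + rho * cos (Im w)).
set (py := fun w : C => b (Re w) + rho * sin (Im w)).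
assert (gx : forall w, has_grad px w p (- rho * sin (Im w))).
{ intros w; eapply has_grad_eq; [apply has_grad_plus; [apply (has_grad_comp1 a _ _ p);
    [apply hd | apply has_grad_Re] |
    apply has_grad_mult; [apply has_grad_const | apply cos_Im_grad]] | |]; simpl; ring. }
assert (gy : forall w, has_grad py w q (rho * cos (Im w))).
{ intros w; eapply has_grad_eq; [apply has_grad_plus; [apply (has_grad_comp1 b _ _ q);
    [apply hd | apply has_grad_Re] |
    apply has_grad_mult; [apply has_grad_const | apply sin_Im_grad]] | |]; simpl; ring. }
assert (ins : forall s th, Rabs (s - s0) < r - rho ->
  square (a s0, b s0) r (px (s, th), py (s, th))).
{ intros s th hs; destruct (hn s).
  apply (translate_circle (a s0, b s0) (a s, b s)); simpl; lra. }
assert (G : forall s th, Rabs (s - s0) < r - rho ->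
  exists d, has_grad (fun w => A (px w, py w) * cos (Im w) + B (px w, py w) * sin (Im w))
    (s, th) ((p * A1 (px (s, th), py (s, th)) + q * A2 (px (s, th), py (s, th))) * cos th
           + (p * B1 (px (s, th), py (s, th)) + q * B2 (px (s, th), py (s, th))) * sin th) d).
{ intros s th hs; destruct (hg _ (ins s th hs)) as [gA gB].
  eexists; eapply has_grad_eq; [apply has_grad_plus; apply has_grad_mult;
    [apply (has_grad_comp2 A); [exact gA | apply gx | apply gy] | apply cos_Im_grad
    |apply (has_grad_comp2 B); [exact gB | apply gx | apply gy] | apply sin_Im_grad] | |
    reflexivity]; simpl; ring. }
apply (is_derive_RInt_circle
  (fun w => A (px w, py w) * cos (Im w) + B (px w, py w) * sin (Im w))
  (fun w => (p * A1 (px w, py w) + q * A2 (px w, py w)) * cos (Im w)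
          + (p * B1 (px w, py w) + q * B2 (px w, py w)) * sin (Im w))
  s0 (mkposreal _ ep)); simpl; intros s th hs; destruct (G s th hs) as [d g].
- exact (has_grad_partial1 _ _ _ _ _ g).
- destruct (hc _ (ins s th hs)) as [c1 c2].
  apply continuous_mul2; try (eapply has_grad_continuous; apply cos_Im_grad || apply sin_Im_grad).
  + apply (continuous_pair (fun w => p * A1 w + q * A2 w)); auto;
      eapply has_grad_continuous; apply gx || apply gy.
  + apply (continuous_pair (fun w => p * B1 w + q * B2 w)); auto;
      eapply has_grad_continuous; apply gx || apply gy.
- exact (has_grad_continuous _ _ _ _ g).
Qed.

(** The centre enters through a translation only, so the derivatives fall on A
    and B. *)
Lemma circle_int_grad (A B A1 A2 B1 B2 : C -> R) (c z : C) (rho r : R) :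
  0 < rho < r ->
  (forall w, square c r w -> has_grad A w (A1 w) (A2 w) /\ has_grad B w (B1 w) (B2 w)) ->
  (forall w, square c r w -> continuous A1 w /\ continuous B1 w) ->
  (forall w, square c r w -> continuous A2 w /\ continuous B2 w) ->
  square c (r - rho) z ->
  has_grad (circle_int rho A B) z (circle_int rho A1 B1 z) (circle_int rho A2 B2 z).
Proof.
intros hr hg h1 h2 hz.
assert (e1 : forall F G : C -> R, (fun w => 1 * F w + 0 * G w) = F)
  by (intros; apply functional_extensionality; intros; ring).
assert (e2 : forall F G : C -> R, (fun w => 0 * F w + 1 * G w) = G)
  by (intros; apply functional_extensionality; intros; ring).
assert (dist0 : forall x s : R, Rabs (x - x) <= Rabs s)
  by (intros; rewrite Rminus_diag, Rabs_R0; apply Rabs_pos).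
apply (has_grad_of_partials (square c (r - rho))); auto using square_is_open.
- intros w hw; destruct (sub_square c r rho w hw) as [r' [hr' sub]].
  assert (T := circle_int_along A B A1 A2 B1 B2 (fun t => t) (fun _ => Im w) (Re w) 1 0 rho r').
  rewrite !e1, C_eta in T; apply T; auto; [lra | | intros; split; [lra | apply dist0]].
  intros s; split; [apply (is_derive_id (K := R_AbsRing)) | apply is_derive_cst].
- destruct (sub_square c r rho z hz) as [r' [hr' sub]].
  assert (T := circle_int_along A B A1 A2 B1 B2 (fun _ => Re z) (fun t => t) (Im z) 0 1 rho r').
  rewrite !e2, C_eta in T; apply T; auto; [lra | | intros; split; [apply dist0 | lra]].
  intros s; split; [apply is_derive_cst | apply (is_derive_id (K := R_AbsRing))].
- destruct (sub_square c r rho z hz) as [r' [hr' sub]].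
  apply (circle_int_continuous A1 B1 z rho r'); auto; lra.
Qed.

(** The step that gains a derivative.  F = U + iV is holomorphic with continuous
    derivative u + iv; by Cauchy's formula the derivative is, near c, an average of F
    over circles of one fixed radius, hence it is as differentiable as F. *)
Lemma CR_derivative (U V u v : C -> R) (c : C) (r : R) : 0 < r ->
  (forall w, square c r w -> has_grad U w (u w) (- v w)) ->
  (forall w, square c r w -> has_grad V w (v w) (u w)) ->
  (forall w, square c r w -> continuous u w /\ continuous v w) ->
  has_grad u c (d1 u c) (- d1 v c) /\ has_grad v c (d1 v c) (d1 u c) /\
  continuous (d1 u) c /\ continuous (d1 v) c.
Proof.
intros rp gU gV cont.
set (rho := r / 2).
assert (hr : 0 < rho < r) by (unfold rho; lra).
assert (tpi := two_PI_pos).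
set (k := / (2 * PI * rho)).
assert (kp : 2 * PI * rho <> 0) by (apply Rgt_not_eq, Rmult_lt_0_compat; lra).
set (S := square c (r - rho)).
assert (oS : open S) by apply square_is_open.
assert (cS : S c) by (apply square_center; lra).
assert (Fu : forall z, S z -> k * circle_int rho U V z = u z).
{ intros z hz; destruct (sub_square c r rho z hz) as [r' [hr' sub]].
  destruct z as [x y]; unfold circle_int; cbn [Re Im fst snd].
  rewrite (cauchy_circle U V u v x y r').
  - unfold k; field; split; lra.
  - intros w hw; apply gU; auto.
  - intros w hw; apply gV; auto.
  - intros w hw; apply cont; auto.
  - lra. }
assert (Fv : forall z, S z -> k * circle_int rho V (fun w => - U w) z = v z).
{ intros z hz; destruct (sub_square c r rho z hz) as [r' [hr' sub]].
  destruct z as [x y]; unfold circle_int; cbn [Re Im fst snd].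
  rewrite (cauchy_circle V (fun w => - U w) v (fun w => - u w) x y r').
  - unfold k; field; split; lra.
  - intros w hw; eapply has_grad_eq; [apply gV; auto | |]; ring.
  - intros w hw; eapply has_grad_eq; [apply has_grad_opp, gU; auto | |]; ring.
  - intros w hw; apply cont; auto.
  - lra. }
set (u' := fun z => k * circle_int rho u v z).
set (v' := fun z => k * circle_int rho v (fun w => - u w) z).
assert (copp : forall (f : C -> R) w, continuous f w -> continuous (fun w => - f w) w)
  by (intros f w hf; apply (continuous_opp (V := R_NormedModule)); exact hf).
assert (gu : forall z, S z -> has_grad u z (u' z) (- v' z)).
{ intros z hz; apply (has_grad_ext_on S (fun z => k * circle_int rho U V z)); auto.
  eapply has_grad_eq; [apply has_grad_mult; [apply has_grad_const |
    apply (circle_int_grad U V u (fun w => - v w) v u c z rho r); auto] | |].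
  - intros w hw; destruct (cont w hw); auto.
  - unfold u'; ring.
  - replace (circle_int rho (fun w => - v w) u z) with
      (- circle_int rho v (fun w => - u w) z); [unfold v'; ring|].
    unfold circle_int, loop_int.
    destruct (sub_square c r rho z hz) as [r' [hr' sub]].
    etransitivity; [symmetry; apply (RInt_opp (V := R_CompleteNormedModule)), ex_RInt_cont|].
    + intros th; apply (circle_integrand_continuous v (fun w => - u w) z z rho r'); try lra;
        try (rewrite Rminus_diag, Rabs_R0; lra).
      intros w hw; destruct (cont w (sub w hw)); auto.
    + apply (RInt_ext (V := R_CompleteNormedModule)); intros th _;
      unfold opp; simpl; ring. }
assert (gv : forall z, S z -> has_grad v z (v' z) (u' z)).
{ intros z hz; apply (has_grad_ext_on S (fun z => k * circle_int rho V (fun w => - U w) z)); auto.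
  eapply has_grad_eq; [apply has_grad_mult; [apply has_grad_const |
    apply (circle_int_grad V (fun w => - U w) v u (fun w => - u w) v c z rho r); auto] | |].
  - intros w hw; split; auto.
    eapply has_grad_eq; [apply has_grad_opp, gU, hw | |]; ring.
  - intros w hw; destruct (cont w hw); auto.
  - unfold v'; ring.
  - unfold u'; ring. }
assert (Eu : forall z, S z -> u' z = d1 u z)
  by (intros z hz; symmetry; eapply has_grad_d1, gu, hz).
assert (Ev : forall z, S z -> v' z = d1 v z)
  by (intros z hz; symmetry; eapply has_grad_d1, gv, hz).
assert (cst : forall f : C -> R, continuous f c -> continuous (fun z => k * f z) c)
  by (intros f hf; apply (continuous_scal_r (V := R_NormedModule)); exact hf).
rewrite <- (Eu c), <- (Ev c) by assumption.
repeat split; auto.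
- apply (continuous_ext_on S u'); auto; apply cst, circle_int_continuous with r; auto.
- apply (continuous_ext_on S v'); auto; apply cst, circle_int_continuous with r; auto.
  intros w hw; destruct (cont w hw); auto.
Qed.

Lemma holomorphic_grad (D : C -> Prop) (f : C -> C) (z : C) :
  holomorphic_on D f -> D z ->
  has_grad (fun w => Re (f w)) z (Re (C_derive f z)) (- Im (C_derive f z)) /\
  has_grad (fun w => Im (f w)) z (Im (C_derive f z)) (Re (C_derive f z)).
Proof.
intros H Dz; apply C_derive_grad, C_derive_correct; [exact z | apply H, Dz].
Qed.

Lemma open_contains_square (D : C -> Prop) (z : C) : open D -> D z ->
  exists r, 0 < r /\ forall w, square z r w -> D w.
Proof.
intros oD Dz; destruct (open_contains_box D z oD Dz) as [d Hd].
exists d; split; [apply d | intros w [h1 h2]; auto].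
Qed.

(** A local primitive F of f exists by Goursat's theorem and is continuously
    differentiable.  So F' = f is continuously differentiable by
    [CR_derivative], and by the same lemma f' is holomorphic. *)
Lemma derivative_holomorphic (D : C -> Prop) (f : C -> C) :
  open D -> holomorphic_on D f -> holomorphic_on D (C_derive f).
Proof.
intros oD hf.
set (u := fun w => Re (f w)); set (v := fun w => Im (f w)).
assert (hg := fun z => holomorphic_grad D f z hf).
assert (C1 : forall z, D z -> has_grad u z (d1 u z) (- d1 v z) /\
  has_grad v z (d1 v z) (d1 u z) /\ continuous (d1 u) z /\ continuous (d1 v) z).
{ intros z Dz; destruct (open_contains_square D z oD Dz) as [r [rp sub]].
  destruct (primitive_on_square u (fun w => - v w) z r) as [U gU].
  { intros w hw; destruct (hg w (sub w hw)) as [g1 g2].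
    do 3 eexists; split; [exact g1 | apply has_grad_opp; exact g2]. }
  destruct (primitive_on_square v u z r) as [V gV].
  { intros w hw; destruct (hg w (sub w hw)) as [g1 g2].
    do 3 eexists; split; [exact g2 | exact g1]. }
  apply (CR_derivative U V u v z r); auto.
  intros w hw; destruct (hg w (sub w hw)) as [g1 g2].
  split; eapply has_grad_continuous; eassumption. }
intros z Dz; destruct (open_contains_square D z oD Dz) as [r [rp sub]].
destruct (CR_derivative u v (d1 u) (d1 v) z r) as (h1 & h2 & _); auto.
1-3: intros w hw; apply C1, sub, hw.
exists (d1 (d1 u) z, d1 (d1 v) z); apply grad_C_derive.
- apply (has_grad_ext_on D (d1 u)); auto.
  intros w Dw; apply (has_grad_d1 _ _ _ _ (proj1 (hg w Dw))).
- apply (has_grad_ext_on D (d1 v)); auto.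
  intros w Dw; apply (has_grad_d1 _ _ _ _ (proj2 (hg w Dw))).
Qed.

Lemma holomorphic_smooth (D : C -> Prop) (f : C -> C) :
  open D -> holomorphic_on D f -> smooth_onC D f.
Proof.
intros oD hf.
assert (K : forall k f, holomorphic_on D f ->
  Ck_on k D (fun w => Re (f w)) /\ Ck_on k D (fun w => Im (f w))).
{ clear f hf; induction k as [|k IH]; intros f hf.
  - split; split; auto; intros z Dz; destruct (holomorphic_grad D f z hf Dz);
      eapply has_grad_continuous; eassumption.
  - destruct (IH _ (derivative_holomorphic D f oD hf)) as [k1 k2].
    split.
    + apply (Ck_intro k D _ (fun w => Re (C_derive f w)) (fun w => - Im (C_derive f w)));
        auto using Ck_opp; intros z Dz; apply (holomorphic_grad D f z hf Dz).
    + apply (Ck_intro k D _ (fun w => Im (C_derive f w)) (fun w => Re (C_derive f w)));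
        auto; intros z Dz; apply (holomorphic_grad D f z hf Dz). }
split; intros k; apply (K k f hf).
Qed.

(** For harmonic u the 1-form - u_y dx + u_x dy is closed; its primitive is the
    imaginary part. *)
Lemma harmonic_real_part (u : C -> R) (c : C) (r : R) :
  Ck_on 2 (square c r) u ->
  (forall z, square c r z -> d1 (d1 u) z + d2 (d2 u) z = 0) ->
  exists f, holomorphic_on (square c r) f /\ forall z, square c r z ->
    Re (f z) = u z /\ C_derive f z = (d1 u z, - d2 u z).
Proof.
intros C2 harm.
assert (oS := square_is_open c r).
destruct (primitive_on_square (fun w => - d2 u w) (d1 u) c r) as [v gv].
{ intros z hz.
  assert (g1 := Ck_grad 0 _ _ z oS (Ck_d1 _ _ _ C2) hz).
  assert (g2 := Ck_grad 0 _ _ z oS (Ck_d2 _ _ _ C2) hz).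
  exists (- d1 (d2 u) z), (d1 (d1 u) z), (d2 (d1 u) z); split; auto.
  eapply has_grad_eq; [apply has_grad_opp, g2 | ring | specialize (harm z hz); lra]. }
assert (hd : forall z, square c r z ->
  @is_derive C_AbsRing C_NormedModule (fun w => (u w, v w)) z (d1 u z, - d2 u z)).
{ intros z hz; apply grad_C_derive; simpl; auto.
  eapply has_grad_eq; [apply (Ck_grad 1 _ _ z oS C2 hz) | ring | ring]. }
exists (fun w => (u w, v w)); split.
- intros z hz; eexists; apply hd, hz.
- intros z hz; split; [reflexivity | apply is_C_derive_unique, hd, hz].
Qed.

(** * The inverse function theorem in the plane *)

Definition sup_dist (z w : C) : R := Rmax (Rabs (Re z - Re w)) (Rabs (Im z - Im w)).

Lemma sup_dist_lt z w r : sup_dist z w < r <->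
  Rabs (Re z - Re w) < r /\ Rabs (Im z - Im w) < r.
Proof.
unfold sup_dist; split.
- intros h; split; eapply Rle_lt_trans; try exact h; [apply Rmax_l | apply Rmax_r].
- intros [h1 h2]; now apply Rmax_lub_lt.
Qed.

Lemma sup_dist_le z w r : sup_dist z w <= r <->
  Rabs (Re z - Re w) <= r /\ Rabs (Im z - Im w) <= r.
Proof.
unfold sup_dist; split.
- intros h; split; eapply Rle_trans; try exact h; [apply Rmax_l | apply Rmax_r].
- intros [h1 h2]; now apply Rmax_lub.
Qed.

Lemma sup_dist_pos z w : 0 <= sup_dist z w.
Proof. eapply Rle_trans; [apply Rabs_pos | apply Rmax_l]. Qed.

Lemma sup_dist_sym z w : sup_dist z w = sup_dist w z.
Proof. unfold sup_dist; now rewrite (Rabs_minus_sym (Re z)), (Rabs_minus_sym (Im z)). Qed.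

Lemma sup_dist_triang z w t : sup_dist z t <= sup_dist z w + sup_dist w t.
Proof.
apply sup_dist_le; split.
- replace (Re z - Re t) with ((Re z - Re w) + (Re w - Re t)) by ring.
  eapply Rle_trans; [apply Rabs_triang|]; apply Rplus_le_compat; apply Rmax_l.
- replace (Im z - Im t) with ((Im z - Im w) + (Im w - Im t)) by ring.
  eapply Rle_trans; [apply Rabs_triang|]; apply Rplus_le_compat; apply Rmax_r.
Qed.

Lemma sup_dist_eq0 z w : sup_dist z w <= 0 -> z = w.
Proof.
intros h; apply sup_dist_le in h; destruct h as [h1 h2].
assert (p1 := Rabs_pos (Re z - Re w)); assert (p2 := Rabs_pos (Im z - Im w)).
assert (e1 : Re z - Re w = 0) by (apply Rabs_eq_0; lra).
assert (e2 : Im z - Im w = 0) by (apply Rabs_eq_0; lra).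
destruct z as [x y], w as [u v]; simpl in e1, e2; f_equal; lra.
Qed.

(** Shifting x n down by 2 K / 2 ^ n turns it into the left end of a nested
    sequence of intervals. *)
Lemma half_cauchy_limit (x : nat -> R) (K : R) :
  (forall n, Rabs (x (S n) - x n) <= K / 2 ^ n) ->
  exists l, forall n, Rabs (x n - l) <= 2 * K / 2 ^ n.
Proof.
intros H.
destruct (nested_halves (fun n => x n - 2 * K / 2 ^ n) (4 * K)) as [l hl].
- intros n; specialize (H n); apply Rabs_le_between in H.
  assert (E : 4 * K / 2 ^ S n = 2 * K / 2 ^ n) by (simpl; field; apply pow_nonzero; lra).
  assert (E2 : 2 * K / 2 ^ S n = K / 2 ^ n) by (simpl; field; apply pow_nonzero; lra).
  assert (E3 : 2 * K / 2 ^ n = K / 2 ^ n + K / 2 ^ n) by lra.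
  rewrite E, E2; lra.
- exists l; intros n; specialize (hl n).
  assert (E : 4 * K / 2 ^ n = 2 * K / 2 ^ n + 2 * K / 2 ^ n) by lra.
  apply Rabs_le; lra.
Qed.

(** Banach's fixed point theorem on a closed square; the bound on Phi c keeps the
    iterates inside. *)
Lemma contraction_fixpoint (Phi : C -> C) (c : C) (r : R) : 0 < r ->
  (forall z w, sup_dist z c <= r -> sup_dist w c <= r ->
     sup_dist (Phi z) (Phi w) <= / 2 * sup_dist z w) ->
  sup_dist (Phi c) c <= r / 2 ->
  exists z, sup_dist z c <= r /\ Phi z = z.
Proof.
intros rp contr hc.
set (it := fix it n := match n with O => c | S k => Phi (it k) end).
assert (p2 : forall n, 0 < / 2 ^ n) by
  (intros n; apply Rinv_0_lt_compat, pow_lt; lra).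
assert (cc : sup_dist c c = 0).
{ unfold sup_dist, Rminus; rewrite !Rplus_opp_r, Rabs_R0; apply Rmax_left; lra. }
assert (stay : forall z, sup_dist z c <= r -> sup_dist (Phi z) c <= r).
{ intros z hz; assert (k := contr z c hz ltac:(lra)).
  assert (t := sup_dist_triang (Phi z) (Phi c) c); lra. }
assert (itin : forall n, sup_dist (it n) c <= r).
{ induction n as [|n IH]; simpl; [lra | auto]. }
assert (step : forall n, sup_dist (it (S n)) (it n) <= r / 2 / 2 ^ n).
{ induction n as [|n IH].
  - simpl; lra.
  - change (sup_dist (Phi (it (S n))) (Phi (it n)) <= r / 2 / 2 ^ S n).
    assert (k := contr _ _ (itin (S n)) (itin n)).
    replace (r / 2 / 2 ^ S n) with (/ 2 * (r / 2 / 2 ^ n))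
      by (simpl; field; apply pow_nonzero; lra); lra. }
destruct (half_cauchy_limit (fun n => Re (it n)) (r / 2)) as [x hx].
{ intros n; specialize (step n); apply sup_dist_le in step; apply step. }
destruct (half_cauchy_limit (fun n => Im (it n)) (r / 2)) as [y hy].
{ intros n; specialize (step n); apply sup_dist_le in step; apply step. }
assert (lim : forall n, sup_dist (it n) (x, y) <= r / 2 ^ n).
{ intros n; apply sup_dist_le; simpl.
  specialize (hx n); specialize (hy n).
  replace (2 * (r / 2)) with r in hx, hy by field; split; assumption. }
assert (small : forall e, 0 < e -> exists n, r / 2 ^ n < e).
{ intros e he; destruct (pow_lt_1_zero (/ 2) ltac:(rewrite Rabs_pos_eq; lra) (e / r))
    as [n Hn]; [now apply Rdiv_lt_0_compat|].
  exists n; specialize (Hn n (Nat.le_refl n)).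
  rewrite Rabs_pos_eq in Hn by (apply pow_le; lra); rewrite pow_inv in Hn.
  apply Rmult_lt_compat_l with (r := r) in Hn; [|lra].
  replace (r * (e / r)) with e in Hn by (field; lra); exact Hn. }
exists (x, y).
assert (hin : sup_dist (x, y) c <= r).
{ apply le_epsilon; intros e he; destruct (small e he) as [n hn].
  assert (t := sup_dist_triang (x, y) (it n) c).
  assert (l := lim n); rewrite (sup_dist_sym (it n)) in l.
  assert (i := itin n); lra. }
split; [exact hin|].
apply sup_dist_eq0, le_epsilon; intros e he.
destruct (small (e / 2) ltac:(lra)) as [n hn].
assert (t := sup_dist_triang (Phi (x, y)) (Phi (it n)) (x, y)).
assert (k := contr (x, y) (it n) hin (itin n)).
assert (l := lim n); assert (l' := lim (S n)); rewrite (sup_dist_sym (it n)) in l.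
change (sup_dist (Phi (it n)) (x, y) <= r / 2 ^ S n) in l'.
assert (h : r / 2 ^ S n <= r / 2 ^ n).
{ replace (r / 2 ^ S n) with (/ 2 * (r * / 2 ^ n)) by (simpl; field; apply pow_nonzero; lra).
  assert (q := Rmult_lt_0_compat _ _ rp (p2 n)); unfold Rdiv; lra. }
assert (q := sup_dist_pos (x, y) (it n)); lra.
Qed.

(** Go from w to z by a horizontal and a vertical segment, each at most as long
    as the distance. *)
Lemma mean_value_square (F F1 F2 : C -> R) (c : C) (r M : R) :
  (forall w, sup_dist w c <= r -> has_grad F w (F1 w) (F2 w)) ->
  (forall w, sup_dist w c <= r -> Rabs (F1 w) <= M /\ Rabs (F2 w) <= M) ->
  forall z w, sup_dist z c <= r -> sup_dist w c <= r ->
  Rabs (F z - F w) <= 2 * M * sup_dist z w.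
Proof.
intros hg hM z w hz hw; destruct z as [x y], w as [u v].
apply sup_dist_le in hz; apply sup_dist_le in hw; simpl in hz, hw.
assert (btw : forall a b t c, Rmin a b <= t <= Rmax a b ->
  Rabs (a - c) <= r -> Rabs (b - c) <= r -> Rabs (t - c) <= r).
{ intros a b t d ht ha hb; apply Rabs_le_between in ha; apply Rabs_le_between in hb.
  apply Rabs_le; revert ht; unfold Rmin, Rmax; destruct (Rle_dec a b); lra. }
destruct (MVT_gen (fun t => F (t, y)) u x (fun t => F1 (t, y))) as [s [hs E1]].
{ intros t ht; eapply has_grad_partial1, hg, sup_dist_le; simpl; split; [|apply hz].
  apply (btw u x); [lra | apply hw | apply hz]. }
{ intros t ht; apply continuity_pt_filterlim, (continuous_hor F).
  eapply has_grad_continuous, hg, sup_dist_le; simpl; split; [|apply hz].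
  apply (btw u x); [lra | apply hw | apply hz]. }
destruct (MVT_gen (fun t => F (u, t)) v y (fun t => F2 (u, t))) as [s' [hs' E2]].
{ intros t ht; eapply has_grad_partial2, hg, sup_dist_le; simpl; split; [apply hw|].
  apply (btw v y); [lra | apply hw | apply hz]. }
{ intros t ht; apply continuity_pt_filterlim, (continuous_ver F).
  eapply has_grad_continuous, hg, sup_dist_le; simpl; split; [apply hw|].
  apply (btw v y); [lra | apply hw | apply hz]. }
simpl in E1, E2.
replace (F (x, y) - F (u, v)) with (F1 (s, y) * (x - u) + F2 (u, s') * (y - v)) by lra.
destruct (hM (s, y)) as [m1 _].
{ apply sup_dist_le; simpl; split; [|apply hz]; apply (btw u x); [lra | apply hw | apply hz]. }
destruct (hM (u, s')) as [_ m2].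
{ apply sup_dist_le; simpl; split; [apply hw|]; apply (btw v y); [lra | apply hw | apply hz]. }
eapply Rle_trans; [apply Rabs_triang|]; rewrite !Rabs_mult.
assert (d := Rle_refl (sup_dist (x, y) (u, v))); apply sup_dist_le in d; simpl in d.
assert (q := sup_dist_pos (x, y) (u, v)).
set (S0 := sup_dist (x, y) (u, v)) in *.
replace (2 * M * S0) with (M * S0 + M * S0) by ring.
apply Rplus_le_compat; apply Rmult_le_compat; try apply Rabs_pos; tauto.
Qed.

Lemma square_sup_dist c r z : square c r z <-> sup_dist z c < r.
Proof. rewrite sup_dist_lt; reflexivity. Qed.

Lemma Rabs_lin2 (a b x y M : R) : Rabs x <= M -> Rabs y <= M ->
  Rabs (a * x + b * y) <= (Rabs a + Rabs b) * M.
Proof.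
intros hx hy; eapply Rle_trans; [apply Rabs_triang|]; rewrite !Rabs_mult.
assert (p := Rabs_pos a); assert (q := Rabs_pos b); nra.
Qed.

(** The Lipschitz bound on sigma turns the o(|z' - z|) in the first-order
    expansion of (P, Q) into o(|w' - w|), and the linear part is inverted by
    Cramer's rule. *)
Lemma inverse_grad (P Q : C -> R) (sigma : C -> C) (w : C) (rad K a b c d : R) :
  0 < rad -> 0 <= K ->
  has_grad P (sigma w) a b -> has_grad Q (sigma w) c d -> a * d - b * c <> 0 ->
  (forall w', square w rad w' -> P (sigma w') = Re w' /\ Q (sigma w') = Im w' /\
     sup_dist (sigma w') (sigma w) <= K * sup_dist w' w) ->
  has_grad (fun w => Re (sigma w)) w (d / (a * d - b * c)) (- b / (a * d - b * c)) /\
  has_grad (fun w => Im (sigma w)) w (- c / (a * d - b * c)) (a / (a * d - b * c)).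
Proof.
intros rp Kp hP hQ; set (j := a * d - b * c); intros nz H.
assert (J : 0 < Rabs j) by now apply Rabs_pos_lt.
set (L := (Rabs a + Rabs b + Rabs c + Rabs d) / Rabs j).
assert (Lp : 0 <= L).
{ apply Rle_mult_inv_pos; auto; assert (p1 := Rabs_pos a); assert (p2 := Rabs_pos b);
    assert (p3 := Rabs_pos c); assert (p4 := Rabs_pos d); lra. }
assert (KL : 0 < L * K + 1) by (assert (h := Rmult_le_pos _ _ Lp Kp); lra).
assert (main : forall eps : posreal, exists delta : posreal, forall w' : C,
  Rabs (Re w' - Re w) < delta -> Rabs (Im w' - Im w) < delta ->
  exists e1 e2, Rabs e1 <= eps / (L * K + 1) * K * sup_dist w' w /\
    Rabs e2 <= eps / (L * K + 1) * K * sup_dist w' w /\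
    Re (sigma w') - Re (sigma w) - (d / j * (Re w' - Re w) + - b / j * (Im w' - Im w))
      = - (d / j) * e1 + b / j * e2 /\
    Im (sigma w') - Im (sigma w) - (- c / j * (Re w' - Re w) + a / j * (Im w' - Im w))
      = c / j * e1 + - (a / j) * e2).
{ intros eps; assert (ep := cond_pos eps).
  assert (etap : 0 < eps / (L * K + 1)) by now apply Rdiv_lt_0_compat.
  destruct (hP (mkposreal _ etap)) as [r1 H1], (hQ (mkposreal _ etap)) as [r2 H2].
  cbn [pos] in H1, H2.
  set (m := Rmin r1 r2 / (K + 1)).
  assert (mp : 0 < m) by
    (apply Rdiv_lt_0_compat; [apply Rmin_pos; apply cond_pos | lra]).
  assert (dp : 0 < Rmin rad m) by now apply Rmin_pos.
  exists (mkposreal _ dp); cbn [pos]; intros w' k1 k2.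
  assert (l1 := Rmin_l rad m); assert (l2 := Rmin_r rad m).
  destruct (H w') as (Pw & Qw & lip); [split; lra|].
  destruct (H w) as (Pw0 & Qw0 & _); [now apply square_center|].
  assert (near : sup_dist (sigma w') (sigma w) < Rmin r1 r2).
  { eapply Rle_lt_trans; [exact lip|].
    assert (h : sup_dist w' w < m) by (apply sup_dist_lt; lra).
    assert (q := sup_dist_pos w' w).
    replace (Rmin r1 r2) with ((K + 1) * m) by (unfold m; field; lra); nra. }
  apply sup_dist_lt in near; destruct near as [n1 n2].
  assert (l3 := Rmin_l r1 r2); assert (l4 := Rmin_r r1 r2).
  specialize (H1 (Re (sigma w')) (Im (sigma w')) ltac:(lra) ltac:(lra)).
  specialize (H2 (Re (sigma w')) (Im (sigma w')) ltac:(lra) ltac:(lra)).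
  rewrite !C_eta, Pw, Pw0 in H1; rewrite !C_eta, Qw, Qw0 in H2.
  fold (sup_dist (sigma w') (sigma w)) in H1, H2.
  assert (tr : eps / (L * K + 1) * sup_dist (sigma w') (sigma w)
    <= eps / (L * K + 1) * K * sup_dist w' w).
  { rewrite Rmult_assoc; apply Rmult_le_compat_l; lra. }
  eexists; eexists; split; [eapply Rle_trans; [exact H1 | exact tr]|].
  split; [eapply Rle_trans; [exact H2 | exact tr]|].
  unfold j; split; field; exact nz. }
assert (fin : forall (eps : posreal) w' p q e1 e2,
  Rabs p + Rabs q <= Rabs a + Rabs b + Rabs c + Rabs d ->
  Rabs e1 <= eps / (L * K + 1) * K * sup_dist w' w ->
  Rabs e2 <= eps / (L * K + 1) * K * sup_dist w' w ->
  Rabs (p / j * e1 + q / j * e2) <= eps * sup_dist w' w).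
{ intros eps w' p q e1 e2 hpq h1 h2; assert (ep := cond_pos eps).
  eapply Rle_trans; [apply Rabs_lin2; eassumption|].
  assert (hl : Rabs (p / j) + Rabs (q / j) <= L).
  { unfold L, Rdiv; rewrite !Rabs_mult, !Rabs_inv, <- Rmult_plus_distr_r.
    apply Rmult_le_compat_r; [left; now apply Rinv_0_lt_compat | exact hpq]. }
  assert (q0 := sup_dist_pos w' w).
  assert (X : 0 <= eps / (L * K + 1) * K * sup_dist w' w).
  { repeat apply Rmult_le_pos; try lra; left; now apply Rinv_0_lt_compat. }
  eapply Rle_trans; [apply Rmult_le_compat_r; [exact X | exact hl]|].
  replace (L * (eps / (L * K + 1) * K * sup_dist w' w)) with
    (eps * sup_dist w' w * (L * K / (L * K + 1))) by (field; lra).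
  rewrite <- (Rmult_1_r (eps * sup_dist w' w)) at 2.
  apply Rmult_le_compat_l; [apply Rmult_le_pos; lra|].
  apply Rmult_le_reg_r with (L * K + 1); [lra|].
  unfold Rdiv; rewrite Rmult_assoc, Rinv_l by lra; lra. }
assert (p1 := Rabs_pos a); assert (p2 := Rabs_pos b);
  assert (p3 := Rabs_pos c); assert (p4 := Rabs_pos d).
split; intros eps; destruct (main eps) as [delta Hd]; exists delta; intros u v k1 k2;
  destruct (Hd (u, v) k1 k2) as (e1 & e2 & h1 & h2 & E1 & E2);
  cbn [Re Im fst snd] in E1, E2; rewrite ?C_eta.
- rewrite E1; replace (- (d / j)) with ((- d) / j) by (unfold Rdiv; ring).
  apply (fin eps (u, v) (- d) b e1 e2); auto; rewrite Rabs_Ropp; lra.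
- rewrite E2; replace (- (a / j)) with ((- a) / j) by (unfold Rdiv; ring).
  apply (fin eps (u, v) c (- a) e1 e2); auto; rewrite Rabs_Ropp; lra.
Qed.

Lemma smooth_continuous D F z : smooth_on D F -> D z -> continuous F z.
Proof. intros H; apply (Ck_continuous 0), H. Qed.

Lemma smooth_grad D F z : open D -> smooth_on D F -> D z ->
  has_grad F z (d1 F z) (d2 F z).
Proof. intros oD H; apply (Ck_grad 0); auto. Qed.

Lemma smooth_d1 D F : smooth_on D F -> smooth_on D (d1 F).
Proof. intros H k; apply (Ck_d1 k D F (H (S k))). Qed.

Lemma smooth_d2 D F : smooth_on D F -> smooth_on D (d2 F).
Proof. intros H k; apply (Ck_d2 k D F (H (S k))). Qed.

Lemma continuous_pos_near (F : C -> R) (z : C) : continuous F z -> 0 < F z ->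
  exists r, 0 < r /\ forall w, sup_dist w z <= r -> 0 < F w.
Proof.
intros cF h.
destruct (proj1 (continuous_eps F z) cF (mkposreal _ h)) as [d Hd]; simpl in Hd.
assert (dp := cond_pos d).
exists (d / 2); split; [lra|]; intros w hw; apply sup_dist_le in hw.
specialize (Hd w ltac:(lra) ltac:(lra)); apply Rabs_def2 in Hd; lra.
Qed.

(** Let A be the inverse of the differential of F = (P, Q) at z0.  For all w the
    map z - A (F z - w) has Lipschitz constant 1/2 on a small square.  Its fixed
    point solves F z = w, and the same estimate shows that F is injective with
    Lipschitz inverse.  The inverse is smooth by induction, as its differential
    is the inverse of that of F composed with sigma. *)
Theorem local_inverse (D : C -> Prop) (P Q : C -> R) (z0 : C) :
  open D -> D z0 -> smooth_on D P -> smooth_on D Q ->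
  d1 P z0 * d2 Q z0 - d2 P z0 * d1 Q z0 <> 0 ->
  exists (V : C -> Prop) (r : R) (sigma : C -> C),
    0 < r /\ open V /\ V z0 /\ (forall z, V z -> D z) /\
    (forall z, V z -> square (P z0, Q z0) r (P z, Q z) /\ sigma (P z, Q z) = z) /\
    (forall w, square (P z0, Q z0) r w ->
       V (sigma w) /\ (P (sigma w), Q (sigma w)) = w) /\
    smooth_onC (square (P z0, Q z0) r) sigma.
Proof.
intros oD Dz sP sQ.
set (a := d1 P z0); set (b := d2 P z0); set (c := d1 Q z0); set (d := d2 Q z0).
set (j := a * d - b * c); intros nz.
assert (J : 0 < Rabs j) by now apply Rabs_pos_lt.
set (L := (Rabs a + Rabs b + Rabs c + Rabs d) / Rabs j).
assert (p1 := Rabs_pos a); assert (p2 := Rabs_pos b);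
  assert (p3 := Rabs_pos c); assert (p4 := Rabs_pos d).
assert (Lp : 0 <= L) by (apply Rle_mult_inv_pos; auto; lra).
set (E1 := fun z => Re z - (d / j * P z + - b / j * Q z)).
set (E2 := fun z => Im z - (- c / j * P z + a / j * Q z)).
set (E11 := fun z => 1 - (d / j * d1 P z + - b / j * d1 Q z)).
set (E12 := fun z => 0 - (d / j * d2 P z + - b / j * d2 Q z)).
set (E21 := fun z => 0 - (- c / j * d1 P z + a / j * d1 Q z)).
set (E22 := fun z => 1 - (- c / j * d2 P z + a / j * d2 Q z)).
set (Jac := fun z => d1 P z * d2 Q z - d2 P z * d1 Q z).
assert (sP1 := smooth_d1 D P sP); assert (sP2 := smooth_d2 D P sP).
assert (sQ1 := smooth_d1 D Q sQ); assert (sQ2 := smooth_d2 D Q sQ).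
assert (gE1 : forall z, D z -> has_grad E1 z (E11 z) (E12 z)).
{ intros z hz; eapply has_grad_eq;
    [apply has_grad_minus; [apply has_grad_Re|]; apply has_grad_plus;
      apply has_grad_mult; try apply has_grad_const; apply (smooth_grad D); auto | |];
    unfold E11, E12; ring. }
assert (gE2 : forall z, D z -> has_grad E2 z (E21 z) (E22 z)).
{ intros z hz; eapply has_grad_eq;
    [apply has_grad_minus; [apply has_grad_Im|]; apply has_grad_plus;
      apply has_grad_mult; try apply has_grad_const; apply (smooth_grad D); auto | |];
    unfold E21, E22; ring. }
assert (cst : forall k l p (F G : C -> R), smooth_on D F -> smooth_on D G ->
  Ck_on 0 D (fun z => k - (l * F z + p * G z))).
{ intros k l p F G hF hG; apply Ck_minus; [auto | now apply Ck_const |].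
  apply Ck_plus; auto; apply Ck_mult; auto using Ck_const. }
set (dE := fun z => / 16 - (E11 z ^ 2 + E12 z ^ 2 + E21 z ^ 2 + E22 z ^ 2)).
assert (cE : continuous dE z0).
{ apply (Ck_continuous 0 D); auto; apply Ck_minus; auto using Ck_const.
  repeat apply Ck_plus; auto; apply Ck_sq; auto; apply cst; auto. }
destruct (continuous_pos_near dE z0 cE) as [r1 [r1p b1]].
{ replace (dE z0) with (/ 16); [lra|].
  unfold dE, E11, E12, E21, E22; fold a b c d; unfold j; field; exact nz. }
assert (cJ : continuous (fun z => Jac z * j) z0).
{ apply (Ck_continuous 0 D); auto; apply Ck_mult; auto using Ck_const.
  apply Ck_minus; auto; apply Ck_mult; auto. }
destruct (continuous_pos_near _ z0 cJ) as [r5 [r5p b5]].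
{ unfold Jac; fold a b c d; fold j; nra. }
destruct (open_contains_square D z0 oD Dz) as [r6 [r6p b6]].
assert (exists r0, 0 < r0 /\ r0 <= r1 /\ r0 <= r5 /\ r0 < r6) as (r0 & r0p & c1 & c5 & c6).
{ exists (Rmin r1 (Rmin r5 (r6 / 2))).
  assert (k1 := Rmin_l r1 (Rmin r5 (r6 / 2))); assert (k2 := Rmin_r r1 (Rmin r5 (r6 / 2))).
  assert (k3 := Rmin_l r5 (r6 / 2)); assert (k4 := Rmin_r r5 (r6 / 2)).
  split; [repeat apply Rmin_pos; lra | lra]. }
assert (small : forall z, sup_dist z z0 <= r0 -> (Rabs (E11 z) <= / 4 /\ Rabs (E12 z) <= / 4) /\
  Rabs (E21 z) <= / 4 /\ Rabs (E22 z) <= / 4).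
{ intros z hz; assert (h := b1 z ltac:(lra)); unfold dE in h.
  repeat split; apply Rabs_le; nra. }
assert (inD : forall z, sup_dist z z0 <= r0 -> D z).
{ intros z hz; apply b6, square_sup_dist; lra. }
assert (JP : forall z, sup_dist z z0 <= r0 -> Jac z <> 0).
{ intros z hz h; specialize (b5 z ltac:(lra)); simpl in b5; rewrite h in b5; lra. }
set (E := fun z : C => (E1 z, E2 z) : C).
assert (contr : forall z w, sup_dist z z0 <= r0 -> sup_dist w z0 <= r0 ->
  sup_dist (E z) (E w) <= / 2 * sup_dist z w).
{ intros z w hz hw; apply sup_dist_le; simpl.
  replace (/ 2) with (2 * / 4) by field; split.
  - apply (mean_value_square E1 E11 E12 z0 r0 (/ 4)); auto.
    intros; now apply small.
  - apply (mean_value_square E2 E21 E22 z0 r0 (/ 4)); auto.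
    intros; now apply small. }
set (F := fun z : C => (P z, Q z) : C).
set (Ainv := fun p q : R => (d / j * p + - b / j * q, - c / j * p + a / j * q)).
assert (Abd : forall p q M, Rabs p <= M -> Rabs q <= M ->
  Rabs (fst (Ainv p q)) <= L * M /\ Rabs (snd (Ainv p q)) <= L * M).
{ intros p q M hp hq.
  assert (Mp : 0 <= M) by (eapply Rle_trans; [apply Rabs_pos | exact hp]).
  assert (aux : forall x y, Rabs x + Rabs y <= Rabs a + Rabs b + Rabs c + Rabs d ->
    Rabs (x / j * p + y / j * q) <= L * M).
  { intros x y hxy; eapply Rle_trans; [apply Rabs_lin2; eassumption|].
    apply Rmult_le_compat_r; auto.
    unfold L, Rdiv; rewrite !Rabs_mult, !Rabs_inv, <- Rmult_plus_distr_r.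
    apply Rmult_le_compat_r; [left; now apply Rinv_0_lt_compat | exact hxy]. }
  split; apply aux; rewrite ?Rabs_Ropp; lra. }
assert (lip : forall z w, sup_dist z z0 <= r0 -> sup_dist w z0 <= r0 ->
  sup_dist z w <= 2 * L * sup_dist (F z) (F w)).
{ intros z w hz hw; assert (k := contr z w hz hw).
  assert (t : sup_dist z w <= sup_dist (E z) (E w) + L * sup_dist (F z) (F w)).
  { assert (u := Rle_refl (sup_dist (E z) (E w))); apply sup_dist_le in u.
    assert (v := Rle_refl (sup_dist (F z) (F w))); apply sup_dist_le in v.
    destruct v as [v1 v2]; destruct (Abd _ _ _ v1 v2) as [A1 A2].
    destruct u as [u1 u2]; apply sup_dist_le; split.
    - replace (Re z - Re w) with (Re (E z) - Re (E w) +
        fst (Ainv (Re (F z) - Re (F w)) (Im (F z) - Im (F w))))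
        by (unfold Ainv, E, F, E1; simpl; field; exact nz).
      eapply Rle_trans; [apply Rabs_triang | lra].
    - replace (Im z - Im w) with (Im (E z) - Im (E w) +
        snd (Ainv (Re (F z) - Re (F w)) (Im (F z) - Im (F w))))
        by (unfold Ainv, E, F, E2; simpl; field; exact nz).
      eapply Rle_trans; [apply Rabs_triang | lra]. }
  lra. }
(* r is such that for w within r of F z0 the first iterate moves z0 by at most r' / 2 *)
set (r' := r0 / 2); set (r := r' / (2 * (L + 1))).
assert (r'p : 0 < r' < r0) by (unfold r'; lra).
assert (rp : 0 < r) by (apply Rdiv_lt_0_compat; lra).
assert (cc : sup_dist z0 z0 = 0).
{ unfold sup_dist, Rminus; rewrite !Rplus_opp_r, Rabs_R0; apply Rmax_left; lra. }
assert (surj : forall w, exists z, square (F z0) r w -> sup_dist z z0 <= r' /\ F z = w).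
{ intros w; destruct (classic (square (F z0) r w)) as [hw|nh]; [|exists z0; tauto].
  apply square_sup_dist in hw.
  assert (hF : forall z, (E1 z + fst (Ainv (Re w) (Im w)),
      E2 z + snd (Ainv (Re w) (Im w))) = z -> F z = w).
  { intros z hz; apply (f_equal Re) in hz as h1; apply (f_equal Im) in hz as h2.
    unfold E1, E2, Ainv in h1, h2; simpl in h1, h2.
    assert (k1 : d / j * (P z - Re w) + - b / j * (Q z - Im w) = 0) by lra.
    assert (k2 : - c / j * (P z - Re w) + a / j * (Q z - Im w) = 0) by lra.
    apply sup_dist_eq0, sup_dist_le; unfold F; simpl.
    assert (q1 : P z - Re w = 0).
    { transitivity (a * (d / j * (P z - Re w) + - b / j * (Q z - Im w)) +
        b * (- c / j * (P z - Re w) + a / j * (Q z - Im w)));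
        [unfold j; field; exact nz | rewrite k1, k2; ring]. }
    assert (q2 : Q z - Im w = 0).
    { transitivity (c * (d / j * (P z - Re w) + - b / j * (Q z - Im w)) +
        d * (- c / j * (P z - Re w) + a / j * (Q z - Im w)));
        [unfold j; field; exact nz | rewrite k1, k2; ring]. }
    rewrite q1, q2, Rabs_R0; lra. }
  destruct (contraction_fixpoint (fun z => (E1 z + fst (Ainv (Re w) (Im w)),
      E2 z + snd (Ainv (Re w) (Im w)))) z0 r') as [z [hz1 hz2]].
  - lra.
  - intros z1 z2 h1 h2; assert (k := contr z1 z2 ltac:(lra) ltac:(lra)).
    apply sup_dist_le in k; simpl in k; apply sup_dist_le; cbn [Re Im fst snd].
    replace (E1 z1 + fst (Ainv (Re w) (Im w)) - (E1 z2 + fst (Ainv (Re w) (Im w))))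
      with (E1 z1 - E1 z2) by ring.
    replace (E2 z1 + snd (Ainv (Re w) (Im w)) - (E2 z2 + snd (Ainv (Re w) (Im w))))
      with (E2 z1 - E2 z2) by ring.
    exact k.
  - assert (v := Rle_refl (sup_dist w (F z0))); apply sup_dist_le in v.
    destruct v as [v1 v2]; destruct (Abd _ _ _ v1 v2) as [A1 A2].
    assert (s : L * sup_dist w (F z0) <= r' / 2).
    { assert (q := sup_dist_pos w (F z0)).
      apply Rle_trans with (L * r); [apply Rmult_le_compat_l; lra|].
      replace (r' / 2) with ((L + 1) * r) by (unfold r; field; lra); nra. }
    apply sup_dist_le; cbn [Re Im fst snd].
    replace (E1 z0 + fst (Ainv (Re w) (Im w)) - Re z0) with
      (fst (Ainv (Re w - Re (F z0)) (Im w - Im (F z0))))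
      by (unfold Ainv, F, E1; simpl; field; exact nz).
    replace (E2 z0 + snd (Ainv (Re w) (Im w)) - Im z0) with
      (snd (Ainv (Re w - Re (F z0)) (Im w - Im (F z0))))
      by (unfold Ainv, F, E2; simpl; field; exact nz).
    lra.
  - exists z; intros _; split; [exact hz1 | apply hF, hz2]. }
set (sigma := fun w => proj1_sig (constructive_indefinite_description _ (surj w))).
assert (sig : forall w, square (F z0) r w -> sup_dist (sigma w) z0 <= r' /\ F (sigma w) = w).
{ intros w; exact (proj2_sig (constructive_indefinite_description _ (surj w))). }
set (V := fun z => square z0 r0 z /\ square (F z0) r (F z)).
assert (sigV : forall w, square (F z0) r w -> V (sigma w)).
{ intros w hw; destruct (sig w hw) as [h1 h2]; split; [apply square_sup_dist; lra|].
  now rewrite h2. }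
assert (uniq : forall z, V z -> sigma (F z) = z).
{ intros z [h1 h2]; apply square_sup_dist in h1; destruct (sig _ h2) as [k1 k2].
  apply sup_dist_eq0; eapply Rle_trans; [apply lip; lra|].
  rewrite k2; right.
  unfold sup_dist, Rminus; rewrite !Rplus_opp_r, Rabs_R0, Rmax_left; lra. }
exists V, r, sigma; split; [exact rp | split; [|split; [|split; [|split; [|split]]]]].
- apply open_of_boxes; intros z [h1 h2].
  assert (Dz' : D z) by (apply inD; apply square_sup_dist in h1; lra).
  destruct (open_contains_box _ z (square_is_open z0 r0) h1) as [e1 H1].
  destruct (open_contains_box _ (F z) (square_is_open (F z0) r) h2) as [e2 H2].
  destruct (proj1 (continuous_eps P z) (smooth_continuous D P z sP Dz') e2) as [e3 H3].
  destruct (proj1 (continuous_eps Q z) (smooth_continuous D Q z sQ Dz') e2) as [e4 H4].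
  assert (ep : 0 < Rmin e1 (Rmin e3 e4)) by (repeat apply Rmin_pos; apply cond_pos).
  exists (mkposreal _ ep); simpl; intros w k1 k2.
  assert (l1 := Rmin_l e1 (Rmin e3 e4)); assert (l2 := Rmin_r e1 (Rmin e3 e4)).
  assert (l3 := Rmin_l e3 e4); assert (l4 := Rmin_r e3 e4).
  split; [apply H1; lra | apply H2; simpl; [apply H3 | apply H4]; lra].
- split; apply square_center; lra.
- intros z [h1 _]; apply inD; apply square_sup_dist in h1; lra.
- intros z hz; split; [apply hz | apply uniq, hz].
- intros w hw; split; [apply sigV, hw | apply sig, hw].
- set (U := square (F z0) r) in *.
  assert (oU : open U) by apply square_is_open.
  assert (gs : forall w, U w ->
    has_grad (fun w => Re (sigma w)) w (d2 Q (sigma w) / Jac (sigma w))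
      (- d2 P (sigma w) / Jac (sigma w)) /\
    has_grad (fun w => Im (sigma w)) w (- d1 Q (sigma w) / Jac (sigma w))
      (d1 P (sigma w) / Jac (sigma w))).
  { intros w hw; destruct (sig w hw) as [h1 h2].
    assert (Ds : D (sigma w)) by (apply inD; lra).
    destruct (open_contains_square U w oU hw) as [e [ep sub]].
    apply (inverse_grad P Q sigma w e (2 * L)); auto; try lra.
    - apply (smooth_grad D); auto.
    - apply (smooth_grad D); auto.
    - apply JP; lra.
    - intros w' hw'; destruct (sig w' (sub w' hw')) as [h1' h2'].
      split; [exact (f_equal Re h2')|]; split; [exact (f_equal Im h2')|].
      eapply Rle_trans; [apply lip; lra|]; rewrite h2, h2'; apply Rle_refl. }
  set (B := square z0 r0).
  assert (oB : open B) by apply square_is_open.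
  assert (BD : forall z, B z -> D z) by
    (intros z hz; apply inD; apply square_sup_dist in hz; lra).
  assert (JB : forall z, B z -> Jac z <> 0) by
    (intros z hz; apply JP; apply square_sup_dist in hz; lra).
  assert (CJ : forall k, Ck_on k B Jac).
  { intros k; apply (Ck_sub k D); auto.
    apply Ck_minus; auto; apply Ck_mult; auto. }
  assert (sB : forall G, smooth_on D G -> forall k, Ck_on k B (fun z => G z / Jac z)).
  { intros G hG k; apply Ck_div; auto; apply (Ck_sub k D); auto. }
  assert (sopp : forall G, smooth_on D G -> smooth_on D (fun z => - G z)).
  { intros G hG k; apply Ck_opp; auto. }
  assert (K : forall k, Ck_on k U (fun w => Re (sigma w)) /\ Ck_on k U (fun w => Im (sigma w))).
  { induction k as [|k [IH1 IH2]].
    - split; split; auto; intros w hw; destruct (gs w hw);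
        eapply has_grad_continuous; eassumption.
    - assert (comp : forall G, smooth_on D G ->
        Ck_on k U (fun w => G (sigma w) / Jac (sigma w))).
      { intros G hG.
        apply (Ck_ext k U (fun w => (fun z => G z / Jac z) (Re (sigma w), Im (sigma w)))); auto.
        - intros w _; now rewrite C_eta.
        - apply (Ck_comp k U B (fun z => G z / Jac z)); auto.
          intros w hw; rewrite C_eta; apply sigV, hw. }
      split.
      + apply (Ck_intro k U _ _ _ oU (fun w hw => proj1 (gs w hw))); [|
          apply (comp (fun z => - d2 P z))]; auto.
      + apply (Ck_intro k U _ _ _ oU (fun w hw => proj2 (gs w hw))); [
          apply (comp (fun z => - d1 Q z))|]; auto. }
  split; intros k; apply K.
Qed.

(** * The stereographic frame and the represented surfaces *)

Lemma Cmod_sq (w : C) : Cmod w ^ 2 = Re w ^ 2 + Im w ^ 2.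
Proof. unfold Cmod; rewrite pow2_sqrt; [reflexivity|]; nra. Qed.

Definition vec (x y t : R) : R3 := ((x, y), t).
Definition has_grad3 (Y : C -> R3) (z : C) (v1 v2 : R3) : Prop :=
  has_grad (fun w => Re (fst (Y w))) z (Re (fst v1)) (Re (fst v2)) /\
  has_grad (fun w => Im (fst (Y w))) z (Im (fst v1)) (Im (fst v2)) /\
  has_grad (fun w => snd (Y w)) z (snd v1) (snd v2).

Lemma R3_ext (v w : R3) : Re (fst v) = Re (fst w) -> Im (fst v) = Im (fst w) ->
  snd v = snd w -> v = w.
Proof. destruct v as [[a b] c], w as [[a' b'] c']; simpl; intros; now subst. Qed.

Lemma has_grad3_D1 Y z v1 v2 : has_grad3 Y z v1 v2 -> D1 Y z = v1.
Proof.
intros (h1 & h2 & h3); apply R3_ext; simpl; eapply has_grad_d1; eassumption.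
Qed.

Lemma has_grad3_D2 Y z v1 v2 : has_grad3 Y z v1 v2 -> D2 Y z = v2.
Proof.
intros (h1 & h2 & h3); apply R3_ext; simpl; eapply has_grad_d2; eassumption.
Qed.

Lemma has_grad3_ext_on (D : C -> Prop) (Y Z : C -> R3) (z : C) (v1 v2 : R3) :
  open D -> D z -> (forall w, D w -> Y w = Z w) ->
  has_grad3 Y z v1 v2 -> has_grad3 Z z v1 v2.
Proof.
intros oD Dz E (h1 & h2 & h3).
split; [|split]; (eapply (has_grad_ext_on D); [exact oD | exact Dz | | eassumption]);
  intros w Dw; simpl; rewrite (E w Dw); reflexivity.
Qed.

(** Product rule; together with the constancy of a scalar product it replaces
    most explicit differentiations below. *)
Lemma has_grad_dot (Y Z : C -> R3) (z : C) (v1 v2 w1 w2 : R3) :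
  has_grad3 Y z v1 v2 -> has_grad3 Z z w1 w2 ->
  has_grad (fun w => dot3 (Y w) (Z w)) z
    (dot3 v1 (Z z) + dot3 (Y z) w1) (dot3 v2 (Z z) + dot3 (Y z) w2).
Proof.
intros (h1 & h2 & h3) (k1 & k2 & k3); unfold dot3, ip.
eapply has_grad_eq; [repeat apply has_grad_plus; apply has_grad_mult; eassumption | |];
  simpl; ring.
Qed.

Lemma has_grad3_add (Y Z : C -> R3) (z : C) (v1 v2 w1 w2 : R3) :
  has_grad3 Y z v1 v2 -> has_grad3 Z z w1 w2 ->
  has_grad3 (fun w => add3 (Y w) (Z w)) z (add3 v1 w1) (add3 v2 w2).
Proof.
intros (h1 & h2 & h3) (k1 & k2 & k3).
split; [|split]; apply has_grad_plus; assumption.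
Qed.

Lemma add3_Re v w : Re (fst (add3 v w)) = Re (fst v) + Re (fst w).
Proof. reflexivity. Qed.
Lemma add3_Im v w : Im (fst (add3 v w)) = Im (fst v) + Im (fst w).
Proof. reflexivity. Qed.
Lemma scal3_Re t v : Re (fst (scal3 t v)) = t * Re (fst v).
Proof. unfold scal3, Cmult; simpl; unfold Re; ring. Qed.
Lemma scal3_Im t v : Im (fst (scal3 t v)) = t * Im (fst v).
Proof. unfold scal3, Cmult; simpl; unfold Im; ring. Qed.

Lemma has_grad3_scal (F : C -> R) (Y : C -> R3) (z : C) (a b : R) (v1 v2 : R3) :
  has_grad F z a b -> has_grad3 Y z v1 v2 ->
  has_grad3 (fun w => scal3 (F w) (Y w)) z
    (add3 (scal3 a (Y z)) (scal3 (F z) v1)) (add3 (scal3 b (Y z)) (scal3 (F z) v2)).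
Proof.
intros hF (h1 & h2 & h3).
split; [|split].
- apply (has_grad_ext (fun w => F w * Re (fst (Y w)))).
  + intros w; now rewrite scal3_Re.
  + rewrite !add3_Re, !scal3_Re; exact (has_grad_mult _ _ _ _ _ _ _ hF h1).
- apply (has_grad_ext (fun w => F w * Im (fst (Y w)))).
  + intros w; now rewrite scal3_Im.
  + rewrite !add3_Im, !scal3_Im; exact (has_grad_mult _ _ _ _ _ _ _ hF h2).
- apply (has_grad_mult F (fun w => snd (Y w))); assumption.
Qed.

Lemma has_grad3_comp (Y : C -> R3) (tau : C -> C) (z : C) (v1 v2 : R3) (a1 a2 b1 b2 : R) :
  has_grad3 Y (tau z) v1 v2 ->
  has_grad (fun w => Re (tau w)) z a1 a2 -> has_grad (fun w => Im (tau w)) z b1 b2 ->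
  has_grad3 (fun w => Y (tau w)) z
    (add3 (scal3 a1 v1) (scal3 b1 v2)) (add3 (scal3 a2 v1) (scal3 b2 v2)).
Proof.
intros (h1 & h2 & h3) hA hB.
assert (K : forall (F : C -> R) p q, has_grad F (tau z) p q ->
  has_grad (fun w => F (tau w)) z (a1 * p + b1 * q) (a2 * p + b2 * q)).
{ intros F p q hF.
  apply (has_grad_ext (fun w => F (Re (tau w), Im (tau w)))).
  - intros w; now rewrite C_eta.
  - eapply has_grad_eq; [apply (has_grad_comp2 F); [rewrite C_eta; exact hF | exact hA | exact hB]
      | |]; ring. }
split; [|split].
- rewrite !add3_Re, !scal3_Re; apply (K (fun w => Re (fst (Y w)))), h1.
- rewrite !add3_Im, !scal3_Im; apply (K (fun w => Im (fst (Y w)))), h2.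
- apply (K (fun w => snd (Y w))), h3.
Qed.

(** The inverse of the stereographic projection from the south pole (0, -1). *)
Definition stereo (w : C) : R3 :=
  vec (2 * Re w / (1 + Re w ^ 2 + Im w ^ 2)) (2 * Im w / (1 + Re w ^ 2 + Im w ^ 2))
      ((1 - Re w ^ 2 - Im w ^ 2) / (1 + Re w ^ 2 + Im w ^ 2)).
Definition stereo_a (w : C) : R3 :=
  vec (2 * (1 - Re w ^ 2 + Im w ^ 2) / (1 + Re w ^ 2 + Im w ^ 2) ^ 2)
      (- 4 * Re w * Im w / (1 + Re w ^ 2 + Im w ^ 2) ^ 2)
      (- 4 * Re w / (1 + Re w ^ 2 + Im w ^ 2) ^ 2).
Definition stereo_b (w : C) : R3 :=
  vec (- 4 * Re w * Im w / (1 + Re w ^ 2 + Im w ^ 2) ^ 2)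
      (2 * (1 + Re w ^ 2 - Im w ^ 2) / (1 + Re w ^ 2 + Im w ^ 2) ^ 2)
      (- 4 * Im w / (1 + Re w ^ 2 + Im w ^ 2) ^ 2).

Lemma T_pos (w : C) : 0 < 1 + Re w ^ 2 + Im w ^ 2.
Proof. nra. Qed.

Lemma T_neq (w : C) : 1 + Re w ^ 2 + Im w ^ 2 <> 0.
Proof. apply Rgt_not_eq, T_pos. Qed.

Lemma RT_N_stereo (g : C -> C) (z : C) : RT_N g z = stereo (g z).
Proof.
unfold RT_N; assert (h := T_neq (g z)); rewrite Cmod_sq.
apply R3_ext; [rewrite scal3_Re | rewrite scal3_Im |]; unfold stereo, scal3, vec;
  simpl; unfold Re, Im in *; field; lra.
Qed.

Lemma sq_grad (F : C -> R) z a b : has_grad F z a b ->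
  has_grad (fun w => F w ^ 2) z (2 * F z * a) (2 * F z * b).
Proof. intros h; apply (has_grad_comp1 (fun t => t ^ 2)); auto; auto_derive; auto; ring. Qed.

Lemma T_grad (w : C) : has_grad (fun w => 1 + Re w ^ 2 + Im w ^ 2) w (2 * Re w) (2 * Im w).
Proof.
eapply has_grad_eq; [repeat apply has_grad_plus; [apply has_grad_const |
  apply sq_grad, has_grad_Re | apply sq_grad, has_grad_Im] | |]; ring.
Qed.

Ltac field_by h :=
  field; repeat split; let E := fresh in intro E; apply h; rewrite <- E; simpl; ring.

Ltac grad_poly :=
  repeat first [ apply has_grad_plus | apply has_grad_minus | apply sq_grad
               | apply has_grad_mult | apply has_grad_opp
               | apply has_grad_Re | apply has_grad_Im | apply has_grad_const].

Lemma stereo_grad (w : C) : has_grad3 stereo w (stereo_a w) (stereo_b w).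
Proof.
assert (h := T_neq w).
split; [|split]; unfold stereo, vec; cbn [Re Im fst snd];
  (eapply has_grad_eq; [apply has_grad_div; [exact h | grad_poly | apply T_grad] | |];
   simpl; field_by h).
Qed.

(** Gauss's formula for the unit sphere in the coordinate w: the tangential
    coefficients are the Christoffel symbols of the metric 4 |dw|^2 / T^2. *)
Lemma stereo_a_grad (w : C) : let T := 1 + Re w ^ 2 + Im w ^ 2 in
  has_grad3 stereo_a w
    (add3 (scal3 (- (4 / T ^ 2)) (stereo w))
       (add3 (scal3 (- (2 * Re w / T)) (stereo_a w)) (scal3 (2 * Im w / T) (stereo_b w))))
    (add3 (scal3 (- (2 * Im w / T)) (stereo_a w)) (scal3 (- (2 * Re w / T)) (stereo_b w))).
Proof.
intros T; assert (h := T_neq w); fold T in h.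
assert (h2 : T ^ 2 <> 0) by now apply pow_nonzero.
split; [|split]; rewrite ?add3_Re, ?add3_Im, ?scal3_Re, ?scal3_Im;
  unfold stereo, stereo_a, stereo_b, vec; cbn [Re Im fst snd add3 scal3];
  (eapply has_grad_eq; [apply has_grad_div; [exact h2 | grad_poly | apply sq_grad, T_grad] | |];
   unfold T in *; simpl; field_by h).
Qed.

Lemma stereo_b_grad (w : C) : let T := 1 + Re w ^ 2 + Im w ^ 2 in
  has_grad3 stereo_b w
    (add3 (scal3 (- (2 * Im w / T)) (stereo_a w)) (scal3 (- (2 * Re w / T)) (stereo_b w)))
    (add3 (scal3 (- (4 / T ^ 2)) (stereo w))
       (add3 (scal3 (2 * Re w / T) (stereo_a w)) (scal3 (- (2 * Im w / T)) (stereo_b w)))).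
Proof.
intros T; assert (h := T_neq w); fold T in h.
assert (h2 : T ^ 2 <> 0) by now apply pow_nonzero.
split; [|split]; rewrite ?add3_Re, ?add3_Im, ?scal3_Re, ?scal3_Im;
  unfold stereo, stereo_a, stereo_b, vec; cbn [Re Im fst snd add3 scal3];
  (eapply has_grad_eq; [apply has_grad_div; [exact h2 | grad_poly | apply sq_grad, T_grad] | |];
   unfold T in *; simpl; field_by h).
Qed.

Lemma dot3_add_r u v w : dot3 u (add3 v w) = dot3 u v + dot3 u w.
Proof. unfold dot3, ip; rewrite add3_Re, add3_Im; simpl; ring. Qed.
Lemma dot3_scal_r u t v : dot3 u (scal3 t v) = t * dot3 u v.
Proof. unfold dot3, ip; rewrite scal3_Re, scal3_Im; simpl; ring. Qed.
Lemma dot3_sym u v : dot3 u v = dot3 v u.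
Proof. unfold dot3, ip; ring. Qed.
Lemma dot3_add_l u v w : dot3 (add3 v w) u = dot3 v u + dot3 w u.
Proof. now rewrite dot3_sym, dot3_add_r, !(dot3_sym u). Qed.
Lemma dot3_scal_l u t v : dot3 (scal3 t v) u = t * dot3 v u.
Proof. now rewrite dot3_sym, dot3_scal_r, dot3_sym. Qed.

Lemma stereo_frame (w : C) : let T := 1 + Re w ^ 2 + Im w ^ 2 in
  dot3 (stereo w) (stereo w) = 1 /\
  dot3 (stereo w) (stereo_a w) = 0 /\ dot3 (stereo w) (stereo_b w) = 0 /\
  dot3 (stereo_a w) (stereo_a w) = 4 / T ^ 2 /\
  dot3 (stereo_b w) (stereo_b w) = 4 / T ^ 2 /\
  dot3 (stereo_a w) (stereo_b w) = 0.
Proof.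
intros T; assert (h := T_neq w); unfold T, dot3, ip, stereo, stereo_a, stereo_b, vec;
  cbn [Re Im fst snd]; unfold Re, Im in *; repeat split; field_by h.
Qed.

(** The expansion in the orthogonal frame of [stereo_frame]. *)
Lemma stereo_decomp (w : C) (v : R3) : let T := 1 + Re w ^ 2 + Im w ^ 2 in
  v = add3 (scal3 (dot3 v (stereo w)) (stereo w))
        (add3 (scal3 (T ^ 2 / 4 * dot3 v (stereo_a w)) (stereo_a w))
              (scal3 (T ^ 2 / 4 * dot3 v (stereo_b w)) (stereo_b w))).
Proof.
intros T; assert (h := T_neq w).
apply R3_ext; rewrite ?add3_Re, ?add3_Im, ?scal3_Re, ?scal3_Im;
  unfold T, dot3, ip, stereo, stereo_a, stereo_b, vec, add3, scal3; cbn [Re Im fst snd];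
  destruct v as [[x y] t]; cbn [Re Im fst snd]; unfold Re, Im in *; field_by h.
Qed.

Lemma RT_T_sq (g : C -> C) (z : C) : RT_T g z = 1 + Re (g z) ^ 2 + Im (g z) ^ 2.
Proof. unfold RT_T; rewrite Cmod_sq; ring. Qed.

Lemma Cmod_sq_neq (w : C) : w <> RtoC 0 -> Re w ^ 2 + Im w ^ 2 <> 0.
Proof.
intros nz E; apply nz; destruct w as [a b]; simpl in E.
assert (a = 0) by nra; assert (b = 0) by nra; subst; reflexivity.
Qed.

Lemma RT_X_coords (f g : C -> C) (z : C) :
  C_derive g z <> RtoC 0 ->
  let a := Re (g z) in let b := Im (g z) in
  let c := Re (C_derive g z) in let d := Im (C_derive g z) in
  let p := Re (C_derive f z) in let q := Im (C_derive f z) in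
  let T := 1 + a ^ 2 + b ^ 2 in let m := c ^ 2 + d ^ 2 in
  let Q := c * (a * p - b * q) + d * (a * q + b * p) in
  RT_X f g z = scal3 (RT_h f z)
    (vec ((T * (c * p + d * q) - 2 * a * Q) / (2 * m) + 2 * a / T)
         ((T * (d * p - c * q) - 2 * b * Q) / (2 * m) + 2 * b / T)
         (- Q / m + (2 - T) / T)).
Proof.
intros nz a b c d p q T m Q.
assert (hm : m <> 0) by (apply Cmod_sq_neq, nz).
assert (hT : T <> 0) by (apply T_neq).
unfold RT_X; rewrite Cmod_sq, RT_T_sq; fold a b c d; fold m T.
apply R3_ext; rewrite ?add3_Re, ?add3_Im, ?scal3_Re, ?scal3_Im;
  unfold vec, add3, scal3; cbn [Re Im fst snd]; unfold ip;
  unfold a, b, c, d, p, q, Re, Im in *;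
  destruct (g z) as [a' b'], (C_derive g z) as [c' d'], (C_derive f z) as [p' q'];
  simpl in *; unfold Q, a, b, c, d, p, q in *; field; split; assumption.
Qed.

(** By [stereo_decomp] these scalar products determine RT_X: it is the envelope
    whose support function is h.  The last two are the derivatives of h with
    respect to the coordinate g. *)
Lemma RT_X_dots (f g : C -> C) (z : C) :
  C_derive g z <> RtoC 0 ->
  let c := Re (C_derive g z) in let d := Im (C_derive g z) in
  let p := Re (C_derive f z) in let q := Im (C_derive f z) in
  let m := c ^ 2 + d ^ 2 in
  dot3 (RT_X f g z) (stereo (g z)) = RT_h f z /\
  dot3 (RT_X f g z) (stereo_a (g z)) = RT_h f z * ((c * p + d * q) / m) /\
  dot3 (RT_X f g z) (stereo_b (g z)) = RT_h f z * ((d * p - c * q) / m).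
Proof.
intros nz c d p q m.
assert (hm : m <> 0) by (apply Cmod_sq_neq, nz).
assert (hT := T_neq (g z)).
rewrite RT_X_coords by assumption; rewrite !dot3_scal_l; fold c d p q m.
unfold dot3, ip, stereo, stereo_a, stereo_b, vec, m, c, d, p, q in *.
destruct (g z) as [a' b'], (C_derive g z) as [c' d'], (C_derive f z) as [p' q'].
cbn [Re Im fst snd] in *.
repeat split; [rewrite <- (Rmult_1_r (RT_h f z)) at 2| |]; apply (f_equal (Rmult _));
  field; auto.
Qed.

Lemma RT_h_grad (f : C -> C) (z : C) (p q : R) :
  has_grad (fun w => Re (f w)) z p (- q) ->
  has_grad (RT_h f) z (RT_h f z * p) (- (RT_h f z * q)).
Proof.
intros hf; apply (has_grad_ext (fun w => exp (Re (f w)))).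
- intros w; unfold RT_h, ip; simpl; f_equal; ring.
- eapply has_grad_eq; [apply (has_grad_comp1 exp _ _ (exp (Re (f z)))); [|exact hf] | |].
  + auto_derive; auto; ring.
  + unfold RT_h, ip; simpl; rewrite Rmult_1_l, Rmult_0_l, Rplus_0_r; reflexivity.
  + unfold RT_h, ip; simpl; rewrite Rmult_1_l, Rmult_0_l, Rplus_0_r.
    change (fst (f z)) with (Re (f z)); ring.
Qed.

Section Data.

Variables (U : C -> Prop) (f g : C -> C).
Hypothesis data : holomorphic_data U f g.

Lemma data_open : open U. Proof. apply data. Qed.

Lemma data_grads (z : C) : U z ->
  let p := Re (C_derive f z) in let q := Im (C_derive f z) in
  let s := Re (C_derive (C_derive f) z) in let t := Im (C_derive (C_derive f) z) in
  let c := Re (C_derive g z) in let d := Im (C_derive g z) in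
  let e := Re (C_derive (C_derive g) z) in let k := Im (C_derive (C_derive g) z) in
  has_grad (RT_h f) z (RT_h f z * p) (- (RT_h f z * q)) /\
  (has_grad (fun w => Re (C_derive f w)) z s (- t) /\
   has_grad (fun w => Im (C_derive f w)) z t s) /\
  (has_grad (fun w => Re (g w)) z c (- d) /\ has_grad (fun w => Im (g w)) z d c) /\
  (has_grad (fun w => Re (C_derive g w)) z e (- k) /\
   has_grad (fun w => Im (C_derive g w)) z k e).
Proof.
destruct data as (oU & _ & hf & hg & _); intros Uz.
assert (hf' := derivative_holomorphic U f oU hf).
assert (hg' := derivative_holomorphic U g oU hg).
split; [apply RT_h_grad, (holomorphic_grad U f z hf Uz) |].
split; [apply (holomorphic_grad U _ z hf' Uz)|].
split; [apply (holomorphic_grad U _ z hg Uz) | apply (holomorphic_grad U _ z hg' Uz)].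
Qed.

Lemma RT_X_differentiable (z : C) : U z -> exists v1 v2, has_grad3 (RT_X f g) z v1 v2.
Proof.
intros Uz; destruct (data_grads z Uz) as (gh & (gp & gq) & (ga & gb) & (gc & gd)).
assert (nz : forall w, U w -> C_derive g w <> RtoC 0) by apply data.
assert (hm := Cmod_sq_neq _ (nz z Uz)).
assert (gT := has_grad_plus _ _ _ _ _ _ _ (has_grad_plus _ _ _ _ _ _ _ (has_grad_const 1 z)
  (sq_grad _ _ _ _ ga)) (sq_grad _ _ _ _ gb)).
assert (gT4 := has_grad_mult _ _ _ _ _ _ _ (sq_grad _ _ _ _ gT) (has_grad_const (/ 4) z)).
assert (gm := has_grad_plus _ _ _ _ _ _ _ (sq_grad _ _ _ _ gc) (sq_grad _ _ _ _ gd)).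
assert (coef : forall F a b, has_grad F z a b -> exists a' b', has_grad (fun w =>
  (1 + Re (g w) ^ 2 + Im (g w) ^ 2) ^ 2 * / 4 *
  (RT_h f w * (F w / (Re (C_derive g w) ^ 2 + Im (C_derive g w) ^ 2)))) z a' b').
{ intros F a b hF; do 2 eexists; apply has_grad_mult; [exact gT4|].
  apply has_grad_mult; [exact gh | apply has_grad_div; [exact hm | exact hF | exact gm]]. }
destruct (coef _ _ _ (has_grad_plus _ _ _ _ _ _ _ (has_grad_mult _ _ _ _ _ _ _ gc gp)
  (has_grad_mult _ _ _ _ _ _ _ gd gq))) as (a1 & a2 & g1).
destruct (coef _ _ _ (has_grad_minus _ _ _ _ _ _ _ (has_grad_mult _ _ _ _ _ _ _ gd gp)
  (has_grad_mult _ _ _ _ _ _ _ gc gq))) as (b1 & b2 & g2).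
assert (comp : forall Y v1 v2, has_grad3 Y (g z) v1 v2 -> has_grad3 (fun w => Y (g w)) z _ _)
  by (intros Y v1 v2 hY; exact (has_grad3_comp Y g z _ _ _ _ _ _ hY ga gb)).
assert (hS := has_grad3_add _ _ _ _ _ _ _
  (has_grad3_scal _ _ _ _ _ _ _ gh (comp _ _ _ (stereo_grad (g z))))
  (has_grad3_add _ _ _ _ _ _ _
    (has_grad3_scal _ _ _ _ _ _ _ g1 (comp _ _ _ (stereo_a_grad (g z))))
    (has_grad3_scal _ _ _ _ _ _ _ g2 (comp _ _ _ (stereo_b_grad (g z)))))).
do 2 eexists; refine (has_grad3_ext_on U _ _ z _ _ data_open Uz _ hS).
intros w Uw; destruct (RT_X_dots f g w (nz w Uw)) as (t0 & t1 & t2).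
symmetry; rewrite (stereo_decomp (g w) (RT_X f g w)) at 1; rewrite t0, t1, t2; reflexivity.
Qed.

(** The partial derivatives of RT_N, by the Cauchy-Riemann equations for g. *)
Definition RT_N1 (w : C) : R3 :=
  add3 (scal3 (Re (C_derive g w)) (stereo_a (g w))) (scal3 (Im (C_derive g w)) (stereo_b (g w))).
Definition RT_N2 (w : C) : R3 :=
  add3 (scal3 (- Im (C_derive g w)) (stereo_a (g w))) (scal3 (Re (C_derive g w)) (stereo_b (g w))).

Lemma RT_N_grad (z : C) : U z -> has_grad3 (RT_N g) z (RT_N1 z) (RT_N2 z).
Proof.
intros Uz; destruct (data_grads z Uz) as (_ & _ & (ga & gb) & _).
apply (has_grad3_ext_on U (fun w => stereo (g w)) _ z _ _ data_open Uz).
- intros w _; symmetry; apply RT_N_stereo.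
- apply has_grad3_comp; auto; apply stereo_grad.
Qed.

(** The conformal factor of the Gauss map. *)
Definition RT_lam (z : C) : R := 4 * Cmod (C_derive g z) ^ 2 / RT_T g z ^ 2.

Lemma RT_lam_pos (z : C) : U z -> 0 < RT_lam z.
Proof.
intros Uz; unfold RT_lam; rewrite Cmod_sq, RT_T_sq.
assert (nz : C_derive g z <> RtoC 0) by (apply data, Uz).
assert (hm := Cmod_sq_neq _ nz).
apply Rdiv_lt_0_compat; [nra | apply pow_lt, T_pos].
Qed.

Lemma RT_frame (z : C) :
  dot3 (RT_N g z) (RT_N g z) = 1 /\
  dot3 (RT_N g z) (RT_N1 z) = 0 /\ dot3 (RT_N g z) (RT_N2 z) = 0 /\
  dot3 (RT_N1 z) (RT_N1 z) = RT_lam z /\ dot3 (RT_N2 z) (RT_N2 z) = RT_lam z /\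
  dot3 (RT_N1 z) (RT_N2 z) = 0.
Proof.
unfold RT_N1, RT_N2, RT_lam; rewrite RT_N_stereo, Cmod_sq, RT_T_sq.
destruct (stereo_frame (g z)) as (h1 & h2 & h3 & h4 & h5 & h6).
rewrite ?dot3_add_r, ?dot3_add_l, ?dot3_scal_r, ?dot3_scal_l, ?dot3_add_r, ?dot3_scal_r.
rewrite (dot3_sym (stereo_b (g z)) (stereo_a (g z))), h1, h2, h3, h4, h5, h6.
assert (hT := T_neq (g z)).
repeat split; field; exact hT.
Qed.

Lemma RT_support (z : C) : U z ->
  dot3 (RT_X f g z) (RT_N g z) = RT_h f z /\
  dot3 (RT_X f g z) (RT_N1 z) = RT_h f z * Re (C_derive f z) /\
  dot3 (RT_X f g z) (RT_N2 z) = - (RT_h f z * Im (C_derive f z)).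
Proof.
intros Uz; assert (nz : C_derive g z <> RtoC 0) by (apply data, Uz).
assert (hm := Cmod_sq_neq _ nz).
destruct (RT_X_dots f g z nz) as (h1 & h2 & h3).
unfold RT_N1, RT_N2; rewrite RT_N_stereo, !dot3_add_r, !dot3_scal_r, h1, h2, h3.
repeat split; field; exact hm.
Qed.

(** Differentiating <X, N> = h and <X, N_j> = h_j gives <X_i, N> = 0 and
    <X_i, N_j> = h_ij - <X, N_ij>, where N_ij is known from Gauss's formula.  So
    no derivative of X has to be computed; xi collects the contribution of the
    Christoffel symbols to the Hessian of h. *)
Lemma RT_second_form (z : C) (X1 X2 : R3) : U z -> has_grad3 (RT_X f g) z X1 X2 ->
  dot3 X1 (RT_N g z) = 0 /\ dot3 X2 (RT_N g z) = 0 /\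
  dot3 X1 (RT_N1 z) = RT_h f z * RT_A1 f g z + RT_h f z * RT_lam z /\
  dot3 X1 (RT_N2 z) = RT_h f z * RT_B f g z /\
  dot3 X2 (RT_N1 z) = RT_h f z * RT_B f g z /\
  dot3 X2 (RT_N2 z) = RT_h f z * RT_A2 f g z + RT_h f z * RT_lam z.
Proof.
intros Uz hX.
assert (nz : C_derive g z <> RtoC 0) by (apply data, Uz).
assert (hm := Cmod_sq_neq _ nz); assert (hT := T_neq (g z)).
destruct (data_grads z Uz) as (gh & (gp & gq) & (ga & gb) & (gc & gd)).
destruct (RT_support z Uz) as (s0 & s1 & s2).
destruct (RT_X_dots f g z nz) as (t0 & t1 & t2).
assert (gN := RT_N_grad z Uz).
assert (gsa := has_grad3_comp stereo_a g z _ _ _ _ _ _ (stereo_a_grad (g z)) ga gb).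
assert (gsb := has_grad3_comp stereo_b g z _ _ _ _ _ _ (stereo_b_grad (g z)) ga gb).
assert (gN1 := has_grad3_add _ _ _ _ _ _ _ (has_grad3_scal _ _ _ _ _ _ _ gc gsa)
  (has_grad3_scal _ _ _ _ _ _ _ gd gsb)).
assert (gN2 := has_grad3_add _ _ _ _ _ _ _
  (has_grad3_scal _ _ _ _ _ _ _ (has_grad_opp _ _ _ _ gd) gsa)
  (has_grad3_scal _ _ _ _ _ _ _ gc gsb)).
assert (k0 := has_grad_dot _ _ _ _ _ _ _ hX gN).
assert (k1 := has_grad_dot _ _ _ _ _ _ _ hX gN1).
assert (k2 := has_grad_dot _ _ _ _ _ _ _ hX gN2).
apply (has_grad_ext_on U _ (RT_h f) _ _ _ data_open Uz) in k0;
  [|intros w Uw; apply (RT_support w Uw)].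
apply (has_grad_ext_on U _ (fun w => RT_h f w * Re (C_derive f w)) _ _ _ data_open Uz) in k1;
  [|intros w Uw; apply (RT_support w Uw)].
apply (has_grad_ext_on U _ (fun w => - (RT_h f w * Im (C_derive f w))) _ _ _ data_open Uz) in k2;
  [|intros w Uw; apply (RT_support w Uw)].
destruct (has_grad_unique _ _ _ _ _ _ k0 gh) as [e01 e02].
destruct (has_grad_unique _ _ _ _ _ _ k1 (has_grad_mult _ _ _ _ _ _ _ gh gp)) as [e11 e12].
destruct (has_grad_unique _ _ _ _ _ _ k2
  (has_grad_opp _ _ _ _ (has_grad_mult _ _ _ _ _ _ _ gh gq))) as [e21 e22].
clear k0 k1 k2 gN1 gN2 gsa gsb.
fold (RT_N1 z) in e11, e12; fold (RT_N2 z) in e21, e22.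
rewrite s1 in e01; rewrite s2 in e02.
rewrite ?dot3_add_r, ?dot3_scal_r, ?dot3_add_r, ?dot3_scal_r, ?dot3_add_r, ?dot3_scal_r,
  ?dot3_add_r, ?dot3_scal_r, t0, t1, t2 in e11, e12, e21, e22.
split; [lra | split; [lra|]].
assert (E : forall x y u v, x + y = u -> u - y = v -> x = v) by (intros; lra).
unfold RT_A1, RT_A2, RT_B, RT_lam, RT_xi; rewrite Cmod_sq, RT_T_sq.
repeat split;
[eapply E; [exact e11|] | eapply E; [exact e21|] | eapply E; [exact e12|] | eapply E; [exact e22|]];
clear - hm hT; unfold ip;
 destruct (g z) as [a b], (C_derive g z) as [c d], (C_derive f z) as [p q],
  (C_derive (C_derive f) z) as [s t], (C_derive (C_derive g) z) as [e k];
 set (h := RT_h f z); clearbody h; simpl in *;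
 field; repeat split; let E := fresh in intro E; (apply hm + apply hT); rewrite <- E; ring.
Qed.

End Data.

Lemma dot3_zero (v : R3) : dot3 v v = 0 -> v = origin.
Proof.
destruct v as [[x y] t]; unfold dot3, ip, origin, RtoC; simpl; intros h.
assert (x = 0) by nra; assert (y = 0) by nra; assert (t = 0) by nra; now subst.
Qed.

Lemma dot3_origin_r (v : R3) : dot3 v origin = 0.
Proof. unfold dot3, ip, origin; simpl; ring. Qed.

Lemma norm3_unit (v : R3) : dot3 v v = 1 -> norm3 v = 1.
Proof. intros h; unfold norm3; rewrite h; apply sqrt_1. Qed.

(** The frame N, N_1, N_2 is orthogonal with |N_1|^2 = |N_2|^2 = lam. *)
Lemma RT_parseval (U : C -> Prop) (f g : C -> C) (z : C) (u v : R3) :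
  holomorphic_data U f g -> U z ->
  dot3 u v = dot3 u (RT_N g z) * dot3 v (RT_N g z) +
    (dot3 u (RT_N1 g z) * dot3 v (RT_N1 g z) + dot3 u (RT_N2 g z) * dot3 v (RT_N2 g z))
     / RT_lam g z.
Proof.
intros data Uz; assert (nz : C_derive g z <> RtoC 0) by (apply data, Uz).
assert (hm := Cmod_sq_neq _ nz); assert (hT := T_neq (g z)).
unfold RT_lam, RT_N1, RT_N2; rewrite RT_N_stereo, Cmod_sq, RT_T_sq.
rewrite !dot3_add_r, !dot3_scal_r.
rewrite (stereo_decomp (g z) v) at 1; rewrite !dot3_add_r, !dot3_scal_r.
set (x := dot3 v _); set (y := dot3 v _); set (t := dot3 v _).
set (x' := dot3 u _); set (y' := dot3 u _); set (t' := dot3 u _).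
field; split; assumption.
Qed.

(** Two vectors orthogonal to N are independent if and only if the matrix of their
    scalar products with N_1 and N_2 is invertible. *)
Lemma RT_regular_iff (U : C -> Prop) (f g : C -> C) (z : C) (Y : C -> R3) (X1 X2 : R3)
  (b11 b12 b22 : R) :
  holomorphic_data U f g -> U z -> has_grad3 Y z X1 X2 ->
  dot3 X1 (RT_N g z) = 0 -> dot3 X2 (RT_N g z) = 0 ->
  dot3 X1 (RT_N1 g z) = b11 -> dot3 X1 (RT_N2 g z) = b12 ->
  dot3 X2 (RT_N1 g z) = b12 -> dot3 X2 (RT_N2 g z) = b22 ->
  (regular_at Y z <-> b11 * b22 - b12 ^ 2 <> 0).
Proof.
intros data Uz hY n1 n2 e11 e12 e21 e22.
unfold regular_at; rewrite (has_grad3_D1 _ _ _ _ hY), (has_grad3_D2 _ _ _ _ hY).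
assert (ker : forall s t, s * b11 + t * b12 = 0 -> s * b12 + t * b22 = 0 ->
  add3 (scal3 s X1) (scal3 t X2) = origin).
{ intros s t h1 h2; apply dot3_zero.
  rewrite (RT_parseval U f g z _ _ data Uz), !dot3_add_l, !dot3_scal_l,
    n1, n2, e11, e12, e21, e22, h1, h2; unfold Rdiv; ring. }
split.
- intros reg det.
  destruct (reg b22 (- b12)) as [h1 h2]; [apply ker; lra|].
  destruct (reg b12 (- b11)) as [h3 h4]; [apply ker; lra|].
  destruct (reg 1 0) as [h5 _]; [apply ker; lra | lra].
- intros det s t h.
  assert (h1 : dot3 (add3 (scal3 s X1) (scal3 t X2)) (RT_N1 g z) = 0)
    by (rewrite h, dot3_sym; apply dot3_origin_r).
  assert (h2 : dot3 (add3 (scal3 s X1) (scal3 t X2)) (RT_N2 g z) = 0)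
    by (rewrite h, dot3_sym; apply dot3_origin_r).
  rewrite dot3_add_l, !dot3_scal_l, e11, e21 in h1.
  rewrite dot3_add_l, !dot3_scal_l, e12, e22 in h2.
  split; apply (Rmult_eq_reg_r (b11 * b22 - b12 ^ 2)); auto.
  + transitivity (b22 * (s * b11 + t * b12) - b12 * (s * b12 + t * b22));
      [ring | rewrite h1, h2; ring].
  + transitivity (b11 * (s * b12 + t * b22) - b12 * (s * b11 + t * b12));
      [ring | rewrite h1, h2; ring].
Qed.

Theorem representation_formulas (U : C -> Prop) (f g : C -> C) :
  holomorphic_data U f g ->
   forall z : C, U z ->
     let X := RT_X f g in
     let N := RT_N g in
     let h := RT_h f z in
     let T := RT_T g z in
     let f' := C_derive f z in
     let g' := C_derive g z in
     let xi := RT_xi f g z in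
     let A1 := RT_A1 f g z in
     let A2 := RT_A2 f g z in
     let B := RT_B f g z in
     unit_normal_at X z (N z) /\
     (regular_at X z <->
      T ^ 4 * ip xi (f' ^ 2 - xi)%C + 4 * T ^ 2 * Cmod f' ^ 2 * Cmod g' ^ 2
        + 16 * Cmod g' ^ 4 <> 0) /\
     coefE X z =
       h ^ 2 * (T ^ 2 / (4 * Cmod g' ^ 2) * (A1 ^ 2 + B ^ 2) + 2 * A1
                + 4 * Cmod g' ^ 2 / T ^ 2) /\
     coefF X z = h ^ 2 * (T ^ 2 * Cmod f' ^ 2 / (4 * Cmod g' ^ 2) + 2) * B /\
     coefG X z =
       h ^ 2 * (T ^ 2 / (4 * Cmod g' ^ 2) * (A2 ^ 2 + B ^ 2) + 2 * A2
                + 4 * Cmod g' ^ 2 / T ^ 2) /\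
     coefb11 X N z = h * A1 + 4 * h * Cmod g' ^ 2 / T ^ 2 /\
     coefb12 X N z = h * B /\
     coefb22 X N z = h * A2 + 4 * h * Cmod g' ^ 2 / T ^ 2.
Proof.
intros data z Uz X N h T f' g' xi A1 A2 B.
assert (nz : g' <> RtoC 0) by (apply data, Uz).
assert (hm := Cmod_sq_neq _ nz); rewrite <- Cmod_sq in hm.
assert (hT : T <> 0) by (unfold T; rewrite RT_T_sq; apply T_neq).
assert (hp : h <> 0) by (apply Rgt_not_eq, exp_pos).
destruct (RT_X_differentiable U f g data z Uz) as (X1 & X2 & hX).
destruct (RT_second_form U f g data z X1 X2 Uz hX) as (n1 & n2 & e11 & e12 & e21 & e22).
destruct (RT_frame g z) as (f0 & _).
assert (gN := RT_N_grad U f g data z Uz).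
assert (P := fun u v => RT_parseval U f g z u v data Uz).
assert (sumA : A1 + A2 = Cmod f' ^ 2).
{ unfold A1, A2, RT_A1, RT_A2, ip; fold f'; rewrite Cmod_sq.
  destruct f' as [p q]; simpl; ring. }
assert (detA : A1 * A2 - B ^ 2 = ip xi (f' ^ 2 - xi)%C).
{ unfold A1, A2, B, RT_A1, RT_A2, RT_B, ip; fold f' xi.
  destruct f' as [p q], xi as [x y]; simpl; field. }
set (m := Cmod g' ^ 2) in *.
assert (lamE : RT_lam g z = 4 * m / T ^ 2) by reflexivity.
fold h A1 A2 B in e11, e12, e21, e22; fold X in hX; fold N in gN.
split; [|split; [|split; [|split; [|split; [|split; [|split]]]]]].
- split; [apply norm3_unit, f0|].
  rewrite (has_grad3_D1 _ _ _ _ hX), (has_grad3_D2 _ _ _ _ hX), !(dot3_sym (N z)).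
  split; assumption.
- rewrite (RT_regular_iff U f g z _ _ _ _ _ _ data Uz hX n1 n2 e11 e12 e21 e22).
  assert (E : T ^ 4 * ip xi (f' ^ 2 - xi)%C + 4 * T ^ 2 * Cmod f' ^ 2 * m + 16 * Cmod g' ^ 4
    = T ^ 4 / h ^ 2 * ((h * A1 + h * RT_lam g z) * (h * A2 + h * RT_lam g z) - (h * B) ^ 2)).
  { replace (Cmod g' ^ 4) with (m ^ 2) by (unfold m; ring).
    rewrite lamE, <- detA, <- sumA; field; split; assumption. }
  rewrite E; split.
  + intros k k'; apply k; apply Rmult_integral in k'; destruct k' as [k'|k']; [|exact k'].
    exfalso; revert k'; apply Rmult_integral_contrapositive; split;
      [|apply Rinv_neq_0_compat]; apply pow_nonzero; assumption.
  + intros k k'; apply k; rewrite k'; ring.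
- unfold coefE; rewrite (has_grad3_D1 _ _ _ _ hX), P, n1, e11, e12, lamE.
  field; split; assumption.
- unfold coefF; rewrite (has_grad3_D1 _ _ _ _ hX), (has_grad3_D2 _ _ _ _ hX), P,
    n1, n2, e11, e12, e21, e22, lamE, <- sumA.
  field; split; assumption.
- unfold coefG; rewrite (has_grad3_D2 _ _ _ _ hX), P, n2, e21, e22, lamE.
  field; split; assumption.
- unfold coefb11; rewrite (has_grad3_D1 _ _ _ _ hX), (has_grad3_D1 _ _ _ _ gN), e11, lamE.
  field; assumption.
- unfold coefb12; rewrite (has_grad3_D1 _ _ _ _ hX), (has_grad3_D2 _ _ _ _ gN); exact e12.
- unfold coefb22; rewrite (has_grad3_D2 _ _ _ _ hX), (has_grad3_D2 _ _ _ _ gN), e22, lamE.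
  field; assumption.
Qed.

(** * Normals, Weingarten matrices and changes of coordinates *)

Lemma dot3_nonneg (v : R3) : 0 <= dot3 v v.
Proof. unfold dot3, ip; nra. Qed.

Lemma norm3_one (v : R3) : norm3 v = 1 -> dot3 v v = 1.
Proof.
unfold norm3; intros h; rewrite <- (sqrt_sqrt (dot3 v v)) by apply dot3_nonneg.
rewrite h; ring.
Qed.

Lemma dot3_cross_l u v : dot3 u (cross3 u v) = 0.
Proof. unfold dot3, ip, cross3; simpl; unfold Re, Im; ring. Qed.
Lemma dot3_cross_r u v : dot3 v (cross3 u v) = 0.
Proof. unfold dot3, ip, cross3; simpl; unfold Re, Im; ring. Qed.
Lemma cross3_lagrange u v :
  dot3 (cross3 u v) (cross3 u v) = dot3 u u * dot3 v v - dot3 u v ^ 2.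
Proof. unfold dot3, ip, cross3; simpl; unfold Re, Im; ring. Qed.

(** From c x (w x c) = (c . c) w - (w . c) c for c = u x v, since w x (u x v)
    vanishes when w is orthogonal to u and v. *)
Lemma orthogonal_parallel u v w : dot3 w u = 0 -> dot3 w v = 0 ->
  scal3 (dot3 (cross3 u v) (cross3 u v)) w = scal3 (dot3 w (cross3 u v)) (cross3 u v).
Proof.
intros h1 h2.
destruct u as [[u1 u2] u3], v as [[v1 v2] v3], w as [[w1 w2] w3].
unfold dot3, ip in h1, h2; simpl in h1, h2.
apply R3_ext; rewrite ?scal3_Re, ?scal3_Im; unfold scal3, dot3, ip, cross3; simpl.
all: apply Rminus_diag_uniq.
- set (c2 := u3 * v1 - u1 * v3); set (c3 := u1 * v2 - u2 * v1).
  transitivity ((w1 * v1 + w2 * v2 + w3 * v3) * (c2 * u3 - c3 * u2)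
    - (w1 * u1 + w2 * u2 + w3 * u3) * (c2 * v3 - c3 * v2));
    [unfold c2, c3; ring | rewrite h1, h2; ring].
- set (c1 := u2 * v3 - u3 * v2); set (c3 := u1 * v2 - u2 * v1).
  transitivity ((w1 * v1 + w2 * v2 + w3 * v3) * (c3 * u1 - c1 * u3)
    - (w1 * u1 + w2 * u2 + w3 * u3) * (c3 * v1 - c1 * v3));
    [unfold c1, c3; ring | rewrite h1, h2; ring].
- set (c1 := u2 * v3 - u3 * v2); set (c2 := u3 * v1 - u1 * v3).
  transitivity ((w1 * v1 + w2 * v2 + w3 * v3) * (c1 * u2 - c2 * u1)
    - (w1 * u1 + w2 * u2 + w3 * u3) * (c1 * v2 - c2 * v1));
    [unfold c1, c2; ring | rewrite h1, h2; ring].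
Qed.

Lemma scal3_assoc s t v : scal3 s (scal3 t v) = scal3 (s * t) v.
Proof. apply R3_ext; rewrite ?scal3_Re, ?scal3_Im; simpl; ring. Qed.
Lemma scal3_1 v : scal3 1 v = v.
Proof. apply R3_ext; rewrite ?scal3_Re, ?scal3_Im; simpl; ring. Qed.
Lemma scal3_0 v : scal3 0 v = origin.
Proof. apply R3_ext; rewrite ?scal3_Re, ?scal3_Im; simpl; ring. Qed.
Lemma add3_origin_r v : add3 v origin = v.
Proof. apply R3_ext; rewrite ?add3_Re, ?add3_Im; simpl; ring. Qed.
Lemma scal3_origin t : scal3 t origin = origin.
Proof. apply R3_ext; rewrite ?scal3_Re, ?scal3_Im; simpl; ring. Qed.

(** Lagrange's identity writes the Gram determinant as |u x v|^2.  If it were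
    zero, |v|^2 u - <u, v> v would have length zero. *)
Lemma independent_gram u v :
  (forall s t, add3 (scal3 s u) (scal3 t v) = origin -> s = 0 /\ t = 0) ->
  0 < dot3 u u * dot3 v v - dot3 u v ^ 2.
Proof.
intros ind.
assert (nn : 0 <= dot3 u u * dot3 v v - dot3 u v ^ 2)
  by (rewrite <- cross3_lagrange; apply dot3_nonneg).
destruct nn as [p|z0]; [exact p | exfalso].
destruct (ind (dot3 v v) (- dot3 u v)) as [h1 h2].
{ apply dot3_zero; rewrite ?dot3_add_l, ?dot3_add_r, ?dot3_scal_l, ?dot3_scal_r,
    (dot3_sym v u).
  transitivity (dot3 v v * (dot3 u u * dot3 v v - dot3 u v ^ 2)); [ring|].
  rewrite <- z0; ring. }
destruct (ind 0 1) as [_ h3]; [|lra].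
rewrite (dot3_zero _ h1), scal3_origin, add3_origin_r; apply scal3_0.
Qed.

Lemma regular_gram Y z : regular_at Y z ->
  0 < dot3 (D1 Y z) (D1 Y z) * dot3 (D2 Y z) (D2 Y z) - dot3 (D1 Y z) (D2 Y z) ^ 2.
Proof. apply independent_gram. Qed.

Lemma normal_unit Y z : regular_at Y z -> unit_normal_at Y z (normal Y z).
Proof.
intros reg; assert (g := regular_gram Y z reg); rewrite <- cross3_lagrange in g.
unfold unit_normal_at, normal; set (c := cross3 (D1 Y z) (D2 Y z)) in *; cbv zeta.
split; [|split].
- apply norm3_unit; rewrite dot3_scal_l, dot3_scal_r.
  assert (s := sqrt_sqrt _ (Rlt_le _ _ g)); assert (s' := sqrt_lt_R0 _ g).
  unfold norm3; rewrite <- s at 3; field; lra.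
- unfold c; rewrite dot3_scal_l, dot3_sym, dot3_cross_l; ring.
- unfold c; rewrite dot3_scal_l, dot3_sym, dot3_cross_r; ring.
Qed.

(** Both unit normals are multiples of D1 Y x D2 Y. *)
Lemma unit_normal_unique Y z n n' : regular_at Y z ->
  unit_normal_at Y z n -> unit_normal_at Y z n' ->
  n' = scal3 (dot3 n n') n /\ dot3 n n' ^ 2 = 1.
Proof.
intros reg (h1 & h2 & h3) (k1 & k2 & k3).
apply norm3_one in h1; apply norm3_one in k1.
assert (g := regular_gram Y z reg); rewrite <- cross3_lagrange in g.
assert (p := orthogonal_parallel _ _ _ h2 h3); assert (p' := orthogonal_parallel _ _ _ k2 k3).
set (c := cross3 (D1 Y z) (D2 Y z)) in *; set (cc := dot3 c c) in *.
assert (E : forall m, scal3 cc m = scal3 (dot3 m c) c -> m = scal3 (dot3 m c / cc) c).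
{ intros m hm; rewrite <- (scal3_1 m) at 1.
  replace 1 with (/ cc * cc) by (field; lra).
  rewrite <- scal3_assoc, hm, scal3_assoc; f_equal; field; lra. }
apply E in p; apply E in p'.
set (x := dot3 n c / cc) in *; set (y := dot3 n' c / cc) in *.
assert (hx : x * x * cc = 1).
{ rewrite p, dot3_scal_l, dot3_scal_r in h1; fold cc in h1; lra. }
assert (hy : y * y * cc = 1).
{ rewrite p', dot3_scal_l, dot3_scal_r in k1; fold cc in k1; lra. }
assert (D : dot3 n n' = x * y * cc).
{ rewrite p, p', dot3_scal_l, dot3_scal_r; fold cc; ring. }
rewrite D; split.
- rewrite p at 1; rewrite p' at 1; rewrite scal3_assoc; f_equal.
  replace (x * y * cc * x) with (y * (x * x * cc)) by ring; rewrite hx; ring.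
- replace ((x * y * cc) ^ 2) with ((x * x * cc) * (y * y * cc)) by ring; rewrite hx, hy; ring.
Qed.

(** The squared distance of the origin from y + r n is |y|^2 + 2 r <y, n> + r^2. *)
Lemma sphere_origin_iff (y n : R3) (r : R) : dot3 n n = 1 ->
  (sphere (add3 y (scal3 r n)) r origin <-> dot3 y y + 2 * r * dot3 y n = 0).
Proof.
intros hn; unfold sphere, norm3.
set (v := add3 origin (scal3 (-1) (add3 y (scal3 r n)))).
assert (E : dot3 v v = dot3 y y + 2 * r * dot3 y n + r ^ 2).
{ unfold v; rewrite ?dot3_add_l, ?dot3_add_r, ?dot3_scal_l, ?dot3_scal_r,
    ?dot3_add_l, ?dot3_add_r, ?dot3_scal_l, ?dot3_scal_r, hn, !dot3_origin_r,
    !(dot3_sym origin), !dot3_origin_r, (dot3_sym n y); ring. }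
split.
- intros h; assert (s := sqrt_sqrt _ (dot3_nonneg v)); rewrite h in s.
  rewrite <- Rabs_mult, Rabs_pos_eq in s by nra; lra.
- intros h; rewrite E, h, Rplus_0_l, <- sqrt_Rsqr_abs; f_equal; unfold Rsqr; ring.
Qed.

(** The condition 2 Psi H + (Lambda + Psi^2) K = 0, with tr W = - 2 H. *)
Definition RT_relation (y n : R3) (W : mat2) : Prop :=
  gauss_curv W * (dot3 y y + dot3 y n ^ 2) = dot3 y n * (m11 W + m22 W).

Lemma RT_relation_sphere (y n : R3) (W : mat2) : dot3 n n = 1 -> gauss_curv W <> 0 ->
  let r := mean_curv W / gauss_curv W + dot3 y n / 2 in
  (sphere (add3 y (scal3 r n)) r origin <-> RT_relation y n W).
Proof.
intros hn hK r; rewrite sphere_origin_iff by assumption.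
unfold RT_relation, r, mean_curv.
assert (E : dot3 y y + 2 * (- (1 / 2) * (m11 W + m22 W) / gauss_curv W + dot3 y n / 2) * dot3 y n
  = (gauss_curv W * (dot3 y y + dot3 y n ^ 2) - dot3 y n * (m11 W + m22 W)) / gauss_curv W)
  by (field; exact hK).
rewrite E; split; intros h.
- apply Rmult_integral in h; destruct h as [h|h]; [lra|].
  now apply Rinv_neq_0_compat in h.
- rewrite h, Rminus_diag; unfold Rdiv; ring.
Qed.

Definition scal_mat (e : R) (W : mat2) : mat2 :=
  Mat2 (e * m11 W) (e * m12 W) (e * m21 W) (e * m22 W).

Lemma RT_relation_sign (y n : R3) (W : mat2) (e : R) : e ^ 2 = 1 ->
  (RT_relation y (scal3 e n) (scal_mat e W) <-> RT_relation y n W).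
Proof.
intros he; unfold RT_relation, gauss_curv; rewrite dot3_scal_r; simpl m11; simpl m12;
  simpl m21; simpl m22.
replace (e * m11 W * (e * m22 W) - e * m12 W * (e * m21 W)) with
  (e ^ 2 * (m11 W * m22 W - m12 W * m21 W)) by ring.
replace ((e * dot3 y n) ^ 2) with (e ^ 2 * dot3 y n ^ 2) by ring.
replace (e * dot3 y n * (e * m11 W + e * m22 W)) with
  (e ^ 2 * (dot3 y n * (m11 W + m22 W))) by ring.
rewrite he, !Rmult_1_l; reflexivity.
Qed.

(** When N is conformal with factor lam, the second fundamental form is
    lam W^{-1}; this is the relation between the traces, multiplied by det W. *)
Lemma conformal_weingarten (x1 x2 n1 n2 : R3) (W : mat2) (lam : R) :
  n1 = add3 (scal3 (m11 W) x1) (scal3 (m12 W) x2) ->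
  n2 = add3 (scal3 (m21 W) x1) (scal3 (m22 W) x2) ->
  dot3 n1 n1 = lam -> dot3 n2 n2 = lam -> dot3 n1 n2 = 0 ->
  gauss_curv W * (dot3 x1 n1 + dot3 x2 n2) = lam * (m11 W + m22 W).
Proof.
intros e1 e2 h1 h2 h3; unfold gauss_curv.
assert (k11 : lam = m11 W * dot3 x1 n1 + m12 W * dot3 x2 n1).
{ rewrite <- h1; rewrite e1 at 1; rewrite dot3_add_l, !dot3_scal_l; ring. }
assert (k12 : 0 = m11 W * dot3 x1 n2 + m12 W * dot3 x2 n2).
{ rewrite <- h3; rewrite e1 at 1; rewrite dot3_add_l, !dot3_scal_l; ring. }
assert (k21 : 0 = m21 W * dot3 x1 n1 + m22 W * dot3 x2 n1).
{ rewrite <- h3; rewrite dot3_sym; rewrite e2 at 1; rewrite dot3_add_l, !dot3_scal_l; ring. }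
assert (k22 : lam = m21 W * dot3 x1 n2 + m22 W * dot3 x2 n2).
{ rewrite <- h2; rewrite e2 at 1; rewrite dot3_add_l, !dot3_scal_l; ring. }
transitivity (m22 W * lam - m12 W * 0 + (m11 W * lam - m21 W * 0)); [|ring].
rewrite k11 at 1; rewrite k21 at 1; rewrite k22 at 1; rewrite k12 at 1; ring.
Qed.

(** If J is the Jacobian of the change of coordinates, W is replaced by
    J^{-1} W J. *)
Lemma weingarten_conjugate (x1 x2 n1 n2 : R3) (W : mat2) (a1 a2 b1 b2 : R) :
  a1 * b2 - b1 * a2 <> 0 ->
  add3 (scal3 a1 n1) (scal3 b1 n2) =
    add3 (scal3 (m11 W) (add3 (scal3 a1 x1) (scal3 b1 x2)))
         (scal3 (m12 W) (add3 (scal3 a2 x1) (scal3 b2 x2))) ->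
  add3 (scal3 a2 n1) (scal3 b2 n2) =
    add3 (scal3 (m21 W) (add3 (scal3 a1 x1) (scal3 b1 x2)))
         (scal3 (m22 W) (add3 (scal3 a2 x1) (scal3 b2 x2))) ->
  exists W', n1 = add3 (scal3 (m11 W') x1) (scal3 (m12 W') x2) /\
    n2 = add3 (scal3 (m21 W') x1) (scal3 (m22 W') x2) /\
    gauss_curv W' = gauss_curv W /\ m11 W' + m22 W' = m11 W + m22 W.
Proof.
destruct W as [w11 w12 w21 w22]; simpl; set (j := a1 * b2 - b1 * a2); intros nz h1 h2.
exists (Mat2
  ((b2 * (w11 * a1 + w12 * a2) - b1 * (w21 * a1 + w22 * a2)) / j)
  ((b2 * (w11 * b1 + w12 * b2) - b1 * (w21 * b1 + w22 * b2)) / j)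
  ((a1 * (w21 * a1 + w22 * a2) - a2 * (w11 * a1 + w12 * a2)) / j)
  ((a1 * (w21 * b1 + w22 * b2) - a2 * (w11 * b1 + w12 * b2)) / j)).
unfold gauss_curv; simpl.
assert (K : forall (N1 N2 X1 X2 : R),
  a1 * N1 + b1 * N2 = w11 * (a1 * X1 + b1 * X2) + w12 * (a2 * X1 + b2 * X2) ->
  a2 * N1 + b2 * N2 = w21 * (a1 * X1 + b1 * X2) + w22 * (a2 * X1 + b2 * X2) ->
  N1 = (b2 * (w11 * a1 + w12 * a2) - b1 * (w21 * a1 + w22 * a2)) / j * X1 +
       (b2 * (w11 * b1 + w12 * b2) - b1 * (w21 * b1 + w22 * b2)) / j * X2 /\
  N2 = (a1 * (w21 * a1 + w22 * a2) - a2 * (w11 * a1 + w12 * a2)) / j * X1 +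
       (a1 * (w21 * b1 + w22 * b2) - a2 * (w11 * b1 + w12 * b2)) / j * X2).
{ intros N1 N2 X1 X2 k1 k2; split; apply (Rmult_eq_reg_l j); auto.
  - transitivity (b2 * (a1 * N1 + b1 * N2) - b1 * (a2 * N1 + b2 * N2));
      [unfold j; ring | rewrite k1, k2; unfold j; field; exact nz].
  - transitivity (a1 * (a2 * N1 + b2 * N2) - a2 * (a1 * N1 + b1 * N2));
      [unfold j; ring | rewrite k1, k2; unfold j; field; exact nz]. }
assert (p1 := f_equal (fun v => Re (fst v)) h1); assert (p2 := f_equal (fun v => Im (fst v)) h1);
assert (p3 := f_equal (fun v : R3 => snd v) h1).
assert (q1 := f_equal (fun v => Re (fst v)) h2); assert (q2 := f_equal (fun v => Im (fst v)) h2);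
assert (q3 := f_equal (fun v : R3 => snd v) h2).
cbv beta in p1, p2, q1, q2;
rewrite ?add3_Re, ?scal3_Re, ?add3_Re, ?scal3_Re in p1, q1.
rewrite ?add3_Im, ?scal3_Im, ?add3_Im, ?scal3_Im in p2, q2.
simpl in p3, q3.
destruct (K _ _ _ _ p1 q1) as [r1 s1], (K _ _ _ _ p2 q2) as [r2 s2],
  (K _ _ _ _ p3 q3) as [r3 s3].
split; [|split; [|split]].
- apply R3_ext; rewrite ?add3_Re, ?add3_Im, ?scal3_Re, ?scal3_Im; auto.
- apply R3_ext; rewrite ?add3_Re, ?add3_Im, ?scal3_Re, ?scal3_Im; auto.
- unfold j; field; exact nz.
- unfold j; field; exact nz.
Qed.

Lemma smooth_on3_intro D Y : smooth_on D (fun z => Re (fst (Y z))) ->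
  smooth_on D (fun z => Im (fst (Y z))) -> smooth_on D (fun z => snd (Y z)) ->
  smooth_on3 D Y.
Proof. intros h1 h2 h3; split; [split|]; assumption. Qed.

Lemma smooth3_grad D Y z : open D -> smooth_on3 D Y -> D z ->
  has_grad3 Y z (D1 Y z) (D2 Y z).
Proof.
intros oD [[h1 h2] h3] Dz.
split; [|split]; apply (smooth_grad D); assumption.
Qed.

Lemma smooth3_D1 D Y : smooth_on3 D Y -> smooth_on3 D (D1 Y).
Proof.
intros [[h1 h2] h3]; split; [split|].
- exact (smooth_d1 _ _ h1).
- exact (smooth_d1 _ _ h2).
- exact (smooth_d1 _ _ h3).
Qed.

Lemma smooth3_D2 D Y : smooth_on3 D Y -> smooth_on3 D (D2 Y).
Proof.
intros [[h1 h2] h3]; split; [split|].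
- exact (smooth_d2 _ _ h1).
- exact (smooth_d2 _ _ h2).
- exact (smooth_d2 _ _ h3).
Qed.

Lemma smooth_dot D Y Z : open D -> smooth_on3 D Y -> smooth_on3 D Z ->
  smooth_on D (fun z => dot3 (Y z) (Z z)).
Proof.
intros oD [[h1 h2] h3] [[k1 k2] k3] k; unfold dot3, ip.
repeat apply Ck_plus; auto; apply Ck_mult; auto.
Qed.

Lemma smooth3_cross D Y Z : open D -> smooth_on3 D Y -> smooth_on3 D Z ->
  smooth_on3 D (fun z => cross3 (Y z) (Z z)).
Proof.
intros oD [[h1 h2] h3] [[k1 k2] k3]; split; [split|]; intros k; simpl;
  apply Ck_minus; auto; apply Ck_mult; auto; first [apply h1|apply h2|apply h3|apply k1|apply k2|apply k3].
Qed.

Lemma smooth3_scal D F Y : open D -> smooth_on D F -> smooth_on3 D Y ->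
  smooth_on3 D (fun z => scal3 (F z) (Y z)).
Proof.
intros oD hF [[h1 h2] h3]; apply smooth_on3_intro; intros k.
- apply (Ck_ext k D (fun z => F z * Re (fst (Y z)))); auto.
  + intros w _; now rewrite scal3_Re.
  + apply Ck_mult; auto.
- apply (Ck_ext k D (fun z => F z * Im (fst (Y z)))); auto.
  + intros w _; now rewrite scal3_Im.
  + apply Ck_mult; auto.
- apply Ck_mult; auto.
Qed.

Lemma smooth3_normal D Y : open D -> smooth_on3 D Y ->
  (forall z, D z -> regular_at Y z) -> smooth_on3 D (normal Y).
Proof.
intros oD hY reg.
assert (hc : smooth_on3 D (fun z => cross3 (D1 Y z) (D2 Y z)))
  by (apply smooth3_cross; auto using smooth3_D1, smooth3_D2).
assert (pos : forall z, D z -> 0 < dot3 (cross3 (D1 Y z) (D2 Y z)) (cross3 (D1 Y z) (D2 Y z))).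
{ intros z Dz; rewrite cross3_lagrange; apply regular_gram, reg, Dz. }
apply (smooth3_scal D (fun z => / norm3 (cross3 (D1 Y z) (D2 Y z)))); auto.
intros k; apply Ck_inv; auto.
- intros z Dz; apply Rgt_not_eq, sqrt_lt_R0, pos, Dz.
- apply (Ck_sqrt k D (fun z => dot3 (cross3 (D1 Y z) (D2 Y z)) (cross3 (D1 Y z) (D2 Y z))));
    auto; apply smooth_dot; auto.
Qed.

Lemma smooth3_comp (D D' : C -> Prop) Y (sigma : C -> C) : open D -> open D' ->
  smooth_onC D' sigma -> (forall w, D' w -> D (sigma w)) -> smooth_on3 D Y ->
  smooth_on3 D' (fun w => Y (sigma w)).
Proof.
intros oD oD' [s1 s2] maps [[h1 h2] h3].
assert (K : forall F, smooth_on D F -> smooth_on D' (fun w => F (sigma w))).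
{ intros F hF k; apply (Ck_ext k D' (fun w => F (Re (sigma w), Im (sigma w)))); auto.
  - intros w _; now rewrite C_eta.
  - apply (Ck_comp k D' D); auto; intros w hw; rewrite C_eta; auto. }
apply smooth_on3_intro; [apply (K _ h1) | apply (K _ h2) | apply (K _ h3)].
Qed.

Lemma weingarten_scal D Y N z W e : open D -> D z -> smooth_on3 D N ->
  is_weingarten Y N z W ->
  is_weingarten Y (fun w => scal3 e (N w)) z (scal_mat e W).
Proof.
intros oD Dz hN [h1 h2].
assert (g := has_grad3_scal (fun _ => e) N z 0 0 _ _ (has_grad_const e z)
  (smooth3_grad D N z oD hN Dz)).
unfold is_weingarten; rewrite (has_grad3_D1 _ _ _ _ g), (has_grad3_D2 _ _ _ _ g), h1, h2.
split; apply R3_ext;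
  rewrite ?add3_Re, ?add3_Im, ?scal3_Re, ?scal3_Im, ?add3_Re, ?add3_Im, ?scal3_Re, ?scal3_Im;
  simpl; ring.
Qed.

Lemma gauss_curv_scal e W : e ^ 2 = 1 -> gauss_curv (scal_mat e W) = gauss_curv W.
Proof.
intros he; unfold gauss_curv; simpl.
transitivity (e ^ 2 * (m11 W * m22 W - m12 W * m21 W)); [ring | rewrite he; ring].
Qed.

(** A kernel vector of the Jacobian would be a linear relation between the
    pulled back vectors. *)
Lemma pullback_jacobian (x1 x2 : R3) (a1 a2 b1 b2 : R) :
  (forall s t, add3 (scal3 s (add3 (scal3 a1 x1) (scal3 b1 x2)))
                    (scal3 t (add3 (scal3 a2 x1) (scal3 b2 x2))) = origin ->
     s = 0 /\ t = 0) ->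
  a1 * b2 - b1 * a2 <> 0.
Proof.
intros ind E.
assert (K : forall s t, s * a1 + t * a2 = 0 -> s * b1 + t * b2 = 0 -> s = 0 /\ t = 0).
{ intros s t h1 h2; apply ind.
  apply R3_ext; rewrite ?add3_Re, ?add3_Im, ?scal3_Re, ?scal3_Im, ?add3_Re, ?add3_Im,
    ?scal3_Re, ?scal3_Im; simpl.
  - transitivity ((s * a1 + t * a2) * Re (fst x1) + (s * b1 + t * b2) * Re (fst x2));
      [ring | rewrite h1, h2; ring].
  - transitivity ((s * a1 + t * a2) * Im (fst x1) + (s * b1 + t * b2) * Im (fst x2));
      [ring | rewrite h1, h2; ring].
  - transitivity ((s * a1 + t * a2) * snd x1 + (s * b1 + t * b2) * snd x2);
      [ring | rewrite h1, h2; ring]. }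
destruct (K b2 (- b1)) as [k1 k2]; [lra | lra |].
destruct (K a2 (- a1)) as [k3 k4]; [lra | lra |].
destruct (K 1 0) as [k5 _]; lra.
Qed.

(** Trace and determinant of W do not depend on the coordinates.  In coordinates
    tau in which the normal field M is conformal, [conformal_weingarten]
    eliminates W from the RT-relation. *)
Lemma RT_transfer (D : C -> Prop) (Y N X M : C -> R3) (tau : C -> C) (z : C) (W : mat2)
  (x1 x2 n1 n2 : R3) (a1 a2 b1 b2 lam : R) :
  open D -> D z -> regular_at Y z ->
  (forall w, D w -> Y w = X (tau w)) -> (forall w, D w -> N w = M (tau w)) ->
  is_weingarten Y N z W -> gauss_curv W <> 0 ->
  has_grad3 X (tau z) x1 x2 -> has_grad3 M (tau z) n1 n2 ->
  has_grad (fun w => Re (tau w)) z a1 a2 -> has_grad (fun w => Im (tau w)) z b1 b2 ->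
  dot3 n1 n1 = lam -> dot3 n2 n2 = lam -> dot3 n1 n2 = 0 -> lam <> 0 ->
  (RT_relation (Y z) (N z) W <->
   lam * (dot3 (Y z) (Y z) + dot3 (Y z) (N z) ^ 2)
     = dot3 (Y z) (N z) * (dot3 x1 n1 + dot3 x2 n2)).
Proof.
intros oD Dz reg hY hN [w1 w2] hK gX gM gA gB h1 h2 h3 hl.
assert (gY := has_grad3_comp X tau z _ _ _ _ _ _ gX gA gB).
apply (has_grad3_ext_on D _ Y) in gY; [|exact oD | exact Dz | intros; symmetry; auto].
assert (gN := has_grad3_comp M tau z _ _ _ _ _ _ gM gA gB).
apply (has_grad3_ext_on D _ N) in gN; [|exact oD | exact Dz | intros; symmetry; auto].
unfold regular_at in reg.
rewrite (has_grad3_D1 _ _ _ _ gY), (has_grad3_D2 _ _ _ _ gY) in reg, w1, w2.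
rewrite (has_grad3_D1 _ _ _ _ gN) in w1; rewrite (has_grad3_D2 _ _ _ _ gN) in w2.
assert (J := pullback_jacobian _ _ _ _ _ _ reg).
destruct (weingarten_conjugate x1 x2 n1 n2 W a1 a2 b1 b2 J w1 w2)
  as (W' & e1 & e2 & det & tr).
assert (cw := conformal_weingarten x1 x2 n1 n2 W' lam e1 e2 h1 h2 h3).
unfold RT_relation; rewrite <- det, <- tr; rewrite <- det in hK.
set (L := dot3 (Y z) (Y z) + dot3 (Y z) (N z) ^ 2); set (psi := dot3 (Y z) (N z)) in *.
split; intros h.
- apply (Rmult_eq_reg_l (gauss_curv W')); auto.
  transitivity (lam * (gauss_curv W' * L)); [ring | rewrite h].
  transitivity (psi * (lam * (m11 W' + m22 W'))); [ring | rewrite <- cw; ring].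
- apply (Rmult_eq_reg_l lam); auto.
  transitivity (gauss_curv W' * (lam * L)); [ring | rewrite h].
  transitivity (psi * (gauss_curv W' * (dot3 x1 n1 + dot3 x2 n2))); [ring | rewrite cw; ring].
Qed.

(** The RT-relation multiplied by EG - F^2, which eliminates W.  Unlike W, this is
    manifestly continuous in z. *)
Definition RT_poly (Y N : C -> R3) (z : C) : R :=
  let E := dot3 (D1 Y z) (D1 Y z) in let F := dot3 (D1 Y z) (D2 Y z) in
  let G := dot3 (D2 Y z) (D2 Y z) in
  let e11 := dot3 (D1 N z) (D1 Y z) in let e12 := dot3 (D1 N z) (D2 Y z) in
  let e21 := dot3 (D2 N z) (D1 Y z) in let e22 := dot3 (D2 N z) (D2 Y z) in
  (e11 * e22 - e12 * e21) * (dot3 (Y z) (Y z) + dot3 (Y z) (N z) * dot3 (Y z) (N z))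
  - dot3 (Y z) (N z) * (e11 * G - e12 * F - e21 * F + e22 * E).

Lemma RT_relation_poly Y N z W : regular_at Y z -> is_weingarten Y N z W ->
  (RT_relation (Y z) (N z) W <-> RT_poly Y N z = 0).
Proof.
intros reg [w1 w2]; assert (g := regular_gram Y z reg).
set (gr := dot3 (D1 Y z) (D1 Y z) * dot3 (D2 Y z) (D2 Y z) - dot3 (D1 Y z) (D2 Y z) ^ 2) in *.
assert (E : RT_poly Y N z = gr * (gauss_curv W * (dot3 (Y z) (Y z) + dot3 (Y z) (N z) ^ 2)
  - dot3 (Y z) (N z) * (m11 W + m22 W))).
{ unfold RT_poly; rewrite w1, w2, !dot3_add_l, !dot3_scal_l, (dot3_sym (D2 Y z) (D1 Y z)).
  unfold gr, gauss_curv; ring. }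
rewrite E; unfold RT_relation; split; intros h.
- rewrite h; ring.
- apply Rmult_integral in h; destruct h as [h|h]; lra.
Qed.

Lemma RT_poly_continuous D Y N z : open D -> smooth_on3 D Y -> smooth_on3 D N -> D z ->
  continuous (RT_poly Y N) z.
Proof.
intros oD hY hN Dz.
assert (hY1 := smooth3_D1 _ _ hY); assert (hY2 := smooth3_D2 _ _ hY).
assert (hN1 := smooth3_D1 _ _ hN); assert (hN2 := smooth3_D2 _ _ hN).
apply (Ck_continuous 0 D); auto; unfold RT_poly; cbv zeta.
repeat first [apply (smooth_dot D); assumption | apply Ck_minus; [exact oD| |]
  | apply Ck_plus; [exact oD| |] | apply Ck_mult; [exact oD| |]].
Qed.

(** * Represented surfaces are RT-surfaces *)

(** Both sides are h^2 (|f'|^2 + 2 lam), because A_1 + A_2 = |f'|^2. *)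
Lemma RT_representation_relation (U : C -> Prop) (f g : C -> C) (z : C) (x1 x2 : R3) :
  holomorphic_data U f g -> U z -> has_grad3 (RT_X f g) z x1 x2 ->
  let X := RT_X f g z in let N := RT_N g z in
  RT_lam g z * (dot3 X X + dot3 X N ^ 2)
    = dot3 X N * (dot3 x1 (RT_N1 g z) + dot3 x2 (RT_N2 g z)).
Proof.
intros data Uz hX X N.
destruct (RT_second_form U f g data z x1 x2 Uz hX) as (_ & _ & e11 & _ & _ & e22).
destruct (RT_support U f g data z Uz) as (s0 & s1 & s2).
assert (l := RT_lam_pos U f g data z Uz).
unfold X, N; rewrite (RT_parseval U f g z (RT_X f g z) (RT_X f g z) data Uz).
rewrite s0, s1, s2, e11, e22.
unfold RT_A1, RT_A2, ip.
destruct (RT_xi f g z) as [a b], (C_derive f z) as [p q]; simpl.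
field; now apply Rgt_not_eq.
Qed.

Lemma unit_normal_pullback (D : C -> Prop) (Y X : C -> R3) (tau : C -> C) (z : C)
  (x1 x2 n : R3) (a1 a2 b1 b2 : R) :
  open D -> D z -> (forall w, D w -> Y w = X (tau w)) ->
  has_grad3 X (tau z) x1 x2 ->
  has_grad (fun w => Re (tau w)) z a1 a2 -> has_grad (fun w => Im (tau w)) z b1 b2 ->
  unit_normal_at X (tau z) n -> unit_normal_at Y z n.
Proof.
intros oD Dz hY gX gA gB (h1 & h2 & h3).
assert (gY := has_grad3_comp X tau z _ _ _ _ _ _ gX gA gB).
apply (has_grad3_ext_on D _ Y) in gY; [|exact oD | exact Dz | intros; symmetry; auto].
rewrite (has_grad3_D1 _ _ _ _ gX) in h2; rewrite (has_grad3_D2 _ _ _ _ gX) in h3.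
unfold unit_normal_at; rewrite (has_grad3_D1 _ _ _ _ gY), (has_grad3_D2 _ _ _ _ gY).
rewrite !dot3_add_r, !dot3_scal_r, h2, h3; split; [exact h1 | split; ring].
Qed.

Lemma in_chart_transition {M : Type} (Y : M -> R3) (a b : chart M) (w : C) :
  overlap a b w ->
  Y (param a w) = Y (param b (transition a b w)) /\ cimg b (transition a b w).
Proof.
intros [h1 h2]; unfold transition; split.
- now rewrite param_coord.
- apply coord_img, h2.
Qed.

Lemma smoothC_grads D (F : C -> C) z : open D -> smooth_onC D F -> D z ->
  exists a1 a2 b1 b2, has_grad (fun w => Re (F w)) z a1 a2 /\
    has_grad (fun w => Im (F w)) z b1 b2.
Proof.
intros oD [h1 h2] Dz; do 4 eexists; split; apply (smooth_grad D); assumption.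
Qed.

Lemma unit_scalar_sign (x e : R) : x ^ 2 = 1 -> e ^ 2 = 1 -> 0 < x * e -> x = e.
Proof.
intros h1 h2 h3.
assert (h : (x - e) * (x + e) = 0) by (ring_simplify; lra).
apply Rmult_integral in h; destruct h as [h|h]; nra.
Qed.

Lemma dot3_origin_l (v : R3) : dot3 origin v = 0.
Proof. rewrite dot3_sym; apply dot3_origin_r. Qed.

Section Surface.

Variables (S : RiemannSurface) (X : S -> R3).
Hypothesis imm : immersion X.
Hypothesis curv : nonzero_curvature X.

Lemma chart_smooth i : smooth_on3 (cimg (atlas i)) (in_chart X (atlas i)).
Proof. apply imm. Qed.

Lemma chart_regular i z : cimg (atlas i) z -> regular_at (in_chart X (atlas i)) z.
Proof. apply imm. Qed.

Lemma chart_normal_smooth i : smooth_on3 (cimg (atlas i)) (normal (in_chart X (atlas i))).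
Proof.
apply smooth3_normal; [apply cimg_open | apply chart_smooth | intros z; apply chart_regular].
Qed.

Lemma chart_normal_unit i z : cimg (atlas i) z ->
  unit_normal_at (in_chart X (atlas i)) z (normal (in_chart X (atlas i)) z).
Proof. intros hz; apply normal_unit, chart_regular, hz. Qed.

Lemma RT_surface_poly : RT_surface X <->
  forall (i : index S) z, cimg (atlas i) z ->
    RT_poly (in_chart X (atlas i)) (normal (in_chart X (atlas i))) z = 0.
Proof.
split.
- intros H i z hz; destruct (H i z hz) as (W & hW & hK & hs).
  destruct (chart_normal_unit i z hz) as [hn _]; apply norm3_one in hn.
  apply (RT_relation_sphere _ _ _ hn hK) in hs.
  exact (proj1 (RT_relation_poly _ _ _ _ (chart_regular i z hz) hW) hs).
- intros H i z hz; destruct (curv i z hz) as (W & hW & hK).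
  destruct (chart_normal_unit i z hz) as [hn _]; apply norm3_one in hn.
  exists W; split; [exact hW | split; [exact hK|]].
  apply (RT_relation_sphere _ _ _ hn hK).
  exact (proj2 (RT_relation_poly _ _ _ _ (chart_regular i z hz) hW) (H i z hz)).
Qed.

Lemma atlas_transition_smooth (i j : index S) :
  smooth_onC (overlap (atlas i) (atlas j)) (transition (atlas i) (atlas j)).
Proof. apply holomorphic_smooth; [apply atlas_overlap | apply atlas_holomorphic]. Qed.

(** Near z the pulled back normal of the representation is a continuous
    multiple of the normal of the chart by a sign, hence a constant multiple;
    then [RT_transfer] applies. *)
Lemma represented_RT_poly (i : index S) (z : C) : cimg (atlas i) z ->
  locally_represented X (param (atlas i) z) ->
  RT_poly (in_chart X (atlas i)) (normal (in_chart X (atlas i))) z = 0.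
Proof.
intros hz (U & f & g & c & data & hc & himg & hdom & hrep).
set (Y := in_chart X (atlas i)).
destruct (hc i) as (oD & _ & sT & _).
set (D := overlap (atlas i) c) in *; set (tau := transition (atlas i) c) in *.
assert (Dz : D z) by (split; assumption).
assert (tU : forall w, D w -> U (tau w)).
{ intros w hw; apply himg, (in_chart_transition X (atlas i) c w hw). }
assert (hY : forall w, D w -> Y w = RT_X f g (tau w)).
{ intros w hw; destruct (hrep (tau w) (tU w hw)) as [h _]; rewrite <- h.
  apply (in_chart_transition X (atlas i) c w hw). }
assert (Dimg : forall w, D w -> cimg (atlas i) w) by (intros w [h _]; exact h).
assert (hun : forall w, D w -> unit_normal_at Y w (RT_N g (tau w))).
{ intros w hw; destruct (RT_X_differentiable U f g data (tau w) (tU w hw)) as (x1 & x2 & gX).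
  destruct (smoothC_grads D tau w oD sT hw) as (a1 & a2 & b1 & b2 & gA & gB).
  apply (unit_normal_pullback D Y (RT_X f g) tau w x1 x2 _ a1 a2 b1 b2); auto.
  apply (representation_formulas U f g data (tau w) (tU w hw)). }
destruct (RT_X_differentiable U f g data (tau z) (tU z Dz)) as (x1 & x2 & gX).
destruct (smoothC_grads D tau z oD sT Dz) as (a1 & a2 & b1 & b2 & gA & gB).
assert (gN := RT_N_grad U f g data (tau z) (tU z Dz)).
assert (gN' := has_grad3_comp (RT_N g) tau z _ _ _ _ _ _ gN gA gB).
assert (gn := smooth3_grad _ _ z (cimg_open _ (atlas i)) (chart_normal_smooth i) hz).
fold Y in gn.
set (sgn := fun w => dot3 (normal Y w) (RT_N g (tau w))).
assert (csgn : continuous sgn z)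
  by (eapply has_grad_continuous, has_grad_dot; [exact gn | exact gN']).
assert (hs : forall w, D w -> RT_N g (tau w) = scal3 (sgn w) (normal Y w) /\ sgn w ^ 2 = 1).
{ intros w hw; apply (unit_normal_unique Y w).
  - apply chart_regular; auto.
  - apply chart_normal_unit; auto.
  - apply hun, hw. }
set (e := sgn z).
assert (he : e ^ 2 = 1) by apply (hs z Dz).
destruct (continuous_pos_near (fun w => sgn w * e) z) as [r [rp hr]].
{ apply (continuous_mult (K := R_AbsRing) sgn (fun _ => e)); auto using continuous_const. }
{ fold e; nra. }
set (D' := fun w => square z r w /\ D w).
assert (oD' : open D') by (apply open_and; auto using square_is_open).
assert (D'z : D' z) by (split; [now apply square_center | exact Dz]).
assert (hN : forall w, D' w -> scal3 e (normal Y w) = RT_N g (tau w)).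
{ intros w [w1 w2]; destruct (hs w w2) as [k1 k2]; rewrite k1; f_equal; symmetry.
  apply unit_scalar_sign; auto; apply hr; left; apply square_sup_dist, w1. }
destruct (curv i z hz) as (W & hW & hK); fold Y in hW.
apply (RT_relation_poly _ _ _ W); [apply chart_regular, hz | exact hW|].
apply (RT_relation_sign _ _ _ e he).
destruct (RT_frame g (tau z)) as (_ & _ & _ & f1 & f2 & f3).
apply (RT_transfer D' Y (fun w => scal3 e (normal Y w)) (RT_X f g) (RT_N g) tau z _
  x1 x2 (RT_N1 g (tau z)) (RT_N2 g (tau z)) a1 a2 b1 b2 (RT_lam g (tau z))); auto.
- apply chart_regular, hz.
- intros w [_ hw]; auto.
- apply (weingarten_scal (cimg (atlas i))); auto using cimg_open.
  apply chart_normal_smooth.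
- rewrite gauss_curv_scal; assumption.
- apply Rgt_not_eq, (RT_lam_pos U f g data), tU, Dz.
- rewrite (hY z Dz), (hN z D'z).
  apply (RT_representation_relation U f g (tau z) x1 x2 data (tU z Dz) gX).
Qed.

Lemma unit_normal_chart_change (i j : index S) (w : C) (n : R3) :
  cimg (atlas i) w -> cdom (atlas j) (param (atlas i) w) ->
  unit_normal_at (in_chart X (atlas j)) (coord (atlas j) (param (atlas i) w)) n ->
  unit_normal_at (in_chart X (atlas i)) w n.
Proof.
intros h1 h2 hn.
set (tau := transition (atlas i) (atlas j)).
assert (ow : overlap (atlas i) (atlas j) w) by (split; assumption).
destruct (smoothC_grads _ tau w (atlas_overlap S i j) (atlas_transition_smooth i j) ow)
  as (a1 & a2 & b1 & b2 & gA & gB).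
assert (gX := smooth3_grad _ _ (tau w) (cimg_open _ (atlas j)) (chart_smooth j)
  (proj2 (in_chart_transition X _ _ w ow))).
refine (unit_normal_pullback _ _ _ tau w _ _ n a1 a2 b1 b2 (atlas_overlap S i j) ow _ gX gA gB hn).
intros v hv; apply (in_chart_transition X _ _ v hv).
Qed.

Lemma derive_nonzero_isolated (phi : R -> R) (x l : R) :
  is_derive phi x l -> l <> 0 -> phi x = 0 ->
  exists d, 0 < d /\ forall t, t <> x -> Rabs (t - x) < d -> phi t <> 0.
Proof.
intros hd nz h0; apply is_derive_Reals in hd.
destruct (hd (Rabs l)) as [d Hd]; [now apply Rabs_pos_lt|].
exists d; split; [apply cond_pos|]; intros t tx ht E.
specialize (Hd (t - x) ltac:(lra) ht).
replace (x + (t - x)) with t in Hd by ring.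
rewrite E, h0 in Hd; replace ((0 - 0) / (t - x) - l) with (- l) in Hd by (field; lra).
rewrite Rabs_Ropp in Hd; lra.
Qed.

Lemma limit_zero (phi : R -> R) (x d : R) : 0 < d -> continuous phi x ->
  (forall t, t <> x -> Rabs (t - x) < d -> phi t = 0) -> phi x = 0.
Proof.
intros dp cphi H; destruct (Req_dec (phi x) 0) as [h|h]; [exact h | exfalso].
assert (ep : 0 < Rabs (phi x)) by now apply Rabs_pos_lt.
destruct (cphi _ (locally_ball (phi x) (mkposreal _ ep))) as [e He].
assert (epos := cond_pos e).
set (s := Rmin d e / 2).
assert (m := Rmin_pos d e dp epos); assert (l1 := Rmin_l d e); assert (l2 := Rmin_r d e).
assert (sp : Rabs (x + s - x) < Rmin d e).
{ replace (x + s - x) with s by ring; unfold s; rewrite Rabs_pos_eq; lra. }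
specialize (He (x + s) ltac:(change (Rabs (x + s - x) < e); lra)).
change (Rabs (phi (x + s) - phi x) < Rabs (phi x)) in He.
rewrite H in He; [|unfold s; lra | lra].
rewrite Rminus_0_l, Rabs_Ropp in He; lra.
Qed.

(** If X = 0, then Lambda and Psi vanish.  Otherwise the normal is vertical at z.
    Since K <> 0, its derivative along the first coordinate line is not zero, and it is
    horizontal; so the nearby points of this line have a normal that is not
    vertical, are not exceptional, and satisfy the relation, which extends to z
    by continuity. *)
Lemma exceptional_RT_poly (i : index S) (z : C) : cimg (atlas i) z ->
  (forall p : S, ~ exceptional_point X p -> locally_represented X p) ->
  exceptional_point X (param (atlas i) z) ->
  RT_poly (in_chart X (atlas i)) (normal (in_chart X (atlas i))) z = 0.
Proof.
intros hz hrep hex; set (Y := in_chart X (atlas i)).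
destruct hex as [h0|[hpos [j [hj hn]]]].
{ unfold RT_poly; replace (Y z) with origin by (symmetry; exact h0).
  rewrite !dot3_origin_l; ring. }
set (south := (RtoC 0, -1) : R3) in *.
assert (zz : forall w : C, cimg (atlas i) w -> forall n,
  unit_normal_at Y w n -> n = south ->
  Re (fst (normal Y w)) = 0 /\ Im (fst (normal Y w)) = 0).
{ intros w hw n un ->.
  destruct (unit_normal_unique Y w south (normal Y w)) as [k _]; auto.
  - apply chart_regular, hw.
  - apply chart_normal_unit, hw.
  - rewrite k, scal3_Re, scal3_Im; simpl; split; ring. }
destruct (zz z hz south (unit_normal_chart_change i j z south hz hj hn) eq_refl) as [v1 v2].
assert (sn := chart_normal_smooth i); fold Y in sn.
assert (gn := smooth3_grad _ _ z (cimg_open _ (atlas i)) sn hz).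
destruct (curv i z hz) as (W & [w1 w2] & hK); fold Y in w1, w2.
assert (reg := chart_regular i z hz); fold Y in reg.
destruct (chart_normal_unit i z hz) as (u1 & _); fold Y in u1; apply norm3_one in u1.
assert (oC := cimg_open _ (atlas i)).
assert (hor : Re (fst (D1 (normal Y) z)) <> 0 \/ Im (fst (D1 (normal Y) z)) <> 0).
{ apply NNPP; intros nh; apply not_or_and in nh; destruct nh as [nh1 nh2].
  apply NNPP in nh1; apply NNPP in nh2.
  assert (perp : dot3 (normal Y z) (D1 (normal Y) z) = 0).
  { assert (g := has_grad_dot _ _ _ _ _ _ _ gn gn).
    apply (has_grad_ext_on (cimg (atlas i)) _ (fun _ => 1)) in g; auto.
    - destruct (has_grad_unique _ _ _ _ _ _ g (has_grad_const 1 z)) as [k _].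
      rewrite (dot3_sym (D1 (normal Y) z)) in k; lra.
    - intros w hw; apply norm3_one, (chart_normal_unit i w hw). }
  unfold dot3, ip in perp, u1; rewrite v1, v2 in perp, u1.
  assert (n3 : snd (D1 (normal Y) z) = 0) by nra.
  assert (n0 : D1 (normal Y) z = origin) by (apply R3_ext; simpl; assumption).
  rewrite n0 in w1; destruct (reg (m11 W) (m12 W)) as [m1 m2]; [now symmetry|].
  apply hK; unfold gauss_curv; rewrite m1, m2; ring. }
assert (iso : exists d, 0 < d /\ forall t, t <> Re z -> Rabs (t - Re z) < d ->
  Re (fst (normal Y (t, Im z))) <> 0 \/ Im (fst (normal Y (t, Im z))) <> 0).
{ destruct gn as (g1 & g2 & _); destruct z as [x y]; destruct hor as [h|h].
  - destruct (derive_nonzero_isolated (fun t => Re (fst (normal Y (t, y)))) x _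
      (has_grad_partial1 (fun w => Re (fst (normal Y w))) x y _ _ g1) h v1)
      as [d [dp Hd]]; exists d; auto.
  - destruct (derive_nonzero_isolated (fun t => Im (fst (normal Y (t, y)))) x _
      (has_grad_partial1 (fun w => Im (fst (normal Y w))) x y _ _ g2) h v2)
      as [d [dp Hd]]; exists d; auto. }
destruct iso as [d [dp Hd]].
destruct (open_contains_square _ z oC hz) as [r [rp sub]].
assert (sY := chart_smooth i); fold Y in sY.
assert (cpos : continuous (fun w => dot3 (Y w) south) z).
{ eapply has_grad_continuous, (has_grad_dot Y (fun _ => south) z _ _ origin origin);
    [exact (smooth3_grad _ _ z oC sY hz)|].
  split; [|split]; exact (has_grad_const _ z). }
destruct (continuous_pos_near _ z cpos hpos) as [r2 [r2p hr2]].
assert (cP := RT_poly_continuous _ Y (normal Y) z oC sY sn hz).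
destruct z as [x y]; simpl in Hd.
apply (limit_zero (fun t => RT_poly Y (normal Y) (t, y)) x (Rmin d (Rmin r r2))).
- repeat apply Rmin_pos; auto.
- apply (continuous_hor (RT_poly Y (normal Y))), cP.
- intros t tx ht.
  assert (l1 := Rmin_l d (Rmin r r2)); assert (l2 := Rmin_r d (Rmin r r2)).
  assert (l3 := Rmin_l r r2); assert (l4 := Rmin_r r r2).
  assert (yy : Rabs (y - y) = 0) by (now rewrite Rminus_diag, Rabs_R0).
  assert (hin : cimg (atlas i) (t, y)) by (apply sub; split; simpl; lra).
  apply (represented_RT_poly i (t, y) hin), hrep.
  intros [k|[_ [j' [k1 k2]]]].
  + assert (hp : 0 < dot3 (Y (t, y)) south) by (apply hr2, sup_dist_le; simpl; lra).
    unfold Y, in_chart in hp; rewrite k, dot3_origin_l in hp; lra.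
  + destruct (zz (t, y) hin south (unit_normal_chart_change i j' (t, y) south hin k1 k2)
      eq_refl) as [q1 q2].
    destruct (Hd t tx ltac:(lra)); tauto.
Qed.

Lemma represented_RT : (forall p : S, ~ exceptional_point X p -> locally_represented X p) ->
  RT_surface X.
Proof.
intros H; apply RT_surface_poly; intros i z hz.
destruct (classic (exceptional_point X (param (atlas i) z))) as [hx|hx].
- now apply exceptional_RT_poly.
- apply represented_RT_poly; auto.
Qed.

End Surface.

(** * RT-surfaces are represented *)

Lemma continuous_into_C {T : UniformSpace} (a b : T -> R) (t : T) :
  continuous a t -> continuous b t -> continuous (fun t => (a t, b t) : C) t.
Proof.
intros ha hb P [e He].
assert (h1 := ha _ (locally_ball (a t) e)); assert (h2 := hb _ (locally_ball (b t) e)).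
change (locally t (fun s => ball (a t) e (a s))) in h1.
change (locally t (fun s => ball (b t) e (b s))) in h2.
refine (filter_imp _ _ _ (filter_and _ _ h1 h2)); intros s [k1 k2].
exact (He (a s, b s) (conj k1 k2)).
Qed.

Lemma continuous_Re_comp {T : UniformSpace} (a : T -> C) (t : T) :
  continuous a t -> continuous (fun t => Re (a t)) t.
Proof.
intros h; apply (continuous_comp a Re); [exact h|].
eapply has_grad_continuous, has_grad_Re.
Qed.

Lemma continuous_Im_comp {T : UniformSpace} (a : T -> C) (t : T) :
  continuous a t -> continuous (fun t => Im (a t)) t.
Proof.
intros h; apply (continuous_comp a Im); [exact h|].
eapply has_grad_continuous, has_grad_Im.
Qed.

Lemma square_convex (c : C) (r s : R) (z w : C) : 0 <= s <= 1 ->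
  square c r z -> square c r w ->
  square c r ((1 - s) * Re z + s * Re w, (1 - s) * Im z + s * Im w).
Proof.
intros hs [z1 z2] [w1 w2]; unfold square; simpl.
assert (K : forall x y a, Rabs (x - a) < r -> Rabs (y - a) < r ->
  Rabs ((1 - s) * x + s * y - a) < r).
{ intros x y a h1 h2; apply Rabs_def2 in h1; apply Rabs_def2 in h2.
  assert (avg : forall p q, 0 < p -> 0 < q -> 0 < (1 - s) * p + s * q).
  { intros p q hp hq; destruct (Req_dec s 0) as [->|s0]; [lra|].
    assert (0 <= (1 - s) * p) by (apply Rmult_le_pos; lra).
    assert (0 < s * q) by (apply Rmult_lt_0_compat; lra); lra. }
  assert (u := avg (r - (x - a)) (r - (y - a)) ltac:(lra) ltac:(lra)).
  assert (l := avg (r + (x - a)) (r + (y - a)) ltac:(lra) ltac:(lra)).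
  apply Rabs_def1; lra. }
split; apply K; assumption.
Qed.

Lemma continuous_blend {T : UniformSpace} (s a b a' b' : T -> R) (t : T) :
  continuous s t -> continuous a t -> continuous b t ->
  continuous a' t -> continuous b' t ->
  continuous (fun t => ((1 - s t) * a t + s t * b t, (1 - s t) * a' t + s t * b' t) : C) t.
Proof.
intros hs ha hb ha' hb'.
assert (h1 : continuous (fun t => 1 - s t) t).
{ apply (continuous_minus (V := R_NormedModule) (fun _ => 1) s); auto using continuous_const. }
assert (blend : forall p q : T -> R, continuous p t -> continuous q t ->
  continuous (fun t => (1 - s t) * p t + s t * q t) t).
{ intros p q hp hq.
  apply (continuous_plus (V := R_NormedModule) (fun t => (1 - s t) * p t) (fun t => s t * q t)).
  - apply (continuous_mult (K := R_AbsRing) (fun t => 1 - s t) p); assumption.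
  - apply (continuous_mult (K := R_AbsRing) s q); assumption. }
apply continuous_into_C; apply blend; assumption.
Qed.

(** Straight segments give the paths and contract the loops. *)
Lemma square_simply_connected (c : C) (r : R) : 0 < r -> simply_connected (square c r).
Proof.
intros rp; split; [|split].
- exists c; now apply square_center.
- intros z w hz hw.
  exists (fun t => ((1 - t) * Re z + t * Re w, (1 - t) * Im z + t * Im w)).
  split; [split|split].
  + intros t; apply (continuous_blend (fun t => t) (fun _ => Re z) (fun _ => Re w)
      (fun _ => Im z) (fun _ => Im w)); auto using continuous_const, continuous_id.
  + intros t ht; apply square_convex; auto.
  + destruct z; simpl; f_equal; ring.
  + destruct w; simpl; f_equal; ring.
- intros gam [cg hg] loop.
  exists (fun st => ((1 - fst st) * Re (gam (snd st)) + fst st * Re (gam 0),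
                     (1 - fst st) * Im (gam (snd st)) + fst st * Im (gam 0))).
  split; [|split; [|split]].
  + intros [s t].
    assert (c1 : continuous (fst : R * R -> R) (s, t)) by apply continuous_fst.
    assert (c2 : continuous (fun st : R * R => gam (snd st)) (s, t)).
    { apply (continuous_comp (snd : R * R -> R) gam); [apply continuous_snd | apply cg]. }
    assert (c3 := continuous_Re_comp _ _ c2); assert (c4 := continuous_Im_comp _ _ c2).
    exact (continuous_blend _ _ (fun _ => Re (gam 0)) _ (fun _ => Im (gam 0)) _ c1 c3
      (continuous_const _ _) c4 (continuous_const _ _)).
  + intros s t hs ht; apply square_convex; auto; apply hg; auto; unfold in01; lra.
  + intros t ht; cbn [fst snd]; split.
    * destruct (gam t) as [x y]; simpl; f_equal; ring.
    * destruct (gam 0) as [x y]; simpl; f_equal; ring.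
  + intros s hs; cbn [fst snd]; rewrite <- loop; split;
      destruct (gam 0) as [x y]; simpl; f_equal; ring.
Qed.

Lemma id_derive (z : C) :
  @is_derive C_AbsRing C_NormedModule (fun w : C => w) z (RtoC 1).
Proof. apply grad_C_derive; [|exact (has_grad_Im z)]. eapply has_grad_eq; [apply has_grad_Re | |]; ring. Qed.

Lemma stereo_smooth D : open D -> smooth_on3 D stereo.
Proof.
intros oD; apply smooth_on3_intro; intros k; unfold stereo, vec; cbn [Re Im fst snd];
  (apply Ck_div; auto; [intros z _; exact (T_neq z) | |]).
all: repeat first [apply Ck_plus; [exact oD| |] | apply Ck_minus; [exact oD| |]
  | apply Ck_const; exact oD | apply Ck_opp; [exact oD|] | apply Ck_Re; exact oD | apply Ck_Im; exact oD
  | apply Ck_sq; [exact oD|] | apply Ck_mult; [exact oD| |] ].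
Qed.

Lemma stereo_a_smooth D : open D -> smooth_on3 D stereo_a.
Proof.
intros oD; assert (E : D1 stereo = stereo_a).
{ apply functional_extensionality; intros w.
  apply (has_grad3_D1 _ _ _ _ (stereo_grad w)). }
rewrite <- E; apply smooth3_D1, stereo_smooth, oD.
Qed.

Lemma stereo_b_smooth D : open D -> smooth_on3 D stereo_b.
Proof.
intros oD; assert (E : D2 stereo = stereo_b).
{ apply functional_extensionality; intros w.
  apply (has_grad3_D2 _ _ _ _ (stereo_grad w)). }
rewrite <- E; apply smooth3_D2, stereo_smooth, oD.
Qed.

(** The derivatives of psi = <Y, N> are <Y, N_1> and <Y, N_2> since Y_i is
    orthogonal to N, and by Gauss's formula
    <Y_1, N_1> + <Y_2, N_2> = Laplace(psi) + 8 psi / T^2.  The RT-relation then reads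
    psi Laplace(psi) = |grad psi|^2, so ln psi is harmonic.  It is the real part of
    a holomorphic f, and Y = RT_X f id because both have the same scalar products
    with the frame. *)
Lemma RT_envelope_representation (w0 : C) (r : R) (Y : C -> R3) :
  let U := square w0 r in
  0 < r -> smooth_on3 U Y ->
  (forall w, U w -> dot3 (D1 Y w) (stereo w) = 0 /\ dot3 (D2 Y w) (stereo w) = 0) ->
  (forall w, U w -> 0 < dot3 (Y w) (stereo w)) ->
  (forall w, U w -> 4 / (1 + Re w ^ 2 + Im w ^ 2) ^ 2 *
     (dot3 (Y w) (Y w) + dot3 (Y w) (stereo w) ^ 2) =
     dot3 (Y w) (stereo w) * (dot3 (D1 Y w) (stereo_a w) + dot3 (D2 Y w) (stereo_b w))) ->
  exists f, holomorphic_data U f (fun w => w) /\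
    forall w, U w -> Y w = RT_X f (fun w => w) w.
Proof.
intros U rp sY perp pos rt.
assert (oU : open U) by apply square_is_open.
set (psi := fun w => dot3 (Y w) (stereo w)).
set (pa := fun w => dot3 (Y w) (stereo_a w)).
set (pb := fun w => dot3 (Y w) (stereo_b w)).
assert (spsi : smooth_on U psi) by (apply smooth_dot; auto using stereo_smooth).
assert (spa : smooth_on U pa) by (apply smooth_dot; auto using stereo_a_smooth).
assert (spb : smooth_on U pb) by (apply smooth_dot; auto using stereo_b_smooth).
assert (gY := fun w => smooth3_grad U Y w oU sY).
assert (gpsi : forall w, U w -> has_grad psi w (pa w) (pb w)).
{ intros w hw; destruct (perp w hw) as [h1 h2].
  eapply has_grad_eq; [apply (has_grad_dot _ _ _ _ _ _ _ (gY w hw) (stereo_grad w)) | |].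
  - rewrite h1; unfold pa; ring.
  - rewrite h2; unfold pb; ring. }
set (u := fun w => ln (psi w)).
assert (nz : forall w, U w -> psi w <> 0) by (intros w hw; apply Rgt_not_eq, pos, hw).
assert (gu : forall w, U w -> has_grad u w (pa w / psi w) (pb w / psi w)).
{ intros w hw; eapply has_grad_eq; [apply (has_grad_comp1 ln psi w (/ psi w) (pa w) (pb w)); [|apply gpsi, hw] | |].
  - apply is_derive_Reals, derivable_pt_lim_ln, pos, hw.
  - unfold Rdiv; ring.
  - unfold Rdiv; ring. }
assert (C2 : Ck_on 2 U u).
{ apply (Ck_intro 1 U u (fun w => pa w / psi w) (fun w => pb w / psi w)); auto;
    apply Ck_div; auto. }
assert (u1 : forall w, U w -> pa w / psi w = d1 u w)
  by (intros w hw; symmetry; eapply has_grad_d1, gu, hw).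
assert (u2 : forall w, U w -> pb w / psi w = d2 u w)
  by (intros w hw; symmetry; eapply has_grad_d2, gu, hw).
assert (harm : forall w, U w -> d1 (d1 u) w + d2 (d2 u) w = 0).
{ intros w hw.
  rewrite <- (d1_ext_on U (fun w => pa w / psi w) (d1 u) w oU hw u1).
  rewrite <- (d2_ext_on U (fun w => pb w / psi w) (d2 u) w oU hw u2).
  assert (g1 := has_grad_div _ _ _ _ _ _ _ (nz w hw)
    (has_grad_dot _ _ _ _ _ _ _ (gY w hw) (stereo_a_grad w)) (gpsi w hw)).
  assert (g2 := has_grad_div _ _ _ _ _ _ _ (nz w hw)
    (has_grad_dot _ _ _ _ _ _ _ (gY w hw) (stereo_b_grad w)) (gpsi w hw)).
  fold pa in g1; fold pb in g2; change (dot3 (Y w) (stereo_a w)) with (pa w) in g1.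
  change (dot3 (Y w) (stereo_b w)) with (pb w) in g2.
  rewrite (has_grad_d1 _ _ _ _ g1), (has_grad_d2 _ _ _ _ g2).
  specialize (rt w hw); rewrite (stereo_decomp w (Y w)) in rt at 2.
  rewrite ?dot3_add_r, ?dot3_scal_r, ?dot3_add_r, ?dot3_scal_r.
  rewrite ?dot3_add_r, ?dot3_scal_r in rt.
  assert (p0 := nz w hw); assert (hT := T_neq w).
  change (dot3 (Y w) (stereo w)) with (psi w) in *.
  change (dot3 (Y w) (stereo_a w)) with (pa w) in *.
  change (dot3 (Y w) (stereo_b w)) with (pb w) in *.
  set (A := dot3 (D1 Y w) (stereo_a w)) in *; set (B := dot3 (D2 Y w) (stereo_b w)) in *.
  set (T := 1 + Re w ^ 2 + Im w ^ 2) in *.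
  assert (E : psi w * (A + B) = 8 / T ^ 2 * psi w ^ 2 + pa w ^ 2 + pb w ^ 2)
    by (rewrite <- rt; field; exact hT).
  transitivity ((psi w * (A + B) - (8 / T ^ 2 * psi w ^ 2 + pa w ^ 2 + pb w ^ 2)) / psi w ^ 2);
    [field; split; assumption | rewrite E; field; split; assumption]. }
destruct (harmonic_real_part u w0 r C2 harm) as (f & hf & hfu).
assert (hd : forall w : C, C_derive (fun w => w) w = RtoC 1)
  by (intros w; apply is_C_derive_unique, id_derive).
exists f; split.
- split; [exact oU | split; [now apply square_simply_connected | split; [exact hf | split]]].
  + intros w _; eexists; apply id_derive.
  + intros w _; rewrite hd; intros h; apply (f_equal Re) in h; simpl in h; lra.
- intros w hw; destruct (hfu w hw) as [f0 f1].
  assert (h1 : RT_h f w = psi w).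
  { transitivity (exp (u w)); [|apply exp_ln, pos, hw].
    unfold RT_h, ip; rewrite f0; apply (f_equal exp); simpl; ring. }
assert (nz1 : C_derive (fun w => w) w <> RtoC 0).
  { rewrite hd; intros h; apply (f_equal Re) in h; simpl in h; lra. }
  destruct (RT_X_dots f (fun w => w) w nz1) as (t0 & t1 & t2).
  rewrite hd, h1, f1, <- (u1 w hw), <- (u2 w hw) in *; simpl in t1, t2.
  rewrite (stereo_decomp w (Y w)), (stereo_decomp w (RT_X f (fun w => w) w)).
  rewrite t0, t1, t2.
  change (dot3 (Y w) (stereo w)) with (psi w); change (dot3 (Y w) (stereo_a w)) with (pa w);
  change (dot3 (Y w) (stereo_b w)) with (pb w).
  assert (p0 := nz w hw).
  f_equal; f_equal; apply (f_equal (fun t => scal3 t _)); apply (f_equal (Rmult _)); field; assumption.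
Qed.

Lemma open_positive (D : C -> Prop) (F : C -> R) : open D ->
  (forall z, D z -> continuous F z) -> open (fun z => D z /\ 0 < F z).
Proof.
intros oD cF; apply open_of_boxes; intros z [Dz pz].
destruct (open_contains_box D z oD Dz) as [e1 H1].
destruct (proj1 (continuous_eps F z) (cF z Dz) (mkposreal _ pz)) as [e2 H2].
assert (ep : 0 < Rmin e1 e2) by (apply Rmin_pos; apply cond_pos).
exists (mkposreal _ ep); simpl in *; intros w k1 k2.
assert (l1 := Rmin_l e1 e2); assert (l2 := Rmin_r e1 e2).
split; [apply H1; lra|].
specialize (H2 w ltac:(lra) ltac:(lra)); apply Rabs_def2 in H2; lra.
Qed.

Lemma open_preimage (D V : C -> Prop) (F : C -> C) : open D -> open V ->
  smooth_onC D F -> open (fun z => D z /\ V (F z)).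
Proof.
intros oD oV [s1 s2]; apply open_of_boxes; intros z [Dz vz].
destruct (open_contains_box D z oD Dz) as [e1 H1].
destruct (open_contains_box V (F z) oV vz) as [e H].
destruct (proj1 (continuous_eps _ z) (smooth_continuous D _ z s1 Dz) e) as [e2 H2].
destruct (proj1 (continuous_eps _ z) (smooth_continuous D _ z s2 Dz) e) as [e3 H3].
assert (ep : 0 < Rmin e1 (Rmin e2 e3)) by (repeat apply Rmin_pos; apply cond_pos).
exists (mkposreal _ ep); simpl; intros w k1 k2.
assert (l1 := Rmin_l e1 (Rmin e2 e3)); assert (l2 := Rmin_r e1 (Rmin e2 e3)).
assert (l3 := Rmin_l e2 e3); assert (l4 := Rmin_r e2 e3).
split; [apply H1; lra | apply H; [apply H2; lra | apply H3; lra]].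
Qed.

Lemma smoothC_sub (D D' : C -> Prop) F : (forall z, D' z -> D z) ->
  smooth_onC D F -> smooth_onC D' F.
Proof. intros sub [h1 h2]; split; intros k; apply (Ck_sub k D); auto. Qed.

Lemma smoothC_comp (D D' : C -> Prop) (G F : C -> C) : open D -> open D' ->
  (forall z, D z -> D' (F z)) -> smooth_onC D' G -> smooth_onC D F ->
  smooth_onC D (fun z => G (F z)).
Proof.
intros oD oD' maps [g1 g2] [f1 f2].
assert (K : forall H, smooth_on D' H -> smooth_on D (fun z => H (F z))).
{ intros H hH k; apply (Ck_ext k D (fun z => H (Re (F z), Im (F z)))); auto.
  - intros w _; now rewrite C_eta.
  - apply (Ck_comp k D D'); auto; intros w hw; rewrite C_eta; auto. }
split; [apply (K _ g1) | apply (K _ g2)].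
Qed.

Lemma stereo_inverse (n : R3) : dot3 n n = 1 -> 0 < 1 + snd n ->
  stereo (Re (fst n) / (1 + snd n), Im (fst n) / (1 + snd n)) = n.
Proof.
destruct n as [[a b] c]; unfold dot3, ip; simpl; intros h p.
assert (T : 1 + (a / (1 + c)) ^ 2 + (b / (1 + c)) ^ 2 = 2 / (1 + c)).
{ replace (1 + (a / (1 + c)) ^ 2 + (b / (1 + c)) ^ 2) with
    (((1 + c) ^ 2 + (a * a + b * b)) / (1 + c) ^ 2) by (field; lra).
  replace (a * a + b * b) with ((1 + c) * (1 - c)) by lra; field; lra. }
unfold stereo, vec; cbn [Re Im fst snd]; rewrite T.
assert (T' : 1 - (a / (1 + c)) ^ 2 - (b / (1 + c)) ^ 2 = 2 * c / (1 + c)).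
{ replace (1 - (a / (1 + c)) ^ 2 - (b / (1 + c)) ^ 2) with
    (2 - (1 + (a / (1 + c)) ^ 2 + (b / (1 + c)) ^ 2)) by ring.
  rewrite T; field; lra. }
rewrite T'; apply R3_ext; simpl; field; lra.
Qed.

Definition recoord {M : Type} (a : chart M) (V : C -> Prop) (U : C -> Prop)
  (F sigma : C -> C) (oU : open U) (Va : forall z, V z -> cimg a z)
  (FU : forall z, V z -> U (F z)) (sV : forall w, U w -> V (sigma w))
  (sF : forall z, V z -> sigma (F z) = z) (Fs : forall w, U w -> F (sigma w) = w) : chart M.
Proof.
refine (Chart M (fun q => cdom a q /\ V (coord a q)) U (fun q => F (coord a q))
  (fun w => param a (sigma w)) oU _ _ _ _).
- intros q [_ hq]; apply FU, hq.
- intros w hw; split.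
  + apply param_dom, Va, sV, hw.
  + rewrite coord_param; auto.
- intros q [h1 h2]; rewrite sF by assumption; apply param_coord, h1.
- intros w hw; rewrite coord_param; auto.
Defined.

Section Surface.

Variables (S : RiemannSurface) (X : S -> R3).
Hypothesis imm : immersion X.
Hypothesis curv : nonzero_curvature X.
Hypothesis RT : RT_surface X.

Lemma recoord_smooth (i : index S) V U F sigma oU Va FU sV sF Fs :
  open V -> smooth_onC V F -> smooth_onC U sigma ->
  smooth_chart S (recoord (atlas i) V U F sigma oU Va FU sV sF Fs).
Proof.
intros oV smF sms j; set (c := recoord _ _ _ _ _ _ _ _ _ _ _).
assert (tji := atlas_transition_smooth S j i); assert (tij := atlas_transition_smooth S i j).
assert (oji := atlas_overlap S j i); assert (oij := atlas_overlap S i j).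
assert (o1 : open (overlap (atlas j) c)).
{ apply (open_ext (fun z => overlap (atlas j) (atlas i) z /\
    V (transition (atlas j) (atlas i) z))).
  - intros z; unfold overlap, c, recoord, transition; simpl; tauto.
  - apply open_preimage; assumption. }
assert (o2 : open (overlap c (atlas j))).
{ apply (open_ext (fun w => U w /\ overlap (atlas i) (atlas j) (sigma w))).
  - intros w; unfold overlap, c, recoord; simpl; split; [tauto|].
    intros [h1 h2]; auto.
  - apply open_preimage; assumption. }
split; [exact o1 | split; [exact o2 | split]].
- change (smooth_onC (overlap (atlas j) c)
    (fun z => F (transition (atlas j) (atlas i) z))).
  apply (smoothC_comp _ V); auto.
  + intros z [_ [_ h]]; exact h.
  + apply (smoothC_sub (overlap (atlas j) (atlas i))); auto.
    intros z [h1 [h2 _]]; split; assumption.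
- change (smooth_onC (overlap c (atlas j))
    (fun w => transition (atlas i) (atlas j) (sigma w))).
  apply (smoothC_comp _ (overlap (atlas i) (atlas j))); auto.
  + intros w [h1 h2]; split; [apply Va, sV, h1 | exact h2].
  + apply (smoothC_sub U); auto; intros w [h _]; exact h.
Qed.

(** As p is not exceptional, the RT-relation excludes Psi = 0, since this would
    give Lambda = 0.  The sign of the unit normal N is chosen to make Psi positive; then
    N is not the south pole at p.  By K <> 0 the field N is an immersion, and its
    stereographic coordinate w is a chart around p, to which
    [RT_envelope_representation] applies. *)
Lemma RT_represented (p : S) : ~ exceptional_point X p -> locally_represented X p.
Proof.
intros nex; destruct (atlas_cover S p) as [i hp].
set (z0 := coord (atlas i) p).
assert (hz0 : cimg (atlas i) z0) by (apply coord_img, hp).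
assert (pz0 : param (atlas i) z0 = p) by (apply param_coord, hp).
set (Y := in_chart X (atlas i)).
assert (Yz0 : Y z0 = X p) by (unfold Y, in_chart; now rewrite pz0).
set (D := cimg (atlas i)) in *.
assert (oD : open D) by apply cimg_open.
assert (sY : smooth_on3 D Y) by apply (chart_smooth S X imm i).
assert (sn : smooth_on3 D (normal Y)) by apply (chart_normal_smooth S X imm i).
assert (reg : forall z, D z -> regular_at Y z) by apply (chart_regular S X imm i).
assert (un : forall z, D z -> unit_normal_at Y z (normal Y z))
  by apply (chart_normal_unit S X imm i).
assert (rel : forall z, D z -> exists W, is_weingarten Y (normal Y) z W /\
  gauss_curv W <> 0 /\ RT_relation (Y z) (normal Y z) W).
{ intros z hz; destruct (RT i z hz) as (W & hW & hK & hs).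
  exists W; split; [exact hW | split; [exact hK|]].
  apply (RT_relation_sphere _ _ _ (norm3_one _ (proj1 (un z hz))) hK); exact hs. }
assert (psi0 : dot3 (Y z0) (normal Y z0) <> 0).
{ intros h; destruct (rel z0 hz0) as (W & _ & hK & hr).
  unfold RT_relation in hr; rewrite h in hr.
  apply nex; left; rewrite <- Yz0; apply dot3_zero.
  apply (Rmult_eq_reg_l (gauss_curv W)); auto; lra. }
set (e := if Rlt_dec 0 (dot3 (Y z0) (normal Y z0)) then 1 else -1).
assert (he : e ^ 2 = 1) by (unfold e; destruct (Rlt_dec _ _); ring).
set (N := fun z => scal3 e (normal Y z)).
assert (sN : smooth_on3 D N).
{ apply (smooth3_scal D (fun _ => e)); auto; intros k; apply Ck_const, oD. }
assert (psi0p : 0 < dot3 (Y z0) (N z0)).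
{ unfold N, e; rewrite dot3_scal_r; destruct (Rlt_dec _ _); lra. }
assert (uN : forall z, D z -> unit_normal_at Y z (N z)).
{ intros z hz; destruct (un z hz) as (h1 & h2 & h3); apply norm3_one in h1.
  unfold N; split; [apply norm3_unit; rewrite dot3_scal_l, dot3_scal_r, h1; lra|].
  rewrite !dot3_scal_l, h2, h3; lra. }
assert (N1 : forall z, D z -> dot3 (N z) (N z) = 1)
  by (intros z hz; apply norm3_one, (uN z hz)).
assert (relN : forall z, D z -> exists W, is_weingarten Y N z W /\
  gauss_curv W <> 0 /\ RT_relation (Y z) (N z) W).
{ intros z hz; destruct (rel z hz) as (W & hW & hK & hr).
  exists (scal_mat e W); split; [|split].
  - apply (weingarten_scal D); assumption.
  - rewrite gauss_curv_scal; assumption.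
  - apply RT_relation_sign; assumption. }
assert (north0 : 0 < 1 + snd (N z0)).
{ destruct (Rlt_dec 0 (1 + snd (N z0))) as [h|h]; [exact h | exfalso; apply nex; right].
  assert (hn := N1 z0 hz0); unfold dot3, ip in hn.
  assert (s0 : snd (N z0) = -1) by nra.
  assert (S0 : N z0 = (RtoC 0, -1)).
  { rewrite s0 in hn; set (a := Re (fst (N z0))) in *; set (b := Im (fst (N z0))) in *.
    assert (a0 : a = 0) by nra; assert (b0 : b = 0) by nra.
    apply R3_ext; [exact a0 | exact b0 | exact s0]. }
  split.
  - rewrite <- Yz0, <- S0; exact psi0p.
  - exists i; split; [exact hp|]; rewrite <- S0; apply (uN z0 hz0). }
set (D0 := fun z => (D z /\ 0 < 1 + snd (N z)) /\ 0 < dot3 (Y z) (N z)).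
assert (s1 : smooth_on D (fun z => 1 + snd (N z))).
{ intros k; apply Ck_plus; auto using Ck_const; apply sN. }
assert (spsi : smooth_on D (fun z => dot3 (Y z) (N z))) by (apply smooth_dot; auto).
assert (oD0 : open D0).
{ apply (open_positive (fun z => D z /\ 0 < 1 + snd (N z)) (fun z => dot3 (Y z) (N z))).
  - apply (open_positive D (fun z => 1 + snd (N z)) oD).
    intros z hz; apply (smooth_continuous D); auto.
  - intros z [hz _]; apply (smooth_continuous D); auto. }
assert (D0z : D0 z0) by (split; [split|]; assumption).
set (P := fun z => Re (fst (N z)) / (1 + snd (N z))).
set (Q := fun z => Im (fst (N z)) / (1 + snd (N z))).
assert (nz0 : forall z, D0 z -> 1 + snd (N z) <> 0)
  by (intros z [[_ h] _]; apply Rgt_not_eq, h).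
assert (D0D : forall z, D0 z -> D z) by (intros z [[h _] _]; exact h).
assert (sP : smooth_on D0 P).
{ intros k; apply Ck_div; auto; apply (Ck_sub k D); auto; apply sN. }
assert (sQ : smooth_on D0 Q).
{ intros k; apply Ck_div; auto; apply (Ck_sub k D); auto; apply sN. }
assert (NF : forall z, D0 z -> stereo (P z, Q z) = N z).
{ intros z hz; apply stereo_inverse; [apply N1, D0D, hz | apply hz]. }
assert (gP := fun z => smooth_grad D0 P z oD0 sP).
assert (gQ := fun z => smooth_grad D0 Q z oD0 sQ).
assert (jac : d1 P z0 * d2 Q z0 - d2 P z0 * d1 Q z0 <> 0).
{ replace (d2 P z0 * d1 Q z0) with (d1 Q z0 * d2 P z0) by ring.
  assert (gN := has_grad3_comp stereo (fun z => (P z, Q z)) z0 _ _ _ _ _ _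
    (stereo_grad _) (gP z0 D0z) (gQ z0 D0z)).
  apply (has_grad3_ext_on D0 _ N) in gN; auto.
  apply (pullback_jacobian (stereo_a (P z0, Q z0)) (stereo_b (P z0, Q z0))).
  rewrite <- (has_grad3_D1 _ _ _ _ gN), <- (has_grad3_D2 _ _ _ _ gN).
  destruct (relN z0 hz0) as (W & [w1 w2] & hK & _); rewrite w1, w2; intros s t h.
  destruct (reg z0 hz0 (s * m11 W + t * m21 W) (s * m12 W + t * m22 W)) as [k1 k2].
  { rewrite <- h; apply R3_ext; rewrite ?add3_Re, ?add3_Im, ?scal3_Re, ?scal3_Im,
      ?add3_Re, ?add3_Im, ?scal3_Re, ?scal3_Im; simpl; ring. }
  unfold gauss_curv in hK; split; apply (Rmult_eq_reg_r (m11 W * m22 W - m12 W * m21 W)); auto.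
  - transitivity ((s * m11 W + t * m21 W) * m22 W - (s * m12 W + t * m22 W) * m21 W);
      [ring | rewrite k1, k2; ring].
  - transitivity ((s * m12 W + t * m22 W) * m11 W - (s * m11 W + t * m21 W) * m12 W);
      [ring | rewrite k1, k2; ring]. }
destruct (local_inverse D0 P Q z0 oD0 D0z sP sQ jac)
  as (V & r & sigma & rp & oV & Vz0 & VD & hV & hU & ssig).
set (F := fun z => (P z, Q z) : C) in *.
set (U := square (P z0, Q z0) r) in *.
assert (oU : open U) by apply square_is_open.
set (c := recoord (atlas i) V U F sigma oU (fun z h => D0D z (VD z h))
  (fun z h => proj1 (hV z h)) (fun w h => proj1 (hU w h))
  (fun z h => proj2 (hV z h)) (fun w h => proj2 (hU w h))).
assert (sF : smooth_onC V F).
{ split; intros k; [exact (Ck_sub k D0 V P VD (sP k)) | exact (Ck_sub k D0 V Q VD (sQ k))]. }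
set (Z := fun w => Y (sigma w)).
assert (sZ : smooth_on3 U Z).
{ apply (smooth3_comp D U Y sigma); auto; intros w hw; apply D0D, VD, hU, hw. }
assert (hN : forall w, U w -> N (sigma w) = stereo w).
{ intros w hw; destruct (hU w hw) as [h1 h2]; rewrite <- NF by auto.
  now rewrite h2. }
assert (hun : forall w, U w -> unit_normal_at Z w (stereo w)).
{ intros w hw; rewrite <- (hN w hw).
  destruct (hU w hw) as [h1 _]; assert (h2 := D0D _ (VD _ h1)).
  destruct (smoothC_grads U sigma w oU ssig hw) as (a1 & a2 & b1 & b2 & gA & gB).
  apply (unit_normal_pullback U Z Y sigma w _ _ _ a1 a2 b1 b2 oU hw
    (fun _ _ => eq_refl) (smooth3_grad D Y _ oD sY h2) gA gB (uN _ h2)). }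
destruct (RT_envelope_representation (P z0, Q z0) r Z rp sZ) as (f & data & hf).
- intros w hw; destruct (hun w hw) as (_ & h2 & h3).
  now rewrite !(dot3_sym _ (stereo w)).
- intros w hw; unfold Z; rewrite <- (hN w hw); apply (VD _ (proj1 (hU w hw))).
- intros w hw; destruct (hU w hw) as [h1 h2].
  assert (h0 := VD _ h1); assert (hD := D0D _ h0).
  destruct (relN _ hD) as (W & hW & hK & hr).
  destruct (stereo_frame w) as (_ & _ & _ & f1 & f2 & f3).
  assert (gZ := smooth3_grad U Z w oU sZ hw).
  assert (gst := stereo_grad w).
  change (F (sigma w) = w) in h2; rewrite <- h2 in gZ at 1; rewrite <- h2 in gst at 1.
  assert (hZ : forall v, V v -> Y v = Z (F v))
    by (intros v hv; exact (f_equal Y (eq_sym (proj2 (hV v hv))))).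
  assert (hst : forall v, V v -> N v = stereo (F v))
    by (intros v hv; exact (eq_sym (NF v (VD v hv)))).
  assert (hl : 4 / (1 + Re w ^ 2 + Im w ^ 2) ^ 2 <> 0)
    by (apply Rgt_not_eq, Rdiv_lt_0_compat; [lra | apply pow_lt, T_pos]).
  assert (T := RT_transfer V Y N Z stereo F (sigma w) W _ _ _ _ _ _ _ _ _ oV h1
    (reg _ hD) hZ hst hW hK gZ gst (gP _ h0) (gQ _ h0) f1 f2 f3 hl).
  assert (R0 := proj1 T hr); rewrite (hN w hw) in R0; exact R0.
- exists U, f, (fun w => w), c; split; [exact data | split; [|split; [|split]]].
  + apply recoord_smooth; assumption.
  + intros z; reflexivity.
  + split; [exact hp | exact Vz0].
  + intros w hw; split.
    * exact (hf w hw).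
    * rewrite RT_N_stereo; exact (hun w hw).
Qed.

End Surface.

Theorem theorem2p5 :
  (forall (S : RiemannSurface) (X : S -> R3),
     immersion X -> nonzero_curvature X ->
     (RT_surface X <->
      forall p : S, ~ exceptional_point X p -> locally_represented X p))
  /\
  (forall (U : C -> Prop) (f g : C -> C), holomorphic_data U f g ->
   forall z : C, U z ->
     let X := RT_X f g in
     let N := RT_N g in
     let h := RT_h f z in
     let T := RT_T g z in
     let f' := C_derive f z in
     let g' := C_derive g z in
     let xi := RT_xi f g z in
     let A1 := RT_A1 f g z in
     let A2 := RT_A2 f g z in
     let B := RT_B f g z in
     unit_normal_at X z (N z) /\
     (regular_at X z <->
      T ^ 4 * ip xi (f' ^ 2 - xi)%C + 4 * T ^ 2 * Cmod f' ^ 2 * Cmod g' ^ 2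
        + 16 * Cmod g' ^ 4 <> 0) /\
     coefE X z =
       h ^ 2 * (T ^ 2 / (4 * Cmod g' ^ 2) * (A1 ^ 2 + B ^ 2) + 2 * A1
                + 4 * Cmod g' ^ 2 / T ^ 2) /\
     coefF X z = h ^ 2 * (T ^ 2 * Cmod f' ^ 2 / (4 * Cmod g' ^ 2) + 2) * B /\
     coefG X z =
       h ^ 2 * (T ^ 2 / (4 * Cmod g' ^ 2) * (A2 ^ 2 + B ^ 2) + 2 * A2
                + 4 * Cmod g' ^ 2 / T ^ 2) /\
     coefb11 X N z = h * A1 + 4 * h * Cmod g' ^ 2 / T ^ 2 /\
     coefb12 X N z = h * B /\
     coefb22 X N z = h * A2 + 4 * h * Cmod g' ^ 2 / T ^ 2).
Proof.
split.
- intros S X imm curv; split.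
  + intros RT p; exact (RT_represented S X imm RT p).
  + exact (represented_RT S X imm curv).
- exact representation_formulas.
Qed.
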